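(* Let $t\in[0,1)$. (i) $[V_{g_t},A(\mathbb{D})]=[C_t,A(\mathbb{D})]$ as Banach spaces. (ii) $H^\infty$ is a proper subspace of $[C_t,A(\mathbb{D})]$. (iii) $H^1\subseteq[C_t,A(\mathbb{D})]\subseteq A^{-1}_0$. (iv) $H^1\subseteq[C_t,H^\infty]\subseteq A^{-1}$.
   Context: $\mathbb{D}=\{z\in\mathbb{C}:|z|<1\}$; $H(\mathbb{D})$ is the Fréchet space of all analytic functions on $\mathbb{D}$ with the topology of uniform convergence on compact sets; $H^1$ and $H^\infty$ are the classical Hardy spaces on $\mathbb{D}$; $A(\mathbb{D})$ is the disc algebra (functions in $H(\mathbb{D})$ extending continuously to $\overline{\mathbb{D}}$, with the sup-norm). $A^{-1}:=\{f\in H(\mathbb{D}):\sup_{z\in\mathbb{D}}(1-|z|)|f(z)|<\infty\}$ and $A^{-1}_0:=\{f\in H(\mathbb{D}):\lim_{|z|\to1^-}(1-|z|)|f(z)|=0\}$. For $t\in(0,1]$ let $g_t(z):=-\frac{\mathrm{Log}(1-tz)}{t}$ and let $g_0(z):=z$, for $z\in\mathbb{D}$. Thus $(V_{g_t}f)(z)=\int_0^z\frac{f(\xi)}{1-t\xi}\,d\xi$, and the generalized Cesàro operator $C_t$ is $(C_tf)(z):=\frac1z\int_0^z\frac{f(\xi)}{1-t\xi}\,d\xi$ for $z\in\mathbb{D}\setminus\{0\}$, $(C_tf)(0):=f(0)$, for $f\in H(\mathbb{D})$. For $X$ a Banach space continuously included in $H(\mathbb{D})$ and $T\colon H(\mathbb{D})\to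 H(\mathbb{D})$ continuous linear with $T(X)\subseteq X$, the optimal domain is $[T,X]:=\{f\in H(\mathbb{D}):Tf\in X\}$ with (semi-)norm $\|f\|_{[T,X]}:=\|Tf\|_X$. Equality ''as Banach spaces'' means equality as linear subspaces of $H(\mathbb{D})$ with equivalent complete norms. *)

(* Defs.v *)
(* Stdlib reals with Coquelicot.

   A function on the unit disc is represented by a total function C -> C whose
   values off the disc are irrelevant: membership in each space below and each
   norm depend only on the values on the disc, and two such functions are the
   same element when they agree there. *)
From Stdlib Require Import Reals.
From Coquelicot Require Import Coquelicot.

Open Scope R_scope.
Open Scope C_scope.

Definition unit_disc (z : C) : Prop := (Cmod z < 1)%R.

Definition closed_disc (z : C) : Prop := (Cmod z <= 1)%R.

Definition eq_disc (f g : C -> C) : Prop := forall z, unit_disc z -> f z = g z.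

Definition analytic (f : C -> C) : Prop :=
  forall z : C, unit_disc z -> @ex_derive C_AbsRing C_NormedModule f z.

Definition fzero : C -> C := fun _ => 0.
Definition fadd (f g : C -> C) : C -> C := fun z => f z + g z.
Definition fsub (f g : C -> C) : C -> C := fun z => f z - g z.
Definition fscal (a : C) (f : C -> C) : C -> C := fun z => a * f z.

Definition linear_subspace (E : (C -> C) -> Prop) : Prop :=
  (forall f, E f -> analytic f) /\
  E fzero /\
  (forall f g, E f -> E g -> E (fadd f g)) /\
  (forall a f, E f -> E (fscal a f)).

Definition contained (E F : (C -> C) -> Prop) : Prop := forall f, E f -> F f.

Definition same_functions (E F : (C -> C) -> Prop) : Prop :=
  forall f, E f <-> F f.

Definition proper_subspace (E F : (C -> C) -> Prop) : Prop :=
  linear_subspace E /\ linear_subspace F /\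
  contained E F /\ ~ same_functions E F.

(* [fs_norm] is meaningful only on elements of the carrier. *)
Record fun_space := FunSpace {
  fs_mem :> (C -> C) -> Prop;
  fs_norm : (C -> C) -> R
}.

Definition norm_axioms (X : fun_space) : Prop :=
  (forall f, X f -> (0 <= fs_norm X f)%R) /\
  (forall f, X f -> (fs_norm X f = 0%R <-> eq_disc f fzero)) /\
  (forall a f, X f -> fs_norm X (fscal a f) = (Cmod a * fs_norm X f)%R) /\
  (forall f g, X f -> X g ->
     (fs_norm X (fadd f g) <= fs_norm X f + fs_norm X g)%R).

Definition complete_norm (X : fun_space) : Prop :=
  forall u : nat -> C -> C,
    (forall n, X (u n)) ->
    (forall eps : R, (0 < eps)%R -> exists N : nat,
       forall m n : nat, (N <= m)%nat -> (N <= n)%nat ->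
         (fs_norm X (fsub (u m) (u n)) < eps)%R) ->
    exists f, X f /\ is_lim_seq (fun n => fs_norm X (fsub (u n) f)) 0%R.

Definition banach (X : fun_space) : Prop :=
  linear_subspace X /\ norm_axioms X /\ complete_norm X.

Definition equivalent_norms (X Y : fun_space) : Prop :=
  exists a b : R, (0 < a)%R /\ (0 < b)%R /\
    forall f, X f ->
      (a * fs_norm X f <= fs_norm Y f)%R /\
      (fs_norm Y f <= b * fs_norm X f)%R.

Definition equal_as_banach_spaces (X Y : fun_space) : Prop :=
  banach X /\ banach Y /\ same_functions X Y /\ equivalent_norms X Y.

(* On unbounded functions [real] returns the junk value 0. *)
Definition sup_norm (f : C -> C) : R :=
  real (Lub_Rbar (fun x : R => exists z : C, unit_disc z /\ x = Cmod (f z))).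

Definition hardy_infty : fun_space :=
  FunSpace
    (fun f => analytic f /\
       exists M : R, forall z, unit_disc z -> (Cmod (f z) <= M)%R)
    sup_norm.

Definition disc_algebra : fun_space :=
  FunSpace
    (fun f => analytic f /\
       exists F : C -> C, eq_disc F f /\
         forall z : C, closed_disc z ->
           filterlim F (within closed_disc (locally z)) (locally (F z)))
    sup_norm.

Definition integral_mean (f : C -> C) (r : R) : R :=
  (/ (2 * PI) *
   RInt (fun theta : R => Cmod (f (r * cos theta, r * sin theta)%R))
     0 (2 * PI))%R.

Definition hardy_one (f : C -> C) : Prop :=
  analytic f /\
  exists M : R, forall r : R, (0 <= r < 1)%R -> (integral_mean f r <= M)%R.

Definition growth_space (f : C -> C) : Prop :=
  analytic f /\
  exists M : R, forall z, unit_disc z -> ((1 - Cmod z) * Cmod (f z) <= M)%R.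

Definition little_growth_space (f : C -> C) : Prop :=
  analytic f /\
  forall eps : R, (0 < eps)%R -> exists delta : R, (0 < delta)%R /\
    forall z, unit_disc z -> (1 - delta < Cmod z)%R ->
      ((1 - Cmod z) * Cmod (f z) < eps)%R.

(* Complex line integral over the segment from 0 to z. *)
Definition integral_from_0 (f : C -> C) (z : C) : C :=
  z * @RInt C_R_CompleteNormedModule (fun s : R => f (RtoC s * z)) 0%R 1%R.

(* Principal argument, with values in (-PI, PI] and junk value 0 at 0. *)
Definition Arg (w : C) : R :=
  match total_order_T (fst w) 0 with
  | inleft (left _) =>
      if Rle_dec 0 (snd w)
      then (atan (snd w / fst w) + PI)%R
      else (atan (snd w / fst w) - PI)%R
  | inleft (right _) =>
      match total_order_T (snd w) 0 with
      | inleft (left _) => (- (PI / 2))%R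
      | inleft (right _) => 0%R
      | inright _ => (PI / 2)%R
      end
  | inright _ => atan (snd w / fst w)
  end.

Definition Log (w : C) : C := (ln (Cmod w), Arg w).

Definition g_log (t : R) (z : C) : C :=
  if Req_EM_T t 0 then z else - (Log (1 - RtoC t * z) / RtoC t).

Definition volterra_op (g : C -> C) (f : C -> C) : C -> C :=
  integral_from_0 (fun xi => f xi * C_derive g xi).

Definition cesaro_op (t : R) (f : C -> C) (z : C) : C :=
  if Ceq_dec z 0 then f 0
  else / z * integral_from_0 (fun xi => f xi / (1 - RtoC t * xi)) z.

Definition optimal_domain (T : (C -> C) -> C -> C) (X : fun_space) : fun_space :=
  FunSpace (fun f => analytic f /\ X (T f)) (fun f => fs_norm X (T f)).

(* Main.v *)
(* Goursat's lemma gives every analytic f a primitive V on the disc.  The difference quotient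
   of V at a point is again analytic, so Cauchy's theorem on circles yields Cauchy's formula and
   the power series of V, hence of f = V'.  If f / (1 - t z) = sum (n + 1) v_(n+1) z^n, then
   V_g f = sum v_n z^n with v_0 = 0 and C_t f = sum v_(n+1) z^n, so V_g f = z C_t f: the two
   operators map into the disc algebra simultaneously, with comparable sup-norms, and a Cauchy
   sequence in the norm has uniformly convergent coefficients.  The growth conditions are the
   Cauchy estimate for (V_g f)' on the disc of radius 1 - |z| about z, combined for the disc
   algebra with uniform continuity.  For f in H^1, Hardy's inequality
   sum |a_n| / (n + 1) <= 8 ||h||_1 for h = f / (1 - t z) makes the series of C_t f absolutely
   convergent on the closed disc.  It is proved for polynomials P by dividing out the Blaschke
   product of the zeros in the disc and taking the square root of the rest: P = b k with the
   H^2 norms of b and k at most ||P||_1^(1/2), and then Hilbert's inequality bounds the Cauchy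
   product of the coefficients. *)
Require Import Defs.
From Stdlib Require Import Reals Lra Lia Psatz ClassicalEpsilon List.
From Coquelicot Require Import Coquelicot.
Local Open Scope R_scope.

(** * Limits and complex derivatives *)

(** [analytic] supplies only a derivative at each point, with no continuity of that derivative, so
    Cauchy's theorem has to start from Goursat's bisection. This also explains the detour through
    the primitive [V]: the difference quotient of f at w is not visibly differentiable at w, whereas
    that of [V] is a mean of f over a segment and inherits the first-order expansion of f.

    The disc algebra is handled through uniform continuity on the open disc, which makes no mention
    of an extension. Since 1 - t <= |1 - t z| <= 2, passing between f and f / (1 - t z) costs only
    constants.

    Hardy's inequality is reached without boundary values or infinite Blaschke products: a
    polynomial has finitely many zeros, a dilate of h is a uniform limit of its Taylor polynomials
    on the circle, and every passage r -> 1 is made in a finite sum with an error linear in 1 - r.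
    The constant 8 is 4 for each of the two factors b and k; the 4 is half of the bound 8 for the
    weighted row sums of the Hilbert matrix, the half coming from 2 x y <= x^2 + y^2. *)

Definition clim {T : Type} (F : (T -> Prop) -> Prop) (f : T -> C) (l : C) : Prop :=
  forall eps, 0 < eps -> F (fun x => Cmod (f x - l) < eps).

Notation near z := (@locally C_UniformSpace z).

#[global] Instance locally_C_filter (z : C) : @Filter C (near z).
Proof. apply filter_filter. Qed.

#[global] Instance locally_R_filter (s : R) : @Filter R (@locally R_UniformSpace s).
Proof. apply filter_filter. Qed.

(** As a product uniform space [C] has square neighbourhoods; round discs generate the same filter,
    so limits can be estimated with [Cmod]. *)
Lemma locally_disc (z : C) (P : C -> Prop) :
  @locally C_UniformSpace z P <->
  exists d, 0 < d /\ forall w, Cmod (w - z) < d -> P w.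
Proof.
  rewrite (locally_C z P). split.
  - intros [d Hd]. exists d. split; [apply d|]. intros w Hw. now apply Hd.
  - intros [d [d0 Hd]]. exists (mkposreal d d0). intros w Hw. now apply Hd.
Qed.

Lemma locally_real (s : R) (P : R -> Prop) :
  locally s P <-> exists d, 0 < d /\ forall x, Rabs (x - s) < d -> P x.
Proof.
  split.
  - intros [d Hd]. exists d. split; [apply d|]. intros w Hw. now apply Hd.
  - intros [d [d0 Hd]]. exists (mkposreal d d0). intros w Hw. now apply Hd.
Qed.

Lemma clim_filterlim {T : Type} (F : (T -> Prop) -> Prop) (FF : Filter F) f l :
  clim F f l <-> filterlim f F (near l).
Proof.
  split.
  - intros H P HP. apply locally_disc in HP. destruct HP as [d [d0 Hd]].
    unfold filtermap. generalize (H d d0). apply filter_imp. intros x. apply Hd.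
  - intros H eps He. apply (H (fun y => Cmod (y - l) < eps)).
    apply locally_disc. exists eps. split; auto.
Qed.

Lemma clim_filterlim_abs {T : Type} (F : (T -> Prop) -> Prop) (FF : Filter F) f l :
  clim F f l <-> filterlim f F (@locally (AbsRing_UniformSpace C_AbsRing) l).
Proof.
  rewrite (clim_filterlim F FF). split; intros H P HP; apply (H P); now apply locally_C.
Qed.

Lemma clim_const {T : Type} (F : (T -> Prop) -> Prop) {FF : Filter F} (c : C) :
  clim F (fun _ => c) c.
Proof.
  intros eps He. apply filter_forall. intros _.
  replace (c - c)%C with (RtoC 0) by ring. now rewrite Cmod_0.
Qed.

Lemma clim_plus {T : Type} (F : (T -> Prop) -> Prop) {FF : Filter F} f g a b :
  clim F f a -> clim F g b -> clim F (fun x => f x + g x)%C (a + b)%C.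
Proof.
  intros Hf Hg eps He.
  assert (He2 : 0 < eps / 2) by lra.
  generalize (filter_and _ _ (Hf _ He2) (Hg _ He2)).
  apply filter_imp. intros x [H1 H2].
  replace (f x + g x - (a + b))%C with ((f x - a) + (g x - b))%C by ring.
  eapply Rle_lt_trans; [apply Cmod_triangle|]. lra.
Qed.

Lemma clim_mult {T : Type} (F : (T -> Prop) -> Prop) {FF : Filter F} f g a b :
  clim F f a -> clim F g b -> clim F (fun x => f x * g x)%C (a * b)%C.
Proof.
  rewrite !(clim_filterlim_abs F FF). intros Hf Hg.
  eapply filterlim_comp_2; [exact Hf|exact Hg|].
  exact (@filterlim_mult C_AbsRing a b).
Qed.

Lemma clim_opp {T : Type} (F : (T -> Prop) -> Prop) {FF : Filter F} f a :
  clim F f a -> clim F (fun x => - f x)%C (- a)%C.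
Proof.
  intros H eps He. generalize (H eps He). apply filter_imp. intros x Hx.
  replace (- f x - - a)%C with (- (f x - a))%C by ring. now rewrite Cmod_opp.
Qed.

Lemma clim_minus {T : Type} (F : (T -> Prop) -> Prop) {FF : Filter F} f g a b :
  clim F f a -> clim F g b -> clim F (fun x => f x - g x)%C (a - b)%C.
Proof. intros Hf Hg. exact (clim_plus F f _ a _ Hf (clim_opp F g b Hg)). Qed.

Lemma Cmod_rev (a b : C) : Cmod a - Cmod b <= Cmod (a - b).
Proof.
  assert (H := Cmod_triangle (a - b) b). replace (a - b + b)%C with a in H by ring. lra.
Qed.

Lemma Cmod_sym (a b : C) : Cmod (a - b) = Cmod (b - a).
Proof. rewrite <- Cmod_opp. f_equal. ring. Qed.

Lemma Rlt_Rmin x a b : x < Rmin a b -> x < a /\ x < b.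
Proof. intros H. split; eapply Rlt_le_trans; [exact H|apply Rmin_l|exact H|apply Rmin_r]. Qed.

Lemma clim_inv {T : Type} (F : (T -> Prop) -> Prop) {FF : Filter F} f (a : C) :
  a <> 0%C -> clim F f a -> clim F (fun x => / f x)%C (/ a)%C.
Proof.
  intros Ha H eps He. assert (Hp : 0 < Cmod a) by exact (proj1 (Cmod_gt_0 _) Ha).
  assert (He' : 0 < eps * (Cmod a * (Cmod a / 2))) by (repeat apply Rmult_lt_0_compat; lra).
  assert (Hp2 : 0 < Cmod a / 2) by lra.
  generalize (filter_and _ _ (H _ Hp2) (H _ He')).
  apply filter_imp. intros x [H1 H2].
  assert (Hx : Cmod a / 2 < Cmod (f x)).
  { assert (H3 := Cmod_rev a (f x)). rewrite Cmod_sym in H3. lra. }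
  assert (Hf : f x <> 0%C) by (apply Cmod_gt_0; lra).
  replace (/ f x - / a)%C with ((a - f x) / (a * f x))%C by (field; auto).
  rewrite Cmod_div by now apply Cmult_neq_0.
  rewrite Cmod_sym, Cmod_mult. apply Rmult_lt_reg_r with (Cmod a * Cmod (f x)).
  { apply Rmult_lt_0_compat; lra. }
  unfold Rdiv. rewrite Rmult_assoc, Rinv_l, Rmult_1_r.
  2: { apply Rgt_not_eq. apply Rmult_lt_0_compat; lra. }
  eapply Rlt_le_trans; [exact H2|].
  apply Rmult_le_compat_l; [lra|]. apply Rmult_le_compat_l; lra.
Qed.

Lemma clim_div {T : Type} (F : (T -> Prop) -> Prop) {FF : Filter F} f g (a b : C) :
  b <> 0%C -> clim F f a -> clim F g b -> clim F (fun x => f x / g x)%C (a / b)%C.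
Proof. intros Hb Hf Hg. exact (clim_mult F f _ a _ Hf (clim_inv F g b Hb Hg)). Qed.

Lemma clim_id (z : C) : clim (near z) (fun w : C => w) z.
Proof. intros e E. apply locally_disc. exists e. split; auto. Qed.

(** Descends through the field operations of the function under the limit. Atomic limits other than
    constants and the identity must be hypotheses; the goals left over are the nonvanishing
    conditions for inverses and quotients. *)
Ltac clim_tac := repeat (
  lazymatch goal with
  | |- @clim ?T ?F ?f ?l => first [ assumption |
    lazymatch f with
    | (fun _ => ?c) => exact (@clim_const T F _ c)
    | (fun w => w) => exact (clim_id _)
    | (fun x => Cplus (@?u x) (@?v x)) => refine (@clim_plus T F _ u v _ _ _ _)
    | (fun x => Cminus (@?u x) (@?v x)) => refine (@clim_minus T F _ u v _ _ _ _)
    | (fun x => Cmult (@?u x) (@?v x)) => refine (@clim_mult T F _ u v _ _ _ _)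
    | (fun x => Copp (@?u x)) => refine (@clim_opp T F _ u _ _)
    | (fun x => Cinv (@?u x)) => refine (@clim_inv T F _ u _ _ _)
    | (fun x => Cdiv (@?u x) (@?v x)) => refine (@clim_div T F _ u v _ _ _ _ _)
    | _ => fail
    end ]
  end).

Definition ccont (f : C -> C) (z : C) : Prop := clim (near z) f (f z).
Definition pcont (p : R -> C) (s : R) : Prop := clim (locally s) p (p s).

Lemma clim_comp {T : Type} (F : (T -> Prop) -> Prop) {FF : Filter F} (f : C -> C) p a :
  clim F p a -> ccont f a -> clim F (fun x => f (p x)) (f a).
Proof.
  intros Hp Hf eps He. destruct (proj1 (locally_disc _ _) (Hf eps He)) as [d [d0 Hd]].
  generalize (Hp d d0). apply filter_imp. intros x. apply Hd.
Qed.

(** The remainder is bounded by a multiple of the increment instead of being divided by it, so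
    [w = z] is no exception. *)
Definition cder (f : C -> C) (z l : C) : Prop :=
  forall eps, 0 < eps -> exists d, 0 < d /\
    forall w, Cmod (w - z) < d -> Cmod (f w - f z - l * (w - z)) <= eps * Cmod (w - z).

Definition pder (p : R -> C) (s : R) (l : C) : Prop :=
  forall eps, 0 < eps -> exists d, 0 < d /\
    forall x, Rabs (x - s) < d -> Cmod (p x - p s - l * RtoC (x - s)) <= eps * Rabs (x - s).

Lemma is_linear_mult (l : C) :
  @is_linear C_AbsRing (AbsRing_NormedModule C_AbsRing) C_NormedModule (fun y : C => (y * l)%C).
Proof. apply (@is_linear_scal_l C_AbsRing C_NormedModule l). Qed.

Lemma cder_is_derive f z l :
  cder f z l <-> @is_derive C_AbsRing C_NormedModule f z l.
Proof.
  split.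
  - intros H. split; [apply is_linear_mult|].
    intros x Hx. assert (Ex := @is_filter_lim_locally_unique C_AbsRing (AbsRing_NormedModule C_AbsRing) z x Hx). subst x.
    intros eps. apply locally_C. apply locally_disc.
    destruct (H eps (cond_pos eps)) as [d [d0 Hd]]. exists d. split; [easy|].
    intros w Hw. specialize (Hd w Hw).
    change (Cmod (f w - f z - (w - z) * l) <= eps * Cmod (w - z)).
    now rewrite (Cmult_comm (w - z) l).
  - intros [_ H] eps He.
    specialize (H z (fun P HP => HP) (mkposreal eps He)). apply locally_C in H.
    apply locally_disc in H. destruct H as [d [d0 Hd]]. exists d. split; [easy|].
    intros w Hw. specialize (Hd w Hw).
    change (Cmod (f w - f z - (w - z) * l) <= eps * Cmod (w - z)) in Hd.
    now rewrite (Cmult_comm (w - z) l) in Hd.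
Qed.

Lemma pder_is_derive p s l :
  pder p s l -> @is_derive R_AbsRing C_R_NormedModule p s l.
Proof.
  intros H. split; [apply (@is_linear_scal_l R_AbsRing C_R_NormedModule l)|].
  intros x Hx. assert (Ex := @is_filter_lim_locally_unique R_AbsRing (AbsRing_NormedModule R_AbsRing) s x Hx). subst x.
  intros eps. apply locally_real.
  destruct (H eps (cond_pos eps)) as [d [d0 Hd]]. exists d. split; [easy|].
  intros y Hy. specialize (Hd y Hy).
  rewrite <- Cmod_norm. rewrite scal_R_Cmult.
  change (Cmod (p y - p s - RtoC (y - s) * l) <= eps * Rabs (y - s)).
  now rewrite (Cmult_comm (RtoC _) l).
Qed.

Lemma pcont_continuous p s : pcont p s -> @continuous R_UniformSpace C_R_NormedModule p s.
Proof. intros H. apply (clim_filterlim (locally s) _) in H. exact H. Qed.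

Lemma cder_ext_loc f g z l d :
  0 < d -> (forall w, Cmod (w - z) < d -> f w = g w) -> cder f z l -> cder g z l.
Proof.
  intros Hd E H eps He. destruct (H eps He) as [d' [d0' Hd']].
  exists (Rmin d d'). split; [now apply Rmin_glb_lt|].
  intros w Hw. assert (Rmin d d' <= d) by apply Rmin_l. assert (Rmin d d' <= d') by apply Rmin_r.
  rewrite <- !E. apply Hd'. lra. replace (z - z)%C with (RtoC 0) by ring. rewrite Cmod_0; lra. lra.
Qed.

Lemma cder_cont f z l : cder f z l -> ccont f z.
Proof.
  intros H eps He. apply locally_disc. destruct (H 1 Rlt_0_1) as [d [d0 Hd]].
  assert (Hl := Cmod_ge_0 l).
  exists (Rmin d (eps / (Cmod l + 1))). split.
  { apply Rmin_glb_lt; [easy|]. apply Rdiv_lt_0_compat; lra. }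
  intros w Hw. destruct (Rlt_Rmin _ _ _ Hw) as [H1 H2].
  specialize (Hd w H1).
  replace (f w - f z)%C with ((f w - f z - l * (w - z)) + l * (w - z))%C by ring.
  eapply Rle_lt_trans; [apply Cmod_triangle|]. rewrite Cmod_mult.
  apply Rlt_div_r in H2; [|lra]. lra.
Qed.

Lemma cder_eq f z l l' : cder f z l -> l = l' -> cder f z l'.
Proof. now intros H <-. Qed.

Lemma cder_const c z : cder (fun _ => c) z 0%C.
Proof.
  intros eps He. exists 1. split; [lra|]. intros w _.
  replace (c - c - 0 * (w - z))%C with (RtoC 0) by ring. rewrite Cmod_0.
  apply Rmult_le_pos; [lra|apply Cmod_ge_0].
Qed.

Lemma cder_id z : cder (fun w => w) z 1%C.
Proof.
  intros eps He. exists 1. split; [lra|]. intros w _.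
  replace (w - z - 1 * (w - z))%C with (RtoC 0) by ring. rewrite Cmod_0.
  apply Rmult_le_pos; [lra|apply Cmod_ge_0].
Qed.

Lemma cder_plus f g z a b : cder f z a -> cder g z b -> cder (fun w => f w + g w)%C z (a + b)%C.
Proof. rewrite !cder_is_derive. intros Hf Hg. exact (is_derive_plus f g z a b Hf Hg). Qed.

(** [C_NormedModule] and [AbsRing_NormedModule C_AbsRing] are different structures with the same
    norm; the library's product and chain rules speak of the second. *)
Lemma cder_abs f z l : cder f z l <-> @is_derive C_AbsRing (AbsRing_NormedModule C_AbsRing) f z l.
Proof. rewrite cder_is_derive. split; intros [[H1 H2 H3] H4]; (split; [now constructor|easy]). Qed.

Lemma cder_mult f g z a b :
  cder f z a -> cder g z b -> cder (fun w => f w * g w)%C z (a * g z + f z * b)%C.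
Proof.
  rewrite !cder_abs. intros Hf Hg. exact (is_derive_mult f g z a b Hf Hg Cmult_comm).
Qed.

Lemma cder_comp f g z a b :
  cder f (g z) a -> cder g z b -> cder (fun w => f (g w)) z (a * b)%C.
Proof.
  rewrite !cder_abs. intros Hf Hg. rewrite Cmult_comm.
  exact (@is_derive_comp C_AbsRing (AbsRing_NormedModule C_AbsRing) f g z a b Hf Hg).
Qed.

Lemma cder_scal c f z a : cder f z a -> cder (fun w => c * f w)%C z (c * a)%C.
Proof.
  intros H. eapply cder_eq; [apply (cder_mult (fun _ => c) f z 0 a); [apply cder_const|easy]|ring].
Qed.

Lemma cder_opp f z a : cder f z a -> cder (fun w => - f w)%C z (- a)%C.
Proof.
  intros H. eapply cder_eq.
  - apply (cder_ext_loc (fun w => (-(1)) * f w)%C _ z _ 1); [lra|intros; ring|apply cder_scal, H].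
  - ring.
Qed.

Lemma cder_minus f g z a b : cder f z a -> cder g z b -> cder (fun w => f w - g w)%C z (a - b)%C.
Proof. intros Hf Hg. apply cder_plus; [easy|]. now apply cder_opp. Qed.

Lemma cder_inv (f : C -> C) z a : f z <> 0%C -> cder f z a -> cder (fun w => / f w)%C z (- a / (f z * f z))%C.
Proof.
  intros Hz Hf.
  assert (Hi : cder (fun w => / w)%C (f z) (- (1) / (f z * f z))%C).
  { assert (Hp : 0 < Cmod (f z)) by now apply Cmod_gt_0.
    intros eps He.
    (* The remainder of the first-order expansion of 1/w at c = f z is exactly (w - c)^2 / (c^2 w).
       Its coefficient is bounded near c, and [K] is such a bound. *)
    assert (Hc : clim (near (f z)) (fun w => / (f z * w) * / f z)%C (/ (f z * f z) * / f z)%C).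
    { clim_tac. now apply Cmult_neq_0. }
    destruct (proj1 (locally_disc _ _) (Hc 1 Rlt_0_1)) as [d [d0 Hd]].
    set (K := Cmod (/ (f z * f z) * / f z) + 1).
    assert (HK : 0 < K) by (unfold K; generalize (Cmod_ge_0 (/ (f z * f z) * / f z)); lra).
    exists (Rmin (Rmin d (eps / K)) (Cmod (f z))). split.
    { repeat apply Rmin_glb_lt; try easy. now apply Rdiv_lt_0_compat. }
    intros w Hw.
    assert (H1 : Cmod (w - f z) < d).
    { eapply Rlt_le_trans; [exact Hw|]. eapply Rle_trans; [apply Rmin_l|apply Rmin_l]. }
    assert (H2 : Cmod (w - f z) < eps / K).
    { eapply Rlt_le_trans; [exact Hw|]. eapply Rle_trans; [apply Rmin_l|apply Rmin_r]. }
    assert (H3 : Cmod (w - f z) < Cmod (f z)).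
    { eapply Rlt_le_trans; [exact Hw|apply Rmin_r]. }
    assert (Hw0 : w <> 0%C).
    { intros ->. rewrite Cmod_sym in H3. replace (f z - 0)%C with (f z) in H3 by ring. lra. }
    specialize (Hd w H1). set (m := (/ (f z * w) * / f z)%C) in *.
    replace (/ w - / f z - - (1) / (f z * f z) * (w - f z))%C with ((m * (w - f z)) * (w - f z))%C
      by (unfold m; field; auto).
    rewrite Cmod_mult. apply Rmult_le_compat_r; [apply Cmod_ge_0|]. rewrite Cmod_mult.
    assert (Hm : Cmod m <= K).
    { unfold K. assert (G := Cmod_rev m (/ (f z * f z) * / f z)). lra. }
    apply Rle_trans with (K * (eps / K)).
    - apply Rmult_le_compat; try apply Cmod_ge_0; lra.
    - apply Req_le. field. lra. }
  eapply cder_eq; [apply (cder_comp (fun w => / w)%C f z); [exact Hi|exact Hf]|].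
  field. easy.
Qed.

Lemma cder_div (f g : C -> C) z a b : g z <> 0%C -> cder f z a -> cder g z b ->
  cder (fun w => f w / g w)%C z ((a * g z - f z * b) / (g z * g z))%C.
Proof.
  intros Hz Hf Hg. eapply cder_eq.
  - apply (cder_mult f (fun w => / g w)%C); [exact Hf|apply cder_inv; [exact Hz|exact Hg]].
  - field. easy.
Qed.

Lemma pder_comp f p s a b : cder f (p s) a -> pder p s b -> pder (fun x => f (p x)) s (a * b)%C.
Proof.
  intros Hf Hp eps He. assert (Ha := Cmod_ge_0 a). assert (Hb := Cmod_ge_0 b).
  destruct (Hf (eps / 2 / (Cmod b + 1))) as [d1 [d10 H1]].
  { apply Rdiv_lt_0_compat; lra. }
  destruct (Hp (Rmin 1 (eps / 2 / (Cmod a + 1)))) as [d2 [d20 H2]].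
  { apply Rmin_glb_lt; [lra|]. apply Rdiv_lt_0_compat; lra. }
  exists (Rmin d2 (d1 / (Cmod b + 2))). split.
  { apply Rmin_glb_lt; [lra|]. apply Rdiv_lt_0_compat; lra. }
  intros x Hx.
  destruct (Rlt_Rmin _ _ _ Hx) as [X1 X2].
  specialize (H2 x X1). assert (X0 := Rabs_pos (x - s)).
  set (e := (p x - p s - b * RtoC (x - s))%C) in *.
  assert (M1 := Rmin_l 1 (eps / 2 / (Cmod a + 1))). assert (M2 := Rmin_r 1 (eps / 2 / (Cmod a + 1))).
  set (m := Rmin 1 (eps / 2 / (Cmod a + 1))) in *.
  assert (Hpx : Cmod (p x - p s) <= (Cmod b + 1) * Rabs (x - s)).
  { replace (p x - p s)%C with (e + b * RtoC (x - s))%C by (unfold e; ring).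
    eapply Rle_trans; [apply Cmod_triangle|]. rewrite Cmod_mult, Cmod_R. nra. }
  assert (Hd : Cmod (p x - p s) < d1).
  { apply Rlt_div_r in X2; [|lra]. nra. }
  specialize (H1 _ Hd).
  replace (f (p x) - f (p s) - a * b * RtoC (x - s))%C
    with ((f (p x) - f (p s) - a * (p x - p s)) + a * e)%C by (unfold e; ring).
  eapply Rle_trans; [apply Cmod_triangle|]. rewrite Cmod_mult.
  apply Rle_trans with (eps / 2 / (Cmod b + 1) * ((Cmod b + 1) * Rabs (x - s)) +
                        (Cmod a + 1) * (eps / 2 / (Cmod a + 1) * Rabs (x - s))).
  - apply Rplus_le_compat.
    + eapply Rle_trans; [exact H1|]. apply Rmult_le_compat_l; [|exact Hpx].
      apply Rlt_le, Rdiv_lt_0_compat; lra.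
    + apply Rmult_le_compat; try apply Cmod_ge_0; try lra.
      eapply Rle_trans; [exact H2|]. apply Rmult_le_compat_r; lra.
  - apply Req_le. field. lra.
Qed.

Lemma pder_cont p s l : pder p s l -> pcont p s.
Proof.
  intros H eps He. apply locally_real. destruct (H 1 Rlt_0_1) as [d [d0 Hd]].
  assert (Hl := Cmod_ge_0 l).
  exists (Rmin d (eps / (Cmod l + 1))). split.
  { apply Rmin_glb_lt; [easy|]. apply Rdiv_lt_0_compat; lra. }
  intros w Hw. destruct (Rlt_Rmin _ _ _ Hw) as [H1 H2].
  specialize (Hd w H1).
  replace (p w - p s)%C with ((p w - p s - l * RtoC (w - s)) + l * RtoC (w - s))%C by ring.
  eapply Rle_lt_trans; [apply Cmod_triangle|]. rewrite Cmod_mult, Cmod_R.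
  apply Rlt_div_r in H2; [|lra]. lra.
Qed.

Lemma pder_line a b s : pder (fun x => a + RtoC x * b)%C s b.
Proof.
  intros eps He. exists 1. split; [lra|]. intros x _. rewrite RtoC_minus.
  replace (a + RtoC x * b - (a + RtoC s * b) - b * (RtoC x - RtoC s))%C with (RtoC 0) by ring.
  rewrite Cmod_0. apply Rmult_le_pos; [lra|apply Rabs_pos].
Qed.

Lemma pder_pair u v s u' v' :
  is_derive u s u' -> is_derive v s v' -> pder (fun x => (u x, v x)) s (u', v').
Proof.
  intros Hu Hv eps He.
  assert (K : forall w w', is_derive w s w' -> exists d, 0 < d /\ forall x, Rabs (x - s) < d ->
     Rabs (w x - w s - w' * (x - s)) <= eps / 2 * Rabs (x - s)).
  { intros w w' [_ H]. specialize (H s (fun P HP => HP) (mkposreal (eps / 2) ltac:(lra))).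
    apply locally_real in H. destruct H as [d [d0 Hd]]. exists d. split; [easy|].
    intros x Hx. specialize (Hd x Hx).
    change (Rabs (w x - w s - (x - s) * w') <= eps / 2 * Rabs (x - s)) in Hd.
    now rewrite (Rmult_comm (x - s)) in Hd. }
  destruct (K u u' Hu) as [d1 [d10 H1]]. destruct (K v v' Hv) as [d2 [d20 H2]].
  exists (Rmin d1 d2). split; [now apply Rmin_glb_lt|]. intros x Hx.
  destruct (Rlt_Rmin _ _ _ Hx) as [X1 X2].
  specialize (H1 x X1). specialize (H2 x X2).
  replace ((u x, v x) - (u s, v s) - (u', v') * RtoC (x - s))%C
    with (RtoC (u x - u s - u' * (x - s)) + Ci * RtoC (v x - v s - v' * (x - s)))%C.
  2: { apply injective_projections; simpl; ring. }
  eapply Rle_trans; [apply Cmod_triangle|]. rewrite Cmod_mult, Cmod_Ci, !Cmod_R. lra.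
Qed.

(** * Integrals along segments and Goursat's lemma *)

Definition CInt (p : R -> C) (a b : R) : C := @RInt C_R_CompleteNormedModule p a b.

Definition pcont_on (p : R -> C) (a b : R) : Prop := forall s, a <= s <= b -> pcont p s.

Lemma CInt_correct p a b : a <= b -> pcont_on p a b ->
  @is_RInt C_R_NormedModule p a b (CInt p a b).
Proof.
  intros Hab H. apply (@RInt_correct C_R_CompleteNormedModule).
  apply (@ex_RInt_continuous C_R_CompleteNormedModule). intros z Hz.
  rewrite Rmin_left, Rmax_right in Hz by easy. apply pcont_continuous. now apply H.
Qed.

Lemma CInt_unique p a b l : @is_RInt C_R_NormedModule p a b l -> CInt p a b = l.
Proof. apply (@is_RInt_unique C_R_CompleteNormedModule). Qed.

Lemma CInt_ext p q a b : a <= b -> (forall s, a <= s <= b -> p s = q s) -> CInt p a b = CInt q a b.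
Proof.
  intros Hab H. apply (@RInt_ext C_R_CompleteNormedModule). intros x Hx.
  rewrite Rmin_left, Rmax_right in Hx by easy. apply H. lra.
Qed.

Lemma CInt_plus p q a b : a <= b -> pcont_on p a b -> pcont_on q a b ->
  CInt (fun s => p s + q s)%C a b = (CInt p a b + CInt q a b)%C.
Proof.
  intros Hab Hp Hq. apply CInt_unique.
  exact (@is_RInt_plus C_R_NormedModule p q a b _ _ (CInt_correct p a b Hab Hp) (CInt_correct q a b Hab Hq)).
Qed.

(** [C_R_NormedModule] is a real module, so the complex factor is split: both components of the
    product are real combinations of the two component integrals. *)
Lemma CInt_scal (c : C) p a b : a <= b -> pcont_on p a b ->
  CInt (fun s => c * p s)%C a b = (c * CInt p a b)%C.
Proof.
  intros Hab Hp. apply CInt_unique. assert (H := CInt_correct p a b Hab Hp).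
  set (I := CInt p a b) in *.
  assert (H1 := @is_RInt_fct_extend_fst R_NormedModule R_NormedModule p a b I H).
  assert (H2 := @is_RInt_fct_extend_snd R_NormedModule R_NormedModule p a b I H).
  apply (@is_RInt_fct_extend_pair R_NormedModule R_NormedModule).
  - exact (is_RInt_minus _ _ a b _ _ (is_RInt_scal _ a b (fst c) _ H1) (is_RInt_scal _ a b (snd c) _ H2)).
  - exact (is_RInt_plus _ _ a b _ _ (is_RInt_scal _ a b (fst c) _ H2) (is_RInt_scal _ a b (snd c) _ H1)).
Qed.

Lemma pcont_scal (c : C) p s : pcont p s -> pcont (fun x => c * p x)%C s.
Proof. unfold pcont. intros H. clim_tac. Qed.

Lemma CInt_minus p q a b : a <= b -> pcont_on p a b -> pcont_on q a b ->
  CInt (fun s => p s - q s)%C a b = (CInt p a b - CInt q a b)%C.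
Proof.
  intros Hab Hp Hq.
  rewrite (CInt_ext _ (fun s => p s + (-(1)) * q s)%C) by (easy || intros; ring).
  rewrite CInt_plus, CInt_scal; try easy; [ring|]. intros s Hs. apply pcont_scal. now apply Hq.
Qed.

Lemma CInt_const (c : C) a b : a <= b -> CInt (fun _ => c) a b = (RtoC (b - a) * c)%C.
Proof.
  intros Hab. rewrite <- scal_R_Cmult. apply CInt_unique.
  exact (@is_RInt_const C_R_NormedModule a b c).
Qed.

Lemma CInt_norm p a b M : a <= b -> pcont_on p a b ->
  (forall s, a <= s <= b -> Cmod (p s) <= M) -> Cmod (CInt p a b) <= (b - a) * M.
Proof.
  intros Hab Hp HM. rewrite Cmod_norm.
  apply (@norm_RInt_le_const C_R_NormedModule p a b _ M Hab); [|now apply CInt_correct].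
  intros x Hx. rewrite <- Cmod_norm. now apply HM.
Qed.

Lemma CInt_FTC P p a b : a <= b -> (forall s, a <= s <= b -> pder P s (p s)) ->
  pcont_on p a b -> CInt p a b = (P b - P a)%C.
Proof.
  intros Hab H Hp. apply CInt_unique.
  apply (@is_RInt_derive C_R_CompleteNormedModule P p a b);
    rewrite ?Rmin_left, ?Rmax_right by easy; intros x Hx;
    rewrite ?Rmin_left, ?Rmax_right in Hx by easy.
  - apply pder_is_derive. now apply H.
  - apply pcont_continuous. now apply Hp.
Qed.

Definition seg (f : C -> C) (a b : C) : C :=
  ((b - a) * CInt (fun s => f (a + RtoC s * (b - a))%C) 0 1)%C.

Lemma integral_from_0_seg f z : integral_from_0 f z = seg f 0 z.
Proof.
  unfold integral_from_0, seg, CInt. f_equal; [ring|].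
  apply (@RInt_ext C_R_CompleteNormedModule). intros x _. f_equal. ring.
Qed.

Lemma conv_mod (c a b : C) s r : 0 <= s <= 1 -> Cmod (a - c) <= r -> Cmod (b - c) <= r ->
  Cmod (a + RtoC s * (b - a) - c) <= r.
Proof.
  intros Hs Ha Hb.
  replace (a + RtoC s * (b - a) - c)%C with (RtoC (1 - s) * (a - c) + RtoC s * (b - c))%C
    by (rewrite RtoC_minus; ring).
  eapply Rle_trans; [apply Cmod_triangle|]. rewrite !Cmod_mult, !Cmod_R.
  rewrite !Rabs_pos_eq by lra. nra.
Qed.

Lemma conv_disc a b s : unit_disc a -> unit_disc b -> 0 <= s <= 1 ->
  unit_disc (a + RtoC s * (b - a))%C.
Proof.
  unfold unit_disc. intros Ha Hb Hs.
  assert (H := conv_mod 0 a b s (Rmax (Cmod a) (Cmod b)) Hs).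
  replace (a - 0)%C with a in H by ring. replace (b - 0)%C with b in H by ring.
  replace (a + RtoC s * (b - a) - 0)%C with (a + RtoC s * (b - a))%C in H by ring.
  eapply Rle_lt_trans; [apply H; [apply Rmax_l|apply Rmax_r]|]. now apply Rmax_lub_lt.
Qed.

Definition dcont (f : C -> C) : Prop := forall z, unit_disc z -> ccont f z.
Definition hol (f : C -> C) : Prop := forall z, unit_disc z -> exists l, cder f z l.

Lemma hol_analytic f : hol f <-> analytic f.
Proof.
  split; intros H z Hz; destruct (H z Hz) as [l Hl]; exists l; now apply cder_is_derive.
Qed.

Lemma hol_dcont f : hol f -> dcont f.
Proof. intros H z Hz. destruct (H z Hz) as [l Hl]. now apply cder_cont in Hl. Qed.

Lemma pcont_line a b s : pcont (fun x => a + RtoC x * b)%C s.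
Proof. exact (pder_cont _ _ _ (pder_line a b s)). Qed.

Lemma pcont_comp f p s : ccont f (p s) -> pcont p s -> pcont (fun x => f (p x)) s.
Proof. intros Hf Hp. exact (clim_comp (locally s) f p _ Hp Hf). Qed.

Lemma seg_pcont f a b : dcont f -> unit_disc a -> unit_disc b ->
  pcont_on (fun s => f (a + RtoC s * (b - a))%C) 0 1.
Proof.
  intros Hf Ha Hb s Hs. apply (pcont_comp f (fun x => a + RtoC x * (b - a))%C).
  - apply Hf. now apply conv_disc.
  - apply pcont_line.
Qed.

(** An affine change of variable. The order of [s0] and [s1] is free, so the choice [s0 = 1],
    [s1 = 0] yields the reversal of orientation and other choices the subdivision of a segment. *)
Lemma seg_sub f a b s0 s1 : dcont f -> unit_disc a -> unit_disc b ->
  0 <= s0 <= 1 -> 0 <= s1 <= 1 ->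
  seg f (a + RtoC s0 * (b - a)) (a + RtoC s1 * (b - a)) =
  ((b - a) * CInt (fun s => f (a + RtoC s * (b - a))%C) s0 s1)%C.
Proof.
  intros Hf Ha Hb H0 H1. unfold seg.
  set (p := fun s => f (a + RtoC s * (b - a))%C).
  assert (Hex : @ex_RInt C_R_CompleteNormedModule p s0 s1).
  { apply (@ex_RInt_continuous C_R_CompleteNormedModule). intros z Hz. apply pcont_continuous.
    apply (seg_pcont f a b Hf Ha Hb). revert Hz. unfold Rmin, Rmax.
    destruct (Rle_dec s0 s1); lra. }
  assert (E : CInt p s0 s1 =
     CInt (fun y => RtoC (s1 - s0) * p ((s1 - s0) * y + s0)%R)%C 0 1).
  { unfold CInt.
    assert (L := @RInt_comp_lin C_R_CompleteNormedModule p (s1 - s0) s0 0 1).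
    replace ((s1 - s0) * 0 + s0)%R with s0 in L by ring.
    replace ((s1 - s0) * 1 + s0)%R with s1 in L by ring.
    rewrite <- L by exact Hex.
    apply (@RInt_ext C_R_CompleteNormedModule). intros x _. now rewrite <- scal_R_Cmult. }
  rewrite E, CInt_scal.
  - rewrite RtoC_minus.
    replace (a + RtoC s1 * (b - a) - (a + RtoC s0 * (b - a)))%C
      with ((b - a) * (RtoC s1 - RtoC s0))%C by ring.
    rewrite <- Cmult_assoc. f_equal. f_equal. apply CInt_ext; [lra|].
    intros s _. unfold p. f_equal. rewrite RtoC_plus, RtoC_mult, RtoC_minus. ring.
  - lra.
  - intros s Hs. unfold p.
    apply (pcont_comp f (fun y => a + RtoC ((s1 - s0) * y + s0) * (b - a))%C).
    + apply Hf. apply conv_disc; try easy. nra.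
    + generalize (pcont_line (a + RtoC s0 * (b - a))%C (RtoC (s1 - s0) * (b - a))%C s).
      unfold pcont, clim. intros G eps He. generalize (G eps He). apply filter_imp. intros x.
      rewrite !RtoC_plus, !RtoC_mult. intros G'. eapply Rle_lt_trans; [|exact G'].
      apply Req_le. f_equal. ring.
Qed.

Lemma seg_split f a b s : dcont f -> unit_disc a -> unit_disc b -> 0 <= s <= 1 ->
  seg f a b = (seg f a (a + RtoC s * (b - a)) + seg f (a + RtoC s * (b - a)) b)%C.
Proof.
  intros Hf Ha Hb Hs.
  assert (E0 := seg_sub f a b 0 s Hf Ha Hb ltac:(lra) Hs).
  assert (E1 := seg_sub f a b s 1 Hf Ha Hb Hs ltac:(lra)).
  replace (a + 0 * (b - a))%C with a in E0 by ring.
  replace (a + 1 * (b - a))%C with b in E1 by ring.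
  rewrite E0, E1. unfold seg. rewrite <- Cmult_plus_distr_l. f_equal. symmetry.
  assert (Hc := seg_pcont f a b Hf Ha Hb).
  apply (@RInt_Chasles C_R_CompleteNormedModule).
  - eexists. apply CInt_correct; [lra|]. intros x Hx. apply Hc. lra.
  - eexists. apply CInt_correct; [lra|]. intros x Hx. apply Hc. lra.
Qed.

Lemma seg_rev f a b : dcont f -> unit_disc a -> unit_disc b -> seg f b a = (- seg f a b)%C.
Proof.
  intros Hf Ha Hb.
  assert (E := seg_sub f a b 1 0 Hf Ha Hb ltac:(lra) ltac:(lra)).
  replace (a + 1 * (b - a))%C with b in E by ring.
  replace (a + 0 * (b - a))%C with a in E by ring.
  rewrite E. unfold seg, CInt.
  rewrite <- (@opp_RInt_swap C_R_CompleteNormedModule).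
  - change opp with Copp. ring.
  - eexists. apply CInt_correct; [lra|]. now apply seg_pcont.
Qed.

Lemma seg_FTC F f a b : (forall z, unit_disc z -> cder F z (f z)) -> dcont f ->
  unit_disc a -> unit_disc b -> seg f a b = (F b - F a)%C.
Proof.
  intros HF Hf Ha Hb. unfold seg. rewrite <- CInt_scal; [|lra|now apply seg_pcont].
  rewrite (CInt_FTC (fun s => F (a + RtoC s * (b - a))%C)).
  - replace (a + 1 * (b - a))%C with b by ring. now replace (a + 0 * (b - a))%C with a by ring.
  - lra.
  - intros s Hs. rewrite Cmult_comm.
    apply (pder_comp F (fun x => a + RtoC x * (b - a))%C); [|apply pder_line].
    apply HF. now apply conv_disc.
  - intros s Hs. apply pcont_scal. now apply (seg_pcont f a b Hf Ha Hb).
Qed.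

Lemma dcont_aff (c d e : C) : dcont (fun z => c + d * (z - e))%C.
Proof. intros z _. unfold ccont. clim_tac. Qed.

(** Affine integrands have the primitive c z + l (z - p)^2 / 2, so their integrals around a triangle
    cancel. The same formula gives the first-order behaviour of segment means needed in
    [slope_hol]. *)
Lemma seg_affine c l p a b : unit_disc a -> unit_disc b ->
  seg (fun z => c + l * (z - p))%C a b = (c * (b - a) + l * ((b - p) * (b - p) - (a - p) * (a - p)) / 2)%C.
Proof.
  intros Ha Hb. rewrite (seg_FTC (fun z => c * z + l * ((z - p) * (z - p)) / 2)%C); [field| | |easy|easy].
  - intros z _. eapply cder_eq.
    + apply cder_plus; [apply cder_scal, cder_id|].
      apply (cder_mult (fun z => l * ((z - p) * (z - p)))%C (fun _ => / 2)%C); [|apply cder_const].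
      apply cder_scal. apply (cder_mult (fun z => z - p)%C (fun z => z - p)%C);
        (apply cder_minus; [apply cder_id|apply cder_const]).
    + field.
  - apply dcont_aff.
Qed.

Lemma seg_norm f a b M : dcont f -> unit_disc a -> unit_disc b ->
  (forall s, 0 <= s <= 1 -> Cmod (f (a + RtoC s * (b - a))%C) <= M) ->
  Cmod (seg f a b) <= Cmod (b - a) * M.
Proof.
  intros Hf Ha Hb HM. unfold seg. rewrite Cmod_mult.
  apply Rmult_le_compat_l; [apply Cmod_ge_0|].
  replace M with ((1 - 0) * M) by ring. apply CInt_norm; [lra|now apply seg_pcont|easy].
Qed.

Lemma seg_minus f g a b : dcont f -> dcont g -> unit_disc a -> unit_disc b ->
  seg (fun z => f z - g z)%C a b = (seg f a b - seg g a b)%C.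
Proof.
  intros Hf Hg Ha Hb. unfold seg. rewrite CInt_minus; [ring|lra|now apply seg_pcont|now apply seg_pcont].
Qed.

Lemma pow_half_small K eps : 0 <= K -> 0 < eps -> exists n, K * (/ 2) ^ n < eps.
Proof.
  intros HK He.
  destruct (pow_lt_1_zero (/ 2) ltac:(rewrite Rabs_pos_eq; lra) (eps / (K + 1)) ltac:(apply Rdiv_lt_0_compat; lra)) as [N HN].
  exists N. specialize (HN N (le_n _)). rewrite Rabs_pos_eq in HN by (apply pow_le; lra).
  apply Rlt_div_r in HN; [|lra].
  nra.
Qed.

Lemma C_complete (u : nat -> C) :
  (forall eps, 0 < eps -> exists N, forall m n, (N <= m)%nat -> (N <= n)%nat -> Cmod (u m - u n) < eps) ->
  exists l, forall eps, 0 < eps -> exists N, forall n, (N <= n)%nat -> Cmod (u n - l) < eps.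
Proof.
  intros H.
  destruct (Rcomplete.R_complete (fun n => fst (u n))) as [x Hx].
  { intros eps He. destruct (H eps He) as [N HN]. exists N. intros m n Hm Hn.
    eapply Rle_lt_trans; [|apply (HN m n Hm Hn)].
    eapply Rle_trans; [|apply Rmax_Cmod]. apply Rmax_l. }
  destruct (Rcomplete.R_complete (fun n => snd (u n))) as [y Hy].
  { intros eps He. destruct (H eps He) as [N HN]. exists N. intros m n Hm Hn.
    eapply Rle_lt_trans; [|apply (HN m n Hm Hn)].
    eapply Rle_trans; [|apply Rmax_Cmod]. apply Rmax_r. }
  exists (x, y). intros eps He.
  destruct (Hx (eps / 2) ltac:(lra)) as [N1 H1]. destruct (Hy (eps / 2) ltac:(lra)) as [N2 H2].
  exists (max N1 N2). intros n Hn. specialize (H1 n ltac:(lia)). specialize (H2 n ltac:(lia)).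
  unfold R_dist, Rdist in *.
  replace (u n - (x, y))%C with (RtoC (fst (u n) - x) + Ci * RtoC (snd (u n) - y))%C
    by (apply injective_projections; simpl; ring).
  eapply Rle_lt_trans; [apply Cmod_triangle|]. rewrite Cmod_mult, Cmod_Ci, !Cmod_R. lra.
Qed.

(** The tail of the geometric series from [n] on is 2 D 2^(-n). Applied to the apexes of bisected
    triangles, this locates their limit point with an explicit rate. *)
Lemma geometric_cauchy_limit (u : nat -> C) D :
  (forall n, Cmod (u (S n) - u n) <= D * (/ 2) ^ n) ->
  exists l, forall n, Cmod (u n - l) <= 2 * D * (/ 2) ^ n.
Proof.
  intros H.
  assert (D0 : 0 <= D).
  { specialize (H 0%nat). simpl in H. generalize (Cmod_ge_0 (u 1%nat - u 0%nat)). lra. }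
  assert (K : forall n k, Cmod (u (n + k)%nat - u n) <= 2 * D * (/ 2) ^ n * (1 - (/ 2) ^ k)).
  { intros n k. induction k as [|k IH].
    - rewrite Nat.add_0_r. replace (u n - u n)%C with (RtoC 0) by ring. rewrite Cmod_0. simpl. lra.
    - replace (n + S k)%nat with (S (n + k)) by lia.
      replace (u (S (n + k)) - u n)%C with ((u (S (n + k)) - u (n + k)%nat) + (u (n + k)%nat - u n))%C by ring.
      eapply Rle_trans; [apply Cmod_triangle|]. specialize (H (n + k)%nat).
      rewrite pow_add in H. simpl. lra. }
  assert (K' : forall n m, (n <= m)%nat -> Cmod (u m - u n) <= 2 * D * (/ 2) ^ n).
  { intros n m Hm. replace m with (n + (m - n))%nat by lia.
    eapply Rle_trans; [apply K|].
    assert (0 <= (/ 2) ^ (m - n)) by (apply pow_le; lra).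
    assert (0 <= 2 * D * (/ 2) ^ n) by (apply Rmult_le_pos; [lra|apply pow_le; lra]). nra. }
  destruct (C_complete u) as [l Hl].
  { intros eps He. destruct (pow_half_small (4 * D) eps) as [N HN]; [lra|easy|].
    exists N. intros m n Hm Hn.
    replace (u m - u n)%C with ((u m - u N) + - (u n - u N))%C by ring.
    eapply Rle_lt_trans; [apply Cmod_triangle|]. rewrite Cmod_opp.
    generalize (K' N m Hm) (K' N n Hn). lra. }
  exists l. intros n. apply Rnot_lt_le. intros Hlt.
  destruct (Hl (Cmod (u n - l) - 2 * D * (/ 2) ^ n)) as [N HN]; [lra|].
  specialize (HN (max n N) ltac:(lia)). specialize (K' n (max n N) ltac:(lia)).
  assert (T := Cmod_triangle (u n - u (max n N)) (u (max n N) - l)).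
  replace (u n - u (max n N) + (u (max n N) - l))%C with (u n - l)%C in T by ring.
  rewrite Cmod_sym in K'. lra.
Qed.

(** * Goursat's lemma by bisection *)

Definition tri (f : C -> C) (T : C * C * C) : C :=
  let '(a, b, c) := T in (seg f a b + seg f b c + seg f c a)%C.

(** The bound [r], taken below 1, confines all triangles of the bisection to one closed subdisc, so
    that their limit point is again in the unit disc; [D] bounds the sides. *)
Definition tri_in (r D : R) (T : C * C * C) : Prop :=
  let '(a, b, c) := T in
  Cmod a <= r /\ Cmod b <= r /\ Cmod c <= r /\
  Cmod (b - a) <= D /\ Cmod (c - b) <= D /\ Cmod (a - c) <= D.

Definition apex (T : C * C * C) : C := fst (fst T).

Lemma half_mod (x : C) (D : R) : Cmod x <= D -> Cmod (RtoC (1 / 2) * x) <= D / 2.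
Proof. intros H. rewrite Cmod_mult, Cmod_R, Rabs_pos_eq by lra. lra. Qed.

Lemma half_sum_mod (a b : C) (r : R) : Cmod a <= r -> Cmod b <= r -> Cmod (a + RtoC (1 / 2) * (b - a)) <= r.
Proof.
  intros Ha Hb. assert (H := conv_mod 0 a b (1 / 2) r ltac:(lra)).
  replace (a - 0)%C with a in H by ring. replace (b - 0)%C with b in H by ring.
  replace (a + RtoC (1 / 2) * (b - a) - 0)%C with (a + RtoC (1 / 2) * (b - a))%C in H by ring.
  now apply H.
Qed.

Lemma half_double : (RtoC (1 / 2) + RtoC (1 / 2) = 1)%C.
Proof. rewrite <- RtoC_plus. f_equal. field. Qed.

(** Joining the midpoints cuts the triangle into four; the integrals along the inner sides cancel,
    so one piece carries at least a quarter of the total. Midpoints stay in the disc of radius [r]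
    by convexity, and every piece has its apex at a vertex or midpoint close to the old apex. *)
Lemma tri_step f r D T : dcont f -> r < 1 -> tri_in r D T ->
  exists T', tri_in r (D / 2) T' /\ Cmod (tri f T) / 4 <= Cmod (tri f T') /\
    Cmod (apex T' - apex T) <= D.
Proof.
  destruct T as [[a b] c]. intros Hf Hr (Ha & Hb & Hc & Hab & Hbc & Hca).
  assert (D0 : 0 <= D) by (generalize (Cmod_ge_0 (b - a)); lra).
  set (h := RtoC (1 / 2)). assert (hh := half_double). fold h in hh.
  set (x := (a + h * (b - a))%C). set (y := (b + h * (c - b))%C). set (w := (c + h * (a - c))%C).
  assert (Hx : Cmod x <= r) by now apply half_sum_mod.
  assert (Hy : Cmod y <= r) by now apply half_sum_mod.
  assert (Hw : Cmod w <= r) by now apply half_sum_mod.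
  assert (U : forall z, Cmod z <= r -> unit_disc z) by (unfold unit_disc; intros; lra).
  assert (Ex := seg_split f a b (1 / 2) Hf (U _ Ha) (U _ Hb) ltac:(lra)). fold h x in Ex.
  assert (Ey := seg_split f b c (1 / 2) Hf (U _ Hb) (U _ Hc) ltac:(lra)). fold h y in Ey.
  assert (Ew := seg_split f c a (1 / 2) Hf (U _ Hc) (U _ Ha) ltac:(lra)). fold h w in Ew.
  assert (Rx := seg_rev f x w Hf (U _ Hx) (U _ Hw)).
  assert (Ry := seg_rev f y x Hf (U _ Hy) (U _ Hx)).
  assert (Rw := seg_rev f w y Hf (U _ Hw) (U _ Hy)).
  assert (E : tri f (a, b, c) = (tri f (a, x, w) + tri f (x, b, y) + tri f (w, y, c) + tri f (w, x, y))%C).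
  { simpl. rewrite Ex, Ey, Ew, Rx, Ry, Rw. ring. }
  assert (M1 : Cmod (x - a) <= D / 2).
  { replace (x - a)%C with (h * (b - a))%C by (unfold x; ring). now apply half_mod. }
  assert (M2 : Cmod (b - x) <= D / 2).
  { replace (b - x)%C with (h * (b - a))%C; [now apply half_mod|].
    unfold x. replace (b - (a + h * (b - a)))%C with ((1 - h) * (b - a))%C by ring. rewrite <- hh. ring. }
  assert (M3 : Cmod (y - b) <= D / 2).
  { replace (y - b)%C with (h * (c - b))%C by (unfold y; ring). now apply half_mod. }
  assert (M4 : Cmod (c - y) <= D / 2).
  { replace (c - y)%C with (h * (c - b))%C; [now apply half_mod|].
    unfold y. replace (c - (b + h * (c - b)))%C with ((1 - h) * (c - b))%C by ring. rewrite <- hh. ring. }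
  assert (M5 : Cmod (w - c) <= D / 2).
  { replace (w - c)%C with (h * (a - c))%C by (unfold w; ring). now apply half_mod. }
  assert (M6 : Cmod (a - w) <= D / 2).
  { replace (a - w)%C with (h * (a - c))%C; [now apply half_mod|].
    unfold w. replace (a - (c + h * (a - c)))%C with ((1 - h) * (a - c))%C by ring. rewrite <- hh. ring. }
  assert (M7 : Cmod (w - x) <= D / 2).
  { replace (w - x)%C with (h * (c - b) + (1 - (h + h)) * (c - a))%C by (unfold x, w; ring).
    rewrite hh. replace (h * (c - b) + (1 - 1) * (c - a))%C with (h * (c - b))%C by ring. now apply half_mod. }
  assert (M8 : Cmod (x - y) <= D / 2).
  { replace (x - y)%C with (h * (a - c) + (1 - (h + h)) * (a - b))%C by (unfold x, y; ring).
    rewrite hh. replace (h * (a - c) + (1 - 1) * (a - b))%C with (h * (a - c))%C by ring. now apply half_mod. }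
  assert (M9 : Cmod (y - w) <= D / 2).
  { replace (y - w)%C with (h * (b - a) + (1 - (h + h)) * (b - c))%C by (unfold y, w; ring).
    rewrite hh. replace (h * (b - a) + (1 - 1) * (b - c))%C with (h * (b - a))%C by ring. now apply half_mod. }
  assert (Tr : Cmod (tri f (a, b, c)) <= Cmod (tri f (a, x, w)) + Cmod (tri f (x, b, y)) + Cmod (tri f (w, y, c)) + Cmod (tri f (w, x, y))).
  { rewrite E. eapply Rle_trans; [apply Cmod_triangle|]. apply Rplus_le_compat_r.
    eapply Rle_trans; [apply Cmod_triangle|]. apply Rplus_le_compat_r. apply Cmod_triangle. }
  rewrite Cmod_sym in M7, M8, M9.
  assert (Z : Cmod (a - a) = 0) by (replace (a - a)%C with (RtoC 0) by ring; apply Cmod_0).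
  destruct (Rle_dec (Cmod (tri f (a, b, c)) / 4) (Cmod (tri f (a, x, w)))) as [C1|C1].
  { exists (a, x, w). unfold tri_in, apex; simpl fst; rewrite ?Z; repeat split; first [assumption | rewrite Cmod_sym; assumption | clear - D0 M1 M2 M3 M4 M5 M6 Hca; lra ]. }
  destruct (Rle_dec (Cmod (tri f (a, b, c)) / 4) (Cmod (tri f (x, b, y)))) as [C2|C2].
  { exists (x, b, y). unfold tri_in, apex; simpl fst; rewrite ?Z; repeat split; first [assumption | rewrite Cmod_sym; assumption | clear - D0 M1 M2 M3 M4 M5 M6 Hca; lra ]. }
  rewrite (Cmod_sym a w) in M6.
  destruct (Rle_dec (Cmod (tri f (a, b, c)) / 4) (Cmod (tri f (w, y, c)))) as [C3|C3].
  { exists (w, y, c). unfold tri_in, apex; simpl fst; rewrite ?Z; repeat split; first [assumption | rewrite Cmod_sym; assumption | clear - D0 M1 M2 M3 M4 M5 M6 Hca; lra ]. }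
  exists (w, x, y). unfold tri_in, apex; simpl fst; rewrite ?Z; repeat split; first [assumption | rewrite Cmod_sym; assumption | clear - D0 M1 M2 M3 M4 M5 M6 Hca; lra | clear - Tr C1 C2 C3; lra].
Qed.

(** After n bisections the integral is still at least 4^(-n) times the original one.
    Differentiability at the limit point bounds it by 9 D^2 eps 4^(-n) for every eps, so the
    original integral is zero. *)
Lemma goursat f a b c : hol f -> unit_disc a -> unit_disc b -> unit_disc c ->
  (seg f a b + seg f b c + seg f c a = 0)%C.
Proof.
  intros Hf Ha Hb Hc. assert (Df := hol_dcont f Hf).
  set (r := Rmax (Cmod a) (Rmax (Cmod b) (Cmod c))).
  assert (Hr : r < 1) by (repeat apply Rmax_lub_lt; assumption).
  set (D := Rmax (Cmod (b - a)) (Rmax (Cmod (c - b)) (Cmod (a - c)))).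
  assert (D0 : 0 <= D) by (eapply Rle_trans; [apply Cmod_ge_0|apply Rmax_l]).
  assert (H0 : tri_in r D (a, b, c)).
  { repeat split; unfold r, D.
    - apply Rmax_l.
    - eapply Rle_trans; [|apply Rmax_r]. apply Rmax_l.
    - eapply Rle_trans; [|apply Rmax_r]. apply Rmax_r.
    - apply Rmax_l.
    - eapply Rle_trans; [|apply Rmax_r]. apply Rmax_l.
    - eapply Rle_trans; [|apply Rmax_r]. apply Rmax_r. }
  (* A piece as in [tri_step], chosen for every [E] and [T]; the choice is meaningful only if [T]
     satisfies [tri_in r E], as it does along [Ts]. *)
  set (next := fun (E : R) T => epsilon (inhabits (a, b, c)) (fun T' => tri_in r (E / 2) T' /\
     Cmod (tri f T) / 4 <= Cmod (tri f T') /\ Cmod (apex T' - apex T) <= E)).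
  set (Ts := fix Ts n := match n with O => (a, b, c) | S n => next (D * (/ 2) ^ n) (Ts n) end).
  assert (Hn : forall n E, tri_in r E (Ts n) -> tri_in r (E / 2) (next E (Ts n)) /\
     Cmod (tri f (Ts n)) / 4 <= Cmod (tri f (next E (Ts n))) /\ Cmod (apex (next E (Ts n)) - apex (Ts n)) <= E).
  { intros n E HE. unfold next. apply epsilon_spec. now apply tri_step. }
  assert (HT : forall n, tri_in r (D * (/ 2) ^ n) (Ts n)).
  { induction n as [|n IH]; [simpl pow; rewrite Rmult_1_r; exact H0|].
    replace (D * (/ 2) ^ S n) with (D * (/ 2) ^ n / 2) by (simpl; field). apply (Hn n _ IH). }
  assert (HI : forall n, Cmod (tri f (a, b, c)) * ((/ 2) ^ n * (/ 2) ^ n) <= Cmod (tri f (Ts n))).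
  { induction n as [|n IH]; [simpl; lra|].
    destruct (Hn n _ (HT n)) as (_ & H & _). simpl Ts.
    replace ((/ 2) ^ S n * (/ 2) ^ S n) with ((/ 2) ^ n * (/ 2) ^ n / 4) by (simpl; field). lra. }
  destruct (geometric_cauchy_limit (fun n => apex (Ts n)) D) as [p Hp].
  { intros n. apply (Hn n _ (HT n)). }
  assert (Pd : unit_disc p).
  { unfold unit_disc. apply Rle_lt_trans with r; [|easy]. apply Rnot_lt_le. intros Hlt.
    destruct (pow_half_small (2 * D) (Cmod p - r)) as [n Hn']; [lra|lra|].
    specialize (Hp n). specialize (HT n). destruct (Ts n) as [[x y] w]. destruct HT as [Hx _]. unfold apex in Hp. simpl fst in Hp.
    generalize (Cmod_rev p x). rewrite Cmod_sym in Hp. lra. }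
  destruct (Hf p Pd) as [l Hl].
  set (g := fun z => (f p + l * (z - p))%C).
  assert (Dg : dcont g) by apply dcont_aff.
  assert (De : dcont (fun z => f z - g z)%C).
  { intros z Hz. assert (H1 := Df z Hz). assert (H2 := Dg z Hz). unfold ccont in *. clim_tac. }
  (* The affine part [g] of [f] at [p] integrates to zero around the triangle. Its apex is within 2
     D q of [p] and its sides are at most D q, so all points are within 3 D q of [p]; three sides of
     length D q then give the factor 9 D^2 q^2. *)
  assert (Bound : forall eps, 0 < eps -> Cmod (tri f (a, b, c)) <= 9 * D * D * eps).
  { intros eps He. destruct (Hl eps He) as [d [d0 Hd]].
    destruct (pow_half_small (3 * D) d) as [n Hn']; [lra|easy|].
    specialize (Hp n). specialize (HT n). specialize (HI n).
    assert (q0 : 0 < (/ 2) ^ n) by (apply pow_lt; lra).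
    set (q := (/ 2) ^ n) in *. destruct (Ts n) as [[x y] w].
    destruct HT as (Hx & Hy & Hw & Hxy & Hyw & Hwx). unfold apex in Hp. simpl fst in Hp.
    assert (Ux : unit_disc x) by (unfold unit_disc; lra).
    assert (Uy : unit_disc y) by (unfold unit_disc; lra).
    assert (Uw : unit_disc w) by (unfold unit_disc; lra).
    assert (Py : Cmod (y - p) <= 3 * D * q).
    { replace (y - p)%C with ((y - x) + (x - p))%C by ring.
      eapply Rle_trans; [apply Cmod_triangle|]. lra. }
    assert (Pw : Cmod (w - p) <= 3 * D * q).
    { replace (w - p)%C with ((w - x) + (x - p))%C by ring. rewrite Cmod_sym in Hwx.
      eapply Rle_trans; [apply Cmod_triangle|]. lra. }
    assert (Px : Cmod (x - p) <= 3 * D * q) by nra.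
    assert (S : forall u v, Cmod (u - p) <= 3 * D * q -> Cmod (v - p) <= 3 * D * q ->
       unit_disc u -> unit_disc v -> Cmod (v - u) <= D * q ->
       Cmod (seg (fun z => f z - g z)%C u v) <= D * q * (eps * (3 * D * q))).
    { intros u v Pu Pv Uu Uv Huv.
      eapply Rle_trans; [apply (seg_norm _ u v (eps * (3 * D * q)) De Uu Uv)|].
      - intros s Hs. assert (B := conv_mod p u v s _ Hs Pu Pv).
        unfold g. replace (f (u + RtoC s * (v - u)) - (f p + l * (u + RtoC s * (v - u) - p)))%C
          with (f (u + RtoC s * (v - u)) - f p - l * (u + RtoC s * (v - u) - p))%C by ring.
        eapply Rle_trans; [apply Hd; lra|]. apply Rmult_le_compat_l; lra.
      - apply Rmult_le_compat_r; [|easy]. repeat apply Rmult_le_pos; lra. }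
    assert (E : tri f (x, y, w) = (seg (fun z => f z - g z)%C x y + seg (fun z => f z - g z)%C y w + seg (fun z => f z - g z)%C w x)%C).
    { simpl. rewrite !seg_minus by easy. unfold g. rewrite !seg_affine by easy. field. }
    assert (T3 : Cmod (tri f (x, y, w)) <= 3 * (D * q * (eps * (3 * D * q)))).
    { rewrite E. eapply Rle_trans; [apply Cmod_triangle|].
      assert (A1 := S x y Px Py Ux Uy Hxy). assert (A2 := S y w Py Pw Uy Uw Hyw).
      assert (A3 := S w x Pw Px Uw Ux Hwx).
      assert (A4 := Cmod_triangle (seg (fun z => f z - g z)%C x y) (seg (fun z => f z - g z)%C y w)). lra. }
    apply Rmult_le_reg_r with (q * q); [now apply Rmult_lt_0_compat|].
    eapply Rle_trans; [exact HI|]. eapply Rle_trans; [exact T3|]. apply Req_le. ring. }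
  apply Cmod_eq_0. apply Rle_antisym; [|apply Cmod_ge_0]. apply Rnot_lt_le. intros Hlt.
  change (seg f a b + seg f b c + seg f c a)%C with (tri f (a, b, c)) in Hlt.
  set (I := Cmod (tri f (a, b, c))) in *.
  (* This eps makes the bound at most I / 2, which contradicts I > 0. *)
  specialize (Bound (I / (2 * (9 * D * D + 1))) ltac:(apply Rdiv_lt_0_compat; nra)).
  assert (9 * D * D / (2 * (9 * D * D + 1)) <= 1 / 2).
  { apply Rmult_le_reg_r with (2 * (9 * D * D + 1)); [nra|].
    unfold Rdiv at 1. rewrite Rmult_assoc, Rinv_l by nra. nra. }
  nra.
Qed.

Definition prim (f : C -> C) (z : C) : C := seg f 0 z.

Lemma unit_disc_0 : unit_disc 0.
Proof. unfold unit_disc. rewrite Cmod_0. lra. Qed.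

Lemma unit_disc_open z : unit_disc z -> exists d, 0 < d /\ forall w, Cmod (w - z) < d -> unit_disc w.
Proof.
  unfold unit_disc. intros Hz. exists (1 - Cmod z). split; [lra|]. intros w Hw.
  generalize (Cmod_rev w z). lra.
Qed.

(** Goursat's lemma for the triangle 0, z, w turns the increment of [prim f] into the integral over
    the segment from z to w; its deviation from f(z) (w - z) is controlled by the continuity of [f]
    at z. *)
Lemma prim_cder f z : hol f -> unit_disc z -> cder (prim f) z (f z).
Proof.
  intros Hf Hz eps He. assert (Df := hol_dcont f Hf).
  destruct (unit_disc_open z Hz) as [d1 [d10 H1]].
  destruct (proj1 (locally_disc _ _) (Df z Hz eps He)) as [d2 [d20 H2]].
  exists (Rmin d1 d2). split; [now apply Rmin_glb_lt|]. intros w Hw.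
  destruct (Rlt_Rmin _ _ _ Hw) as [W1 W2].
  specialize (H1 w W1). assert (U0 := unit_disc_0).
  assert (G := goursat f 0 z w Hf U0 Hz H1). rewrite (seg_rev f 0 w Df U0 H1) in G.
  assert (E : (prim f w - prim f z)%C = seg f z w).
  { unfold prim. replace (seg f z w) with (seg f 0 w - seg f 0 z + (seg f 0 z + seg f z w + - seg f 0 w))%C by ring.
    rewrite G. ring. }
  rewrite E.
  assert (Ec : seg (fun _ => f z) z w = (f z * (w - z))%C).
  { unfold seg. rewrite CInt_const by lra. replace (1 - 0)%R with 1%R by ring. ring. }
  assert (Dc : dcont (fun _ => f z)) by (intros u _; unfold ccont; clim_tac).
  rewrite <- Ec, <- seg_minus by easy.
  rewrite Rmult_comm. apply seg_norm; try easy.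
  - intros u Hu. assert (A := Df u Hu). unfold ccont in *. clim_tac.
  - intros s Hs. apply Rlt_le, H2.
    replace (z + RtoC s * (w - z) - z)%C with (RtoC s * (w - z))%C by ring.
    rewrite Cmod_mult, Cmod_R, Rabs_pos_eq by lra.
    assert (C0 := Cmod_ge_0 (w - z)). nra.
Qed.

(** * Power series *)

Fixpoint csum (a : nat -> C) (n : nat) : C :=
  match n with O => 0%C | S k => (csum a k + a k)%C end.

Fixpoint rsum (a : nat -> R) (n : nat) : R :=
  match n with O => 0 | S k => rsum a k + a k end.

Definition cser (a : nat -> C) (l : C) : Prop := clim eventually (csum a) l.

Lemma csum_ext a b n : (forall k, (k < n)%nat -> a k = b k) -> csum a n = csum b n.
Proof. induction n as [|n IH]; simpl; intros H; [easy|]. rewrite IH, H; auto. Qed.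

Lemma rsum_ext a b n : (forall k, (k < n)%nat -> a k = b k) -> rsum a n = rsum b n.
Proof. induction n as [|n IH]; simpl; intros H; [easy|]. rewrite IH, H; auto. Qed.

Lemma csum_plus a b n : csum (fun k => a k + b k)%C n = (csum a n + csum b n)%C.
Proof. induction n as [|n IH]; simpl; [ring|]. rewrite IH. ring. Qed.

Lemma csum_scal c a n : csum (fun k => c * a k)%C n = (c * csum a n)%C.
Proof. induction n as [|n IH]; simpl; [ring|]. rewrite IH. ring. Qed.

Lemma csum_shift a n : csum a (S n) = (a O + csum (fun k => a (S k)) n)%C.
Proof. induction n as [|n IH]; [simpl; ring|]. simpl in *. rewrite IH. ring. Qed.

Lemma rsum_shift a n : rsum a (S n) = a O + rsum (fun k => a (S k)) n.
Proof. induction n as [|n IH]; [simpl; ring|]. simpl in *. rewrite IH. ring. Qed.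

Lemma rsum_plus a b n : rsum (fun k => a k + b k) n = rsum a n + rsum b n.
Proof. induction n as [|n IH]; simpl; [ring|]. rewrite IH. ring. Qed.

Lemma rsum_scal c a n : rsum (fun k => c * a k) n = c * rsum a n.
Proof. induction n as [|n IH]; simpl; [ring|]. rewrite IH. ring. Qed.

Lemma rsum_le a b n : (forall k, (k < n)%nat -> a k <= b k) -> rsum a n <= rsum b n.
Proof.
  induction n as [|n IH]; simpl; intros H; [lra|].
  generalize (IH (fun k Hk => H k (Nat.lt_lt_succ_r _ _ Hk))) (H n (Nat.lt_succ_diag_r n)). lra.
Qed.

Lemma rsum_nonneg a n : (forall k, (k < n)%nat -> 0 <= a k) -> 0 <= rsum a n.
Proof.
  intros H. apply Rle_trans with (rsum (fun _ => 0) n).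
  - clear H. induction n; simpl; lra.
  - now apply rsum_le.
Qed.

Lemma rsum_mono a m n : (forall k, 0 <= a k) -> (m <= n)%nat -> rsum a m <= rsum a n.
Proof. intros H. induction 1 as [|n _ IH]; [lra|]. simpl. generalize (H n). lra. Qed.

(** Lets x tend to 0 in an inequality with a linear error term, where [K] may have either sign. With
    x = 1 - r it serves for passages to the unit circle. *)
Lemma le_of_le_add X A K : (forall x, 0 < x <= 1 -> X <= A + K * x) -> X <= A.
Proof.
  intros H. apply Rnot_lt_le. intros Hlt. assert (K0 := Rabs_pos K).
  set (x := Rmin 1 ((X - A) / (2 * (Rabs K + 1)))).
  assert (x0 : 0 < x) by (apply Rmin_glb_lt; [lra|apply Rdiv_lt_0_compat; lra]).
  assert (x1 : x <= 1) by apply Rmin_l.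
  assert (x2 : x <= (X - A) / (2 * (Rabs K + 1))) by apply Rmin_r.
  specialize (H x (conj x0 x1)). assert (KK := Rle_abs K).
  apply (Rmult_le_compat_r (2 * (Rabs K + 1))) in x2; [|lra].
  unfold Rdiv in x2. rewrite Rmult_assoc, Rinv_l in x2 by lra. nra.
Qed.

Lemma bernoulli x n : 0 <= x <= 1 -> 1 - INR n * x <= (1 - x) ^ n.
Proof.
  intros Hx. induction n as [|n IH]; [simpl; lra|]. rewrite S_INR. simpl.
  assert (0 <= INR n * x * x) by (repeat apply Rmult_le_pos; try lra; apply pos_INR). nra.
Qed.

(** In a finite sum Bernoulli's inequality r^n >= 1 - n (1 - r) turns the factors r^n into an error
    linear in 1 - r, which joins [K * (1 - r)] and disappears as r tends to 1. *)
Lemma abel_bound a N A K : (forall n, 0 <= a n) ->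
  (forall r, 0 <= r < 1 -> rsum (fun n => a n * r ^ n) N <= A + K * (1 - r)) -> rsum a N <= A.
Proof.
  intros H0 H. apply (le_of_le_add _ _ (K + rsum (fun n => INR n * a n) N)). intros x Hx.
  specialize (H (1 - x) ltac:(lra)). replace (1 - (1 - x)) with x in H by ring.
  assert (B : rsum a N <= rsum (fun n => a n * (1 - x) ^ n + x * (INR n * a n)) N).
  { apply rsum_le. intros n _. assert (Bn := bernoulli x n ltac:(lra)). specialize (H0 n). nra. }
  rewrite rsum_plus, rsum_scal in B. lra.
Qed.

Lemma csum_norm a n : Cmod (csum a n) <= rsum (fun k => Cmod (a k)) n.
Proof.
  induction n as [|n IH]; simpl; [rewrite Cmod_0; lra|].
  eapply Rle_trans; [apply Cmod_triangle|]. lra.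
Qed.

Lemma csum_diff_norm a m n : (m <= n)%nat ->
  Cmod (csum a n - csum a m) <= rsum (fun k => Cmod (a k)) n - rsum (fun k => Cmod (a k)) m.
Proof.
  induction 1 as [|n Hn IH].
  - replace (csum a m - csum a m)%C with (RtoC 0) by ring. rewrite Cmod_0. lra.
  - simpl. replace (csum a n + a n - csum a m)%C with (csum a n - csum a m + a n)%C by ring.
    eapply Rle_trans; [apply Cmod_triangle|]. lra.
Qed.

Lemma clim_seq (u : nat -> C) l : clim eventually u l <->
  forall eps, 0 < eps -> exists N, forall n, (N <= n)%nat -> Cmod (u n - l) < eps.
Proof. split; intros H eps He; exact (H eps He). Qed.

Lemma clim_unique (u : nat -> C) l l' : clim eventually u l -> clim eventually u l' -> l = l'.
Proof.
  intros H H'. apply Ceq_minus, Cmod_eq_0. apply Rle_antisym; [|apply Cmod_ge_0].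
  apply Rnot_lt_le. intros Hlt.
  destruct (proj1 (clim_seq _ _) H (Cmod (l - l') / 2) ltac:(lra)) as [N HN].
  destruct (proj1 (clim_seq _ _) H' (Cmod (l - l') / 2) ltac:(lra)) as [N' HN'].
  specialize (HN (max N N') ltac:(lia)). specialize (HN' (max N N') ltac:(lia)).
  assert (T := Cmod_triangle (l - u (max N N')) (u (max N N') - l')).
  replace (l - u (max N N') + (u (max N N') - l'))%C with (l - l')%C in T by ring.
  rewrite (Cmod_sym l (u _)) in T. lra.
Qed.

Lemma clim_bound (u : nat -> C) l c K N : clim eventually u l ->
  (forall n, (N <= n)%nat -> Cmod (u n - c) <= K) -> Cmod (l - c) <= K.
Proof.
  intros H HK. apply Rnot_lt_le. intros Hlt.
  destruct (proj1 (clim_seq _ _) H (Cmod (l - c) - K) ltac:(lra)) as [N' HN'].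
  specialize (HN' (max N N') ltac:(lia)). specialize (HK (max N N') ltac:(lia)).
  assert (T := Cmod_triangle (l - u (max N N')) (u (max N N') - c)).
  replace (l - u (max N N') + (u (max N N') - c))%C with (l - c)%C in T by ring.
  rewrite (Cmod_sym l (u _)) in T. lra.
Qed.

Lemma cser_ext a b l : (forall n, a n = b n) -> cser a l -> cser b l.
Proof.
  intros E H eps He. destruct (H eps He) as [N HN]. exists N. intros n Hn.
  rewrite <- (csum_ext a b); auto.
Qed.

Lemma cser_plus a b l m : cser a l -> cser b m -> cser (fun n => a n + b n)%C (l + m)%C.
Proof.
  intros Ha Hb eps He. generalize (clim_plus eventually _ _ _ _ Ha Hb eps He).
  apply filter_imp. intros n. now rewrite csum_plus.
Qed.

Lemma cser_scal c a l : cser a l -> cser (fun n => c * a n)%C (c * l)%C.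
Proof.
  intros Ha eps He. generalize (clim_mult eventually _ _ _ _ (clim_const eventually c) Ha eps He).
  apply filter_imp. intros n. now rewrite csum_scal.
Qed.

Lemma cser_shift a l : cser a l -> cser (fun n => a (S n)) (l - a O)%C.
Proof.
  intros H eps He. destruct (H eps He) as [N HN]. exists N. intros n Hn.
  specialize (HN (S n) ltac:(lia)). rewrite csum_shift in HN.
  replace (csum (fun k => a (S k)) n - (l - a O))%C
    with (a O + csum (fun k => a (S k)) n - l)%C by ring. easy.
Qed.

Lemma cser_unshift a l : cser (fun n => a (S n)) l -> cser a (a O + l)%C.
Proof.
  intros H eps He. destruct (H eps He) as [N HN]. exists (S N). intros n Hn.
  destruct n as [|n]; [lia|]. specialize (HN n ltac:(lia)). rewrite csum_shift.
  replace (a O + csum (fun k => a (S k)) n - (a O + l))%C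
    with (csum (fun k => a (S k)) n - l)%C by ring. easy.
Qed.

Lemma cser_bound a l K : cser a l -> (forall n, rsum (fun k => Cmod (a k)) n <= K) -> Cmod l <= K.
Proof.
  intros H HK. replace l with (l - 0)%C by ring. apply (clim_bound (csum a) l 0 K 0 H).
  intros n _. replace (csum a n - 0)%C with (csum a n) by ring.
  eapply Rle_trans; [apply csum_norm|apply HK].
Qed.

Lemma rsum_bounded_cauchy a K : (forall n, 0 <= a n) -> (forall n, rsum a n <= K) ->
  forall eps, 0 < eps -> exists N, forall m n, (N <= m)%nat -> (m <= n)%nat -> rsum a n - rsum a m < eps.
Proof.
  intros H0 HK eps He.
  assert (Hc : Cauchy_crit (rsum a)).
  { apply CV_Cauchy. apply growing_cv.
    - intros n. simpl. generalize (H0 n). lra.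
    - exists K. intros x [n ->]. apply HK. }
  destruct (Hc eps He) as [N HN]. exists N. intros m n Hm Hn.
  specialize (HN n m ltac:(lia) ltac:(lia)). unfold Rdist in HN. apply Rabs_def2 in HN. lra.
Qed.

Lemma abs_cser a K : (forall n, rsum (fun k => Cmod (a k)) n <= K) -> exists l, cser a l.
Proof.
  intros HK. apply C_complete. intros eps He.
  destruct (rsum_bounded_cauchy (fun k => Cmod (a k)) K (fun k => Cmod_ge_0 _) HK eps He) as [N HN].
  exists N. intros m n Hm Hn. destruct (Nat.le_ge_cases m n) as [L|L].
  - rewrite Cmod_sym. eapply Rle_lt_trans; [now apply csum_diff_norm|]. now apply HN.
  - eapply Rle_lt_trans; [now apply csum_diff_norm|]. now apply HN.
Qed.

Lemma rsum_geom_tail a M q m n : 0 <= q < 1 -> (forall k, a k <= M * q ^ k) ->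
  0 <= M -> (m <= n)%nat -> rsum a n - rsum a m <= M / (1 - q) * q ^ m.
Proof.
  intros Hq H HM Hmn.
  assert (E : rsum a n - rsum a m <= M / (1 - q) * (q ^ m - q ^ n)).
  { induction Hmn as [|n Hn IH]; [lra|]. simpl. specialize (H n).
    replace (M / (1 - q) * (q ^ m - q * q ^ n)) with (M / (1 - q) * (q ^ m - q ^ n) + M * q ^ n)
      by (field; lra). lra. }
  assert (0 <= q ^ n) by (apply pow_le; lra).
  assert (0 <= M / (1 - q)) by (apply Rmult_le_pos; [easy|apply Rlt_le, Rinv_0_lt_compat; lra]). nra.
Qed.

Lemma cser_geom_tail a l M q m : 0 <= q < 1 -> 0 <= M -> (forall k, Cmod (a k) <= M * q ^ k) ->
  cser a l -> Cmod (l - csum a m) <= M / (1 - q) * q ^ m.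
Proof.
  intros Hq HM H Hl. apply (clim_bound (csum a) l _ _ m Hl). intros n Hn.
  eapply Rle_trans; [now apply csum_diff_norm|]. now apply rsum_geom_tail.
Qed.

Lemma rsum_geom a M q n : 0 <= q < 1 -> 0 <= M -> (forall k, a k <= M * q ^ k) -> rsum a n <= M / (1 - q).
Proof.
  intros Hq HM H. assert (T := rsum_geom_tail a M q 0 n Hq H HM (Nat.le_0_l n)). simpl in T. lra.
Qed.

(** Radius of convergence at least 1, in a form that passes easily through sums, shifts and
    multiplication by n. *)
Definition tame (a : nat -> C) : Prop :=
  forall r, 0 <= r < 1 -> exists M, forall n, Cmod (a n) * r ^ n <= M.

(** Boundedness at the larger radius (1 + r) / 2 becomes geometric decay at r, with ratio r / ((1 +
    r) / 2). *)
Lemma tame_geom a r : tame a -> 0 <= r < 1 ->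
  exists M q, 0 <= M /\ 0 <= q < 1 /\ forall n, Cmod (a n) * r ^ n <= M * q ^ n.
Proof.
  intros Ha Hr. destruct (Ha ((1 + r) / 2) ltac:(lra)) as [M HM].
  exists M, (r / ((1 + r) / 2)).
  assert (Hq : r / ((1 + r) / 2) < 1).
  { apply Rmult_lt_reg_r with ((1 + r) / 2); [lra|]. unfold Rdiv at 1. rewrite Rmult_assoc, Rinv_l; lra. }
  assert (Hq0 : 0 <= r / ((1 + r) / 2)).
  { apply Rmult_le_pos; [lra|]. apply Rlt_le, Rinv_0_lt_compat. lra. }
  repeat split; try easy.
  - specialize (HM 0%nat). simpl in HM. generalize (Cmod_ge_0 (a 0%nat)). lra.
  - intros n. replace (r ^ n) with (((1 + r) / 2) ^ n * (r / ((1 + r) / 2)) ^ n).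
    + rewrite <- Rmult_assoc. apply Rmult_le_compat_r; [now apply pow_le|apply HM].
    + rewrite <- Rpow_mult_distr. f_equal. field. lra.
Qed.

Lemma INR_pow_bounded q : 0 <= q < 1 -> exists K, 0 <= K /\ forall n, INR n * q ^ n <= K.
Proof.
  intros [H0 H1]. destruct (Req_dec q 0) as [->|Hq].
  { exists 0. split; [lra|]. intros [|n]; simpl; lra. }
  assert (Hi : 1 < / q) by (rewrite <- Rinv_1; apply Rinv_lt_contravar; lra).
  assert (Hk : 0 < / (/ q - 1)) by (apply Rinv_0_lt_compat; lra).
  exists (/ (/ q - 1)). split; [lra|].
  (* Bernoulli's inequality for 1/q: q^(-n) >= 1 + n (1/q - 1), so n q^n is at most 1 / (1/q -
     1). *)
  intros n. assert (B := poly n (/ q - 1) ltac:(lra)).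
  replace (1 + (/ q - 1)) with (/ q) in B by ring. rewrite pow_inv in B.
  assert (P : 0 < q ^ n) by (apply pow_lt; lra).
  apply (Rmult_le_compat_r (q ^ n)) in B; [|lra]. rewrite Rinv_l in B by lra.
  apply Rmult_le_reg_r with (/ q - 1); [lra|]. rewrite Rinv_l by lra. lra.
Qed.

Lemma tame_INR a : tame a -> tame (fun n => RtoC (INR n) * a n)%C.
Proof.
  intros Ha r Hr. destruct (tame_geom a r Ha Hr) as (M & q & HM & Hq & H).
  destruct (INR_pow_bounded q Hq) as [K [HK0 HK]]. exists (M * K). intros n.
  rewrite Cmod_mult, Cmod_R, Rabs_pos_eq by apply pos_INR.
  apply Rle_trans with (M * (INR n * q ^ n)).
  - replace (M * (INR n * q ^ n)) with (INR n * (M * q ^ n)) by ring. rewrite Rmult_assoc.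
    apply Rmult_le_compat_l; [apply pos_INR|apply H].
  - now apply Rmult_le_compat_l.
Qed.

Lemma tame_shift a : tame a -> tame (fun n => a (S n)).
Proof.
  intros Ha r Hr. destruct (Ha ((1 + r) / 2) ltac:(lra)) as [M HM].
  exists (M / ((1 + r) / 2)). intros n. apply Rmult_le_reg_r with ((1 + r) / 2); [lra|].
  unfold Rdiv at 2. rewrite (Rmult_assoc M), Rinv_l, Rmult_1_r by lra.
  apply Rle_trans with (2 := HM (S n)). rewrite Rmult_assoc.
  apply Rmult_le_compat_l; [apply Cmod_ge_0|]. simpl. rewrite Rmult_comm.
  apply Rmult_le_compat_l; [lra|]. apply pow_incr. lra.
Qed.

Lemma tame_unshift a : tame (fun n => a (S n)) -> tame a.
Proof.
  intros Ha r Hr. destruct (Ha r Hr) as [M HM]. exists (Cmod (a O) + Rabs M).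
  assert (G := Cmod_ge_0 (a O)). assert (A := Rle_abs M). assert (A0 := Rabs_pos M).
  intros [|n]; [simpl; lra|]. specialize (HM n). assert (P : 0 <= r ^ n) by (apply pow_le; lra).
  simpl. nra.
Qed.

Lemma tame_plus a b : tame a -> tame b -> tame (fun n => a n + b n)%C.
Proof.
  intros Ha Hb r Hr. destruct (Ha r Hr) as [M HM]. destruct (Hb r Hr) as [K HK].
  exists (M + K). intros n. assert (P : 0 <= r ^ n) by (apply pow_le; lra).
  specialize (HM n). specialize (HK n). assert (T := Cmod_triangle (a n) (b n)). nra.
Qed.

Lemma tame_scal c a : tame a -> tame (fun n => c * a n)%C.
Proof.
  intros Ha r Hr. destruct (Ha r Hr) as [M HM]. exists (Cmod c * M). intros n.
  rewrite Cmod_mult, Rmult_assoc. apply Rmult_le_compat_l; [apply Cmod_ge_0|apply HM].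
Qed.

Lemma tame_le a b : (forall n, Cmod (a n) <= Cmod (b n)) -> tame b -> tame a.
Proof.
  intros H Hb r Hr. destruct (Hb r Hr) as [M HM]. exists M. intros n.
  eapply Rle_trans; [|apply HM]. apply Rmult_le_compat_r; [apply pow_le; lra|apply H].
Qed.

Lemma tame_bounded a M : (forall n, Cmod (a n) <= M) -> tame a.
Proof.
  intros H r Hr. exists M. intros n.
  assert (P1 : r ^ n <= 1) by (rewrite <- (pow1 n); apply pow_incr; lra).
  specialize (H n). generalize (Cmod_ge_0 (a n)). nra.
Qed.

Definition pser (f : C -> C) (a : nat -> C) : Prop :=
  tame a /\ forall z, unit_disc z -> cser (fun n => a n * z ^ n)%C (f z).

Lemma term_mod a z n : Cmod (a n * z ^ n)%C = Cmod (a n) * Cmod z ^ n.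
Proof. now rewrite Cmod_mult, Cmod_pow. Qed.

Lemma pser_exists a : tame a -> exists f, pser f a.
Proof.
  intros Ha.
  exists (fun z => epsilon (inhabits (RtoC 0)) (cser (fun n => a n * z ^ n)%C)).
  split; [easy|]. intros z Hz. apply epsilon_spec.
  destruct (tame_geom a (Cmod z) Ha (conj (Cmod_ge_0 z) Hz)) as (M & q & HM & Hq & H).
  apply (abs_cser _ (M / (1 - q))). intros n. apply rsum_geom; try easy.
  intros k. rewrite term_mod. apply H.
Qed.

Lemma pser_ext f g a : (forall z, unit_disc z -> f z = g z) -> pser f a -> pser g a.
Proof. intros E [H1 H2]. split; [easy|]. intros z Hz. rewrite <- E; auto. Qed.

Lemma pser_ext_coef f a b : (forall n, a n = b n) -> pser f a -> pser f b.
Proof.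
  intros E [H1 H2]. split.
  - apply (tame_le b a); [|easy]. intros n. rewrite E. lra.
  - intros z Hz. apply (cser_ext (fun n => a n * z ^ n)%C); auto. intros n. now rewrite E.
Qed.

Lemma pser_fun_unique f g a : pser f a -> pser g a -> forall z, unit_disc z -> f z = g z.
Proof. intros [_ Hf] [_ Hg] z Hz. exact (clim_unique _ _ _ (Hf z Hz) (Hg z Hz)). Qed.

Lemma pser_plus f g a b : pser f a -> pser g b -> pser (fun z => f z + g z)%C (fun n => a n + b n)%C.
Proof.
  intros [Ta Ha] [Tb Hb]. split; [now apply tame_plus|]. intros z Hz.
  apply (cser_ext (fun n => a n * z ^ n + b n * z ^ n)%C); [intros; ring|].
  apply cser_plus; auto.
Qed.

Lemma pser_scal c f a : pser f a -> pser (fun z => c * f z)%C (fun n => c * a n)%C.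
Proof.
  intros [Ta Ha]. split; [now apply tame_scal|]. intros z Hz.
  apply (cser_ext (fun n => c * (a n * z ^ n))%C); [intros; ring|].
  apply cser_scal; auto.
Qed.

Lemma pser_minus f g a b : pser f a -> pser g b -> pser (fun z => f z - g z)%C (fun n => a n - b n)%C.
Proof.
  intros Hf Hg. apply (pser_ext (fun z => f z + (-(1)) * g z)%C); [intros; ring|].
  apply (pser_ext_coef _ (fun n => a n + (-(1)) * b n)%C); [intros; ring|].
  apply pser_plus; [easy|]. now apply pser_scal.
Qed.

Lemma csum_zero_tail (b : nat -> C) n : (forall k, b (S k) = 0%C) -> csum b (S n) = b O.
Proof. intros H. induction n as [|n IH]; [simpl; ring|]. rewrite <- IH. simpl. rewrite H. ring. Qed.

Lemma pser_at_0 f a : pser f a -> f 0%C = a O.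
Proof.
  intros [_ H]. apply (clim_unique _ _ _ (H 0%C unit_disc_0)).
  intros eps He. exists 1%nat. intros n Hn. destruct n as [|n]; [lia|].
  rewrite csum_zero_tail by (intros k; rewrite Cpow_S; ring).
  replace (a O * 0 ^ O - a O)%C with (RtoC 0) by (simpl; ring). now rewrite Cmod_0.
Qed.

(** The backward shift f -> (f - f(0)) / z, with the singularity at 0 removed by hand. It drives the
    inductions on coefficients below. *)
Definition slope0 (f : C -> C) (a : nat -> C) (z : C) : C :=
  if Ceq_dec z 0 then a 1%nat else ((f z - a O) / z)%C.

Lemma slope0_eq f a z : pser f a -> f z = (a O + z * slope0 f a z)%C.
Proof.
  intros H. unfold slope0. destruct (Ceq_dec z 0) as [->|Hz].
  - rewrite (pser_at_0 f a H). ring.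
  - field. easy.
Qed.

Lemma pser_slope0 f a : pser f a -> pser (slope0 f a) (fun n => a (S n)).
Proof.
  intros H. split; [apply tame_shift, H|]. intros z Hz. unfold slope0.
  destruct (Ceq_dec z 0) as [->|Hz0].
  - intros eps He. exists 1%nat. intros n Hn. destruct n as [|n]; [lia|].
    rewrite csum_zero_tail by (intros k; rewrite Cpow_S; ring).
    replace (a 1%nat * 0 ^ O - a 1%nat)%C with (RtoC 0) by (simpl; ring). now rewrite Cmod_0.
  - assert (Hs := cser_scal (/ z)%C _ _ (cser_shift _ _ (proj2 H z Hz))).
    apply (cser_ext _ (fun n => a (S n) * z ^ n)%C) in Hs.
    + replace ((f z - a O) / z)%C with (/ z * (f z - a O * z ^ 0))%C by (simpl; field; easy). exact Hs.
    + intros n. rewrite Cpow_S. field. easy.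
Qed.

Lemma pser_mulz g b a0 : pser g b ->
  pser (fun z => a0 + z * g z)%C (fun n => match n with O => a0 | S k => b k end).
Proof.
  intros [Tb Hb]. split; [now apply tame_unshift|]. intros z Hz.
  assert (E := cser_unshift (fun n => match n with O => a0 | S k => b k end * z ^ n)%C (z * g z)%C).
  simpl in E. replace (a0 + z * g z)%C with (a0 * 1 + z * g z)%C by ring. apply E.
  apply (cser_ext (fun n => z * (b n * z ^ n))%C); [intros n; ring|]. now apply cser_scal, Hb.
Qed.

(** The factor [r] on the left replaces the exponent n - 1 on the right, so that n = 0 and r = 0
    need no separate form. *)
Lemma pow_diff_bound (z w : C) (r : R) n : 0 <= r -> Cmod z <= r -> Cmod w <= r ->
  Cmod (w ^ n - z ^ n) * r <= INR n * r ^ n * Cmod (w - z).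
Proof.
  intros Hr Hz Hw. induction n as [|n IH].
  - simpl. replace (1 - 1)%C with (RtoC 0) by ring. rewrite Cmod_0. lra.
  - replace (w ^ S n - z ^ S n)%C with (z * (w ^ n - z ^ n) + (w - z) * w ^ n)%C by (rewrite !Cpow_S; ring).
    rewrite S_INR. simpl pow.
    assert (T := Cmod_triangle (z * (w ^ n - z ^ n)) ((w - z) * w ^ n)). rewrite !Cmod_mult, Cmod_pow in T.
    assert (P : Cmod w ^ n <= r ^ n) by (apply pow_incr; split; [apply Cmod_ge_0|easy]).
    assert (D0 := Cmod_ge_0 (w - z)). assert (D1 := Cmod_ge_0 (w ^ n - z ^ n)).
    apply Rle_trans with ((r * Cmod (w ^ n - z ^ n) + Cmod (w - z) * r ^ n) * r).
    + apply Rmult_le_compat_r; [easy|]. eapply Rle_trans; [exact T|].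
      apply Rplus_le_compat; [now apply Rmult_le_compat_r|now apply Rmult_le_compat_l].
    + nra.
Qed.

(** Quadratic Taylor remainder of the power z^(n+1), by induction from z E + (w - z)(w^k - z^k) with
    E the previous remainder. The factor r^2 again stands in for lowered exponents. *)
Lemma pow_taylor_bound (z w : C) (r : R) n : 0 <= r -> Cmod z <= r -> Cmod w <= r ->
  Cmod (w ^ S n - z ^ S n - RtoC (INR (S n)) * z ^ n * (w - z)) * (r * r) <=
  INR (S n) * INR (S n) * r ^ S n * (Cmod (w - z) * Cmod (w - z)).
Proof.
  intros Hr Hz Hw. assert (D0 := Cmod_ge_0 (w - z)). induction n as [|n IH].
  - simpl. replace (w * 1 - z * 1 - 1 * 1 * (w - z))%C with (RtoC 0) by ring. rewrite Cmod_0.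
    rewrite Rmult_0_l. repeat apply Rmult_le_pos; lra.
  - assert (B := pow_diff_bound z w r (S n) Hr Hz Hw).
    set (k := S n) in *.
    replace (w ^ S k - z ^ S k - RtoC (INR (S k)) * z ^ k * (w - z))%C
      with (z * (w ^ k - z ^ k - RtoC (INR k) * z ^ n * (w - z)) + (w - z) * (w ^ k - z ^ k))%C.
    2: { rewrite S_INR, RtoC_plus, !Cpow_S. unfold k. rewrite !Cpow_S. ring. }
    set (E := (w ^ k - z ^ k - RtoC (INR k) * z ^ n * (w - z))%C) in *.
    set (G := (w ^ k - z ^ k)%C) in *.
    assert (T := Cmod_triangle (z * E) ((w - z) * G)). rewrite !Cmod_mult in T.
    assert (E0 := Cmod_ge_0 E).
    rewrite S_INR. change (r ^ S k) with (r * r ^ k).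
    assert (I0 := pos_INR k). assert (P : 0 <= r ^ k) by now apply pow_le.
    set (d := Cmod (w - z)) in *. set (p := r ^ k) in *. set (i := INR k) in *.
    apply Rle_trans with ((r * Cmod E + d * Cmod G) * (r * r)).
    { apply Rmult_le_compat_r; [nra|]. eapply Rle_trans; [exact T|]. apply Rplus_le_compat_r.
      now apply Rmult_le_compat_r. }
    apply Rle_trans with (r * (i * i * p * (d * d)) + d * r * (i * p * d)).
    { replace ((r * Cmod E + d * Cmod G) * (r * r)) with (r * (Cmod E * (r * r)) + d * r * (Cmod G * r)) by ring.
      apply Rplus_le_compat; (apply Rmult_le_compat_l; [|assumption]); [lra|].
      apply Rmult_le_pos; lra. }
    clearbody d p i. assert (X : 0 <= r * p * (d * d)) by (repeat apply Rmult_le_pos; easy).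
    assert (X' := Rmult_le_pos _ _ I0 X). lra.
Qed.

Definition dcoef (a : nat -> C) (n : nat) : C := (RtoC (INR (S n)) * a (S n))%C.

Lemma tame_dcoef a : tame a -> tame (dcoef a).
Proof. intros H. exact (tame_shift _ (tame_INR a H)). Qed.

(** Summing the quadratic remainders of the powers gives |f w - f z - g z (w - z)| <= K |w - z|^2
    for |w| <= r = (1 + |z|) / 2; [K] is finite because the terms n^2 |a_n| r^n decay
    geometrically. *)
Lemma pser_cder f g a z : pser f a -> pser g (dcoef a) -> unit_disc z -> cder f z (g z).
Proof.
  intros [Ta Hf] [_ Hg] Hz. unfold unit_disc in Hz.
  assert (Cz := Cmod_ge_0 z).
  set (r := (1 + Cmod z) / 2). assert (Hr : 0 < r < 1 /\ Cmod z < r) by (unfold r; lra).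
  destruct (tame_geom _ r (tame_INR _ (tame_INR _ Ta)) ltac:(lra)) as (M & q & HM & Hq & H).
  set (K := M / (1 - q) / (r * r)).
  assert (HK : 0 <= K).
  { unfold K. repeat apply Rmult_le_pos; try easy; apply Rlt_le, Rinv_0_lt_compat; nra. }
  assert (B : forall w, Cmod w <= r -> Cmod (f w - f z - g z * (w - z)) <= K * (Cmod (w - z) * Cmod (w - z))).
  { intros w Hw. assert (Uw : unit_disc w) by (unfold unit_disc; lra).
    set (e := fun n => (a (S n) * (w ^ S n - z ^ S n - RtoC (INR (S n)) * z ^ n * (w - z)))%C).
    assert (He : cser e (f w - f z - g z * (w - z))%C).
    { assert (S1 := cser_shift _ _ (Hf w Uw)). assert (S2 := cser_shift _ _ (Hf z Hz)).
      assert (S3 := cser_plus _ _ _ _ S1 (cser_scal (-(1))%C _ _ S2)).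
      assert (S4 := cser_plus _ _ _ _ S3 (cser_scal (-(w - z))%C _ _ (Hg z Hz))).
      replace (f w - f z - g z * (w - z))%C with
        (f w - a 0%nat * w ^ 0 + - (1) * (f z - a 0%nat * z ^ 0) + - (w - z) * g z)%C by (simpl; ring).
      eapply cser_ext; [|exact S4]. intros n. unfold e, dcoef. simpl. ring. }
    apply (cser_bound _ _ _ He). intros n.
    assert (E1 : rsum (fun k => Cmod (e k)) n <= rsum (fun k => Cmod (w - z) * Cmod (w - z) / (r * r) *
       (Cmod (RtoC (INR (S k)) * (RtoC (INR (S k)) * a (S k))) * r ^ S k)) n).
    { apply rsum_le. intros k _. unfold e. rewrite !Cmod_mult, !Cmod_R, !Rabs_pos_eq by apply pos_INR.
      assert (T := pow_taylor_bound z w r k ltac:(lra) ltac:(lra) Hw).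
      set (E := Cmod (w ^ S k - z ^ S k - RtoC (INR (S k)) * z ^ k * (w - z))) in *.
      apply Rmult_le_reg_r with (r * r); [nra|].
      replace (Cmod (w - z) * Cmod (w - z) / (r * r) * (INR (S k) * (INR (S k) * Cmod (a (S k))) * r ^ S k) * (r * r))
        with (Cmod (a (S k)) * (INR (S k) * INR (S k) * r ^ S k * (Cmod (w - z) * Cmod (w - z)))) by (field; lra).
      rewrite Rmult_assoc. apply Rmult_le_compat_l; [apply Cmod_ge_0|exact T]. }
    eapply Rle_trans; [exact E1|]. rewrite rsum_scal.
    assert (E2 : rsum (fun k => Cmod (RtoC (INR (S k)) * (RtoC (INR (S k)) * a (S k))) * r ^ S k) n <= M / (1 - q)).
    { apply Rle_trans with (rsum (fun k => Cmod (RtoC (INR k) * (RtoC (INR k) * a k)) * r ^ k) (S n)).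
      - rewrite rsum_shift.
        assert (0 <= Cmod (RtoC (INR 0) * (RtoC (INR 0) * a 0%nat)) * r ^ 0)
          by (apply Rmult_le_pos; [apply Cmod_ge_0|apply pow_le; lra]). lra.
      - apply rsum_geom; easy. }
    unfold K. replace (M / (1 - q) / (r * r) * (Cmod (w - z) * Cmod (w - z))) with
      (Cmod (w - z) * Cmod (w - z) / (r * r) * (M / (1 - q))) by (field; lra).
    apply Rmult_le_compat_l; [|exact E2].
    apply Rmult_le_pos; [|apply Rlt_le, Rinv_0_lt_compat; nra]. apply Rmult_le_pos; apply Cmod_ge_0. }
  intros eps He. exists (Rmin (r - Cmod z) (eps / (K + 1))). split.
  { apply Rmin_glb_lt; [lra|]. apply Rdiv_lt_0_compat; lra. }
  intros w Hw.
  destruct (Rlt_Rmin _ _ _ Hw) as [W1 W2].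
  eapply Rle_trans; [apply B; generalize (Cmod_rev w z); lra|].
  rewrite <- Rmult_assoc. apply Rmult_le_compat_r; [apply Cmod_ge_0|].
  apply Rlt_div_r in W2; [|lra].
  generalize (Cmod_ge_0 (w - z)). nra.
Qed.

Lemma pser_hol f a : pser f a -> hol f.
Proof.
  intros H z Hz. destruct (pser_exists (dcoef a) (tame_dcoef _ (proj1 H))) as [g Hg].
  exists (g z). now apply (pser_cder f g a).
Qed.

(** The constant term is the limit at 0 of the sum. The hypothesis leaves out z = 0 so that it
    survives division by z, and the induction on [n] can pass to the shifted sequence. *)
Lemma pser_unique_zero (rho : R) : 0 < rho -> forall n (d : nat -> C),
  (exists M, forall n, Cmod (d n) * rho ^ n <= M) ->
  (forall z : C, z <> 0%C -> Cmod z < rho -> cser (fun n => d n * z ^ n)%C 0) ->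
  d n = 0%C.
Proof.
  intros Hrho.
  assert (D0 : forall d : nat -> C, (exists M, forall n, Cmod (d n) * rho ^ n <= M) ->
     (forall z : C, z <> 0%C -> Cmod z < rho -> cser (fun n => d n * z ^ n)%C 0) -> d O = 0%C).
  { intros d [M HM] H. assert (M0 : 0 <= M).
    { specialize (HM O). simpl in HM. generalize (Cmod_ge_0 (d O)). lra. }
    apply Cmod_eq_0, Rle_antisym; [|apply Cmod_ge_0]. apply Rnot_lt_le. intros Hlt.
    (* At the point x rho the remaining terms sum to at most M x / (1 - x) <= 2 M x, which by the
       second bound on [x] is smaller than |d_0|. *)
    set (x := Rmin (/ 2) (Cmod (d O) / (2 * (M + 1) * 2))).
    assert (Hx : 0 < x) by (apply Rmin_glb_lt; [lra|apply Rdiv_lt_0_compat; lra]).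
    assert (X1 : x <= / 2) by apply Rmin_l.
    assert (X2 : x <= Cmod (d O) / (2 * (M + 1) * 2)) by apply Rmin_r.
    assert (Cz : Cmod (RtoC (x * rho)) = x * rho) by (rewrite Cmod_R, Rabs_pos_eq; nra).
    specialize (H (RtoC (x * rho))).
    assert (Hs : cser (fun n => d n * RtoC (x * rho) ^ n)%C 0).
    { apply H; [|rewrite Cz; nra]. intros E. apply RtoC_inj in E. nra. }
    assert (T' : Cmod (0 - csum (fun n => d n * RtoC (x * rho) ^ n)%C 1) <= M / (1 - x) * x ^ 1).
    { apply (cser_geom_tail _ _ M x 1); [lra|easy| |easy]. intros k. rewrite Cmod_mult, Cmod_pow, Cz, Rpow_mult_distr.
      rewrite (Rmult_comm (x ^ k)), <- Rmult_assoc. apply Rmult_le_compat_r; [apply pow_le; lra|apply HM]. }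
    simpl in T'. replace (0 - (0 + d O * 1))%C with (- d O)%C in T' by ring.
    rewrite Cmod_opp, Rmult_1_r in T'.
    assert (G : M / (1 - x) <= 2 * M).
    { apply Rmult_le_reg_r with (1 - x); [lra|]. unfold Rdiv. rewrite Rmult_assoc, Rinv_l; nra. }
    apply (Rmult_le_compat_r (2 * (M + 1) * 2)) in X2; [|lra].
    unfold Rdiv in X2. rewrite (Rmult_assoc (Cmod (d O))), Rinv_l, Rmult_1_r in X2 by lra. nra. }
  induction n as [|n IH]; intros d HM H; [now apply D0|].
  apply (IH (fun k => d (S k))).
  - destruct HM as [M HM]. exists (M / rho). intros k. apply Rmult_le_reg_r with rho; [easy|].
    unfold Rdiv. rewrite (Rmult_assoc M), Rinv_l, Rmult_1_r by lra.
    specialize (HM (S k)). simpl in HM. lra.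
  - intros z Hz Hzr. assert (Hs := cser_scal (/ z)%C _ _ (cser_shift _ _ (H z Hz Hzr))).
    cbv beta in Hs. rewrite (D0 d HM H) in Hs. replace (/ z * (0 - 0 * z ^ 0))%C with (RtoC 0) in Hs by (simpl; field; easy).
    eapply cser_ext; [|exact Hs]. intros k. cbv beta. rewrite Cpow_S. field. easy.
Qed.

Lemma pser_unique f a b : pser f a -> pser f b -> forall n, a n = b n.
Proof.
  intros [Ta Ha] [Tb Hb] n. apply Ceq_minus.
  apply (pser_unique_zero (/ 2) ltac:(lra) n (fun k => a k - b k)%C).
  - assert (T := tame_plus _ _ Ta (tame_scal (-(1))%C _ Tb)).
    destruct (T (/ 2) ltac:(lra)) as [M HM]. exists M. intros k. specialize (HM k).
    now replace (a k - b k)%C with (a k + - (1) * b k)%C by ring.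
  - intros z _ Hz. assert (Uz : unit_disc z) by (unfold unit_disc; lra).
    assert (Hs := cser_plus _ _ _ _ (Ha z Uz) (cser_scal (-(1))%C _ _ (Hb z Uz))).
    replace (f z + - (1) * f z)%C with (RtoC 0) in Hs by ring.
    eapply cser_ext; [|exact Hs]. intros k. simpl. ring.
Qed.

(** * Cauchy's formula on circles, Bessel's inequality *)

Definition circ (r theta : R) : C := (r * cos theta, r * sin theta).

Lemma circ_mod r theta : 0 <= r -> Cmod (circ r theta) = r.
Proof.
  intros Hr. unfold Cmod, circ; simpl.
  replace (r * cos theta * (r * cos theta * 1) + r * sin theta * (r * sin theta * 1))
    with (r * r * ((sin theta)² + (cos theta)²)) by (unfold Rsqr; ring).
  rewrite sin2_cos2, Rmult_1_r. now apply sqrt_square.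
Qed.

Lemma circ_disc r theta : 0 <= r < 1 -> unit_disc (circ r theta).
Proof. intros Hr. unfold unit_disc. rewrite circ_mod; lra. Qed.

Lemma circ_nz r theta : 0 < r -> circ r theta <> 0%C.
Proof. intros Hr. apply Cmod_gt_0. rewrite circ_mod; lra. Qed.

Lemma circ_pder r theta : pder (circ r) theta (Ci * circ r theta)%C.
Proof.
  replace (Ci * circ r theta)%C with ((r * - sin theta, r * cos theta) : C).
  - apply (pder_pair (fun x => r * cos x) (fun x => r * sin x)); auto_derive; try easy; ring.
  - apply injective_projections; simpl; ring.
Qed.

Lemma circ_pcont r theta : pcont (circ r) theta.
Proof. exact (pder_cont _ _ _ (circ_pder r theta)). Qed.

Lemma circ_period r : circ r (2 * PI) = circ r 0.
Proof. unfold circ. now rewrite cos_2PI, sin_2PI, cos_0, sin_0. Qed.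

Lemma circ_pcont_comp f r theta : dcont f -> 0 <= r < 1 -> pcont (fun x => f (circ r x)) theta.
Proof. intros Hf Hr. apply pcont_comp; [|apply circ_pcont]. now apply Hf, circ_disc. Qed.

Lemma two_PI_pos : 0 < 2 * PI.
Proof. generalize PI_RGT_0. lra. Qed.

(** Up to the factor i the integrand is the derivative of [prim q] along the circle, and the circle
    is closed. *)
Lemma cauchy_circle q r : hol q -> 0 <= r < 1 ->
  CInt (fun x => q (circ r x) * circ r x)%C 0 (2 * PI) = 0%C.
Proof.
  intros Hq Hr. assert (P := two_PI_pos). assert (Dq := hol_dcont q Hq).
  assert (Hc : pcont_on (fun x => q (circ r x) * circ r x)%C 0 (2 * PI)).
  { intros s _. assert (H1 := circ_pcont_comp q r s Dq Hr). assert (H2 := circ_pcont r s).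
    unfold pcont in *. clim_tac. }
  assert (E : CInt (fun x => Ci * (q (circ r x) * circ r x))%C 0 (2 * PI) =
    (prim q (circ r (2 * PI)) - prim q (circ r 0))%C).
  { apply (CInt_FTC (fun x => prim q (circ r x))); [lra| |].
    - intros s _. replace (Ci * (q (circ r s) * circ r s))%C with (q (circ r s) * (Ci * circ r s))%C by ring.
      apply pder_comp; [|apply circ_pder]. apply prim_cder; [easy|]. now apply circ_disc.
    - intros s Hs. now apply pcont_scal, Hc. }
  rewrite CInt_scal in E by (lra || easy). rewrite circ_period in E.
  replace (CInt (fun x => q (circ r x) * circ r x)%C 0 (2 * PI)) with
    (/ Ci * (Ci * CInt (fun x => q (circ r x) * circ r x) 0 (2 * PI)))%C by (field; apply Ci_nz).
  rewrite E. field. apply Ci_nz.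
Qed.

Lemma cder_pow n z : cder (fun w => w ^ S n)%C z (RtoC (INR (S n)) * z ^ n)%C.
Proof.
  induction n as [|n IH].
  - apply (cder_ext_loc (fun w => w)%C _ z _ 1); [lra|intros; simpl; ring|].
    eapply cder_eq; [apply cder_id|simpl; ring].
  - apply (cder_ext_loc (fun w => w * w ^ S n)%C _ z _ 1); [lra|intros; rewrite !Cpow_S; ring|].
    eapply cder_eq; [apply (cder_mult (fun w => w) (fun w => w ^ S n)%C); [apply cder_id|apply IH]|].
    rewrite (S_INR (S n)), RtoC_plus, !Cpow_S. ring.
Qed.

(** The integrand is the angular derivative of i z^(-(n+1)) / (n+1), which has period 2 PI. The pole
    at 0 keeps [cauchy_circle] from applying. *)
Lemma circle_inv_pow r n : 0 < r ->
  CInt (fun x => (/ circ r x) ^ S n)%C 0 (2 * PI) = 0%C.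
Proof.
  intros Hr. assert (P := two_PI_pos).
  assert (Hn : RtoC (INR (S n)) <> 0%C).
  { intros E. apply RtoC_inj in E. generalize (lt_0_INR (S n) ltac:(lia)). lra. }
  assert (HD : forall s, pder (fun x => Ci / RtoC (INR (S n)) * (/ circ r x) ^ S n)%C s ((/ circ r s) ^ S n)%C).
  { intros s. assert (Hz := circ_nz r s Hr).
    assert (Hd : cder (fun w => Ci / RtoC (INR (S n)) * (/ w) ^ S n)%C (circ r s)
       (Ci / RtoC (INR (S n)) * ((RtoC (INR (S n)) * (/ circ r s) ^ n) * (- (1) / (circ r s * circ r s))))%C).
    { apply cder_scal. apply (cder_comp (fun w => w ^ S n)%C (fun w => / w)%C); [apply cder_pow|].
      apply (cder_inv (fun w => w)); [easy|apply cder_id]. }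
    assert (K := pder_comp _ _ _ _ _ Hd (circ_pder r s)).
    replace ((/ circ r s) ^ S n)%C with
      (Ci / RtoC (INR (S n)) * ((RtoC (INR (S n)) * (/ circ r s) ^ n) * (- (1) / (circ r s * circ r s))) * (Ci * circ r s))%C; [exact K|].
    rewrite Cpow_S. replace (/ circ r s * (/ circ r s) ^ n)%C with (- (Ci * Ci) * (/ circ r s * (/ circ r s) ^ n))%C.
    - field. now split.
    - replace (Ci * Ci)%C with (-(1))%C by (apply injective_projections; simpl; ring). ring. }
  rewrite (CInt_FTC (fun x => Ci / RtoC (INR (S n)) * (/ circ r x) ^ S n)%C).
  - rewrite circ_period. ring.
  - lra.
  - intros s _. apply HD.
  (* The integrand is a constant multiple of the antiderivative, whose continuity is already known
     from its derivative. *)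
  - intros s _. assert (K := pder_cont _ _ _ (HD s)).
    assert (K2 := pcont_scal (RtoC (INR (S n)) / Ci)%C _ s K).
    intros eps He. generalize (K2 eps He). apply filter_imp. intros x.
    replace (RtoC (INR (S n)) / Ci * (Ci / RtoC (INR (S n)) * (/ circ r x) ^ S n))%C with ((/ circ r x) ^ S n)%C
      by (field; split; [easy|apply Ci_nz]).
    replace (RtoC (INR (S n)) / Ci * (Ci / RtoC (INR (S n)) * (/ circ r s) ^ S n))%C with ((/ circ r s) ^ S n)%C
      by (field; split; [easy|apply Ci_nz]). easy.
Qed.

Lemma pcont_Cmod p s : pcont p s -> continuous (fun x => Cmod (p x)) s.
Proof.
  intros H. apply (filterlim_locally (F := locally s)). intros eps.
  generalize (H eps (cond_pos eps)). apply filter_imp. intros x Hx.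
  change (Rabs (Cmod (p x) - Cmod (p s)) < eps).
  generalize (Cmod_rev (p x) (p s)) (Cmod_rev (p s) (p x)). rewrite (Cmod_sym (p s)).
  intros H1 H2. apply Rabs_def1; lra.
Qed.

Lemma pcont_bounded p a b : a <= b -> pcont_on p a b -> exists M, forall s, a <= s <= b -> Cmod (p s) <= M.
Proof.
  intros Hab H. destruct (continuity_ab_maj (fun x => Cmod (p x)) a b Hab) as [x [Hx _]].
  { intros c Hc. apply continuity_pt_filterlim. now apply pcont_Cmod, H. }
  exists (Cmod (p x)). apply Hx.
Qed.

Lemma cder_unique f z a b : cder f z a -> cder f z b -> a = b.
Proof.
  rewrite !cder_is_derive. intros Ha Hb.
  now rewrite <- (is_C_derive_unique f z a Ha), <- (is_C_derive_unique f z b Hb).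
Qed.

Definition slope (V F : C -> C) (w z : C) : C :=
  if Ceq_dec z w then F w else ((V z - V w) / (z - w))%C.

(* At [w] the quotient is the mean of [V' = F] over the segment from [w] to [z], and
   [F] has a first-order expansion at [w]; thus no higher regularity of [V] is needed. *)
Lemma slope_hol V F w : hol F -> (forall z, unit_disc z -> cder V z (F z)) -> unit_disc w ->
  hol (slope V F w).
Proof.
  intros HF HV Hw z Hz. destruct (Ceq_dec z w) as [->|Hzw].
  (* The mean of F(w) + l (u - w) over the segment from w to z is F(w) + l (z - w) / 2, hence the
     derivative l / 2. *)
  - destruct (HF w Hw) as [l Hl]. exists (l / 2)%C.
    assert (DF := hol_dcont F HF).
    destruct (unit_disc_open w Hw) as [d1 [d10 H1]].
    intros eps He. destruct (Hl eps He) as [d2 [d20 H2]].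
    exists (Rmin d1 d2). split; [now apply Rmin_glb_lt|]. intros z Hzd.
    destruct (Rlt_Rmin _ _ _ Hzd) as [W1 W2].
    assert (Uz := H1 z W1). unfold slope.
    destruct (Ceq_dec w w) as [_|]; [|easy].
    destruct (Ceq_dec z w) as [->|Hne].
    { replace (F w - F w - l / 2 * (w - w))%C with (RtoC 0) by ring. rewrite Cmod_0.
      apply Rmult_le_pos; [lra|apply Cmod_ge_0]. }
    assert (Hn : (z - w)%C <> 0%C) by now apply Cminus_eq_contra.
    set (g := fun u => (F w + l * (u - w))%C).
    assert (Dg : dcont g) by apply dcont_aff.
    assert (E1 : seg F w z = (V z - V w)%C) by (apply seg_FTC; easy).
    assert (E2 := seg_affine (F w) l w w z Hw Uz). fold g in E2.
    assert (B : Cmod (seg (fun u => F u - g u)%C w z) <= Cmod (z - w) * (eps * Cmod (z - w))).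
    { apply seg_norm; try easy.
      - intros u Hu. assert (A1 := DF u Hu). assert (A2 := Dg u Hu). unfold ccont in *. clim_tac.
      - intros s Hs.
        assert (Es : Cmod (w + RtoC s * (z - w) - w) <= Cmod (z - w)).
        { replace (w + RtoC s * (z - w) - w)%C with (RtoC s * (z - w))%C by ring.
          rewrite Cmod_mult, Cmod_R, Rabs_pos_eq by lra. generalize (Cmod_ge_0 (z - w)). nra. }
        unfold g. replace (F (w + RtoC s * (z - w)) - (F w + l * (w + RtoC s * (z - w) - w)))%C
          with (F (w + RtoC s * (z - w)) - F w - l * (w + RtoC s * (z - w) - w))%C by ring.
        eapply Rle_trans; [apply H2; lra|]. apply Rmult_le_compat_l; lra. }
    rewrite seg_minus, E1, E2 in B by easy.
    replace ((V z - V w) / (z - w) - F w - l / 2 * (z - w))%C with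
      ((V z - V w - (F w * (z - w) + l * ((z - w) * (z - w) - (w - w) * (w - w)) / 2)) / (z - w))%C
      by (field; easy).
    rewrite Cmod_div by easy. assert (Cp : 0 < Cmod (z - w)) by now apply Cmod_gt_0.
    apply Rmult_le_reg_r with (Cmod (z - w)); [easy|].
    unfold Rdiv. rewrite Rmult_assoc, Rinv_l, Rmult_1_r by lra. lra.
  - assert (Hn : (z - w)%C <> 0%C) by now apply Cminus_eq_contra.
    exists ((F z * (z - w) - (V z - V w) * 1) / ((z - w) * (z - w)))%C.
    apply (cder_ext_loc (fun u => (V u - V w) / (u - w))%C _ z _ (Cmod (z - w))).
    + now apply Cmod_gt_0.
    + intros u Hu. unfold slope. destruct (Ceq_dec u w) as [->|]; [|easy].
      rewrite Cmod_sym in Hu. lra.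
    + apply (cder_div (fun u => V u - V w)%C (fun u => u - w)%C); [easy| |].
      * eapply cder_eq; [apply cder_minus; [now apply HV|apply cder_const]|ring].
      * eapply cder_eq; [apply cder_minus; [apply cder_id|apply cder_const]|ring].
Qed.

Lemma CInt_csum (g : nat -> R -> C) a b N : a <= b -> (forall j, pcont_on (g j) a b) ->
  CInt (fun x => csum (fun j => g j x) N) a b = csum (fun j => CInt (g j) a b) N /\
  pcont_on (fun x => csum (fun j => g j x) N) a b.
Proof.
  intros Hab Hg. induction N as [|N [IH1 IH2]]; simpl.
  - split; [rewrite CInt_const by easy; ring|]. intros s _. unfold pcont. clim_tac.
  - split.
    + rewrite CInt_plus; [now rewrite IH1|easy|easy|apply Hg].
    + intros s Hs. assert (H1 := IH2 s Hs). assert (H2 := Hg N s Hs). unfold pcont in *. clim_tac.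
Qed.

Lemma geom_expand (z w : C) N : z <> 0%C -> (z - w)%C <> 0%C ->
  (z / (z - w))%C = (csum (fun j => w ^ j * (/ z) ^ j) N + w ^ N * (/ z) ^ N * (z / (z - w)))%C.
Proof.
  intros Hz Hzw. induction N as [|N IH]; simpl csum.
  - simpl. ring.
  - rewrite IH at 1. rewrite !Cpow_S.
    replace (w ^ N * (/ z) ^ N * (z / (z - w)))%C
      with (w ^ N * (/ z) ^ N + w * w ^ N * (/ z * (/ z) ^ N) * (z / (z - w)))%C; [ring|].
    field. now split.
Qed.

(** The Cauchy coefficient of z^j, i.e. the contour integral of V(z) / z^(j+1) divided by 2 PI i,
    written in the angle, where dz = i z dtheta. *)
Definition ccoef (V : C -> C) (r : R) (j : nat) : C :=
  (/ RtoC (2 * PI) * CInt (fun x => V (circ r x) * (/ circ r x) ^ j)%C 0 (2 * PI))%C.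

Lemma pcont_inv_pow r j s : 0 < r -> pcont (fun x => (/ circ r x) ^ j)%C s.
Proof.
  intros Hr. assert (Hc := circ_pcont r s). assert (Hz := circ_nz r s Hr).
  unfold pcont in *. induction j as [|j IH]; simpl; clim_tac. easy.
Qed.

Lemma two_PI_nz : RtoC (2 * PI) <> 0%C.
Proof. intros E. apply RtoC_inj in E. generalize two_PI_pos. lra. Qed.

Lemma ccoef_bound V r : dcont V -> 0 < r < 1 -> exists M, forall j, Cmod (ccoef V r j) * r ^ j <= M.
Proof.
  intros DV Hr. assert (P := two_PI_pos).
  destruct (pcont_bounded (fun x => V (circ r x)) 0 (2 * PI)) as [M HM]; [lra| |].
  { intros s _. apply circ_pcont_comp; [easy|lra]. }
  exists M. intros j. unfold ccoef.
  assert (Pj : 0 < r ^ j) by (apply pow_lt; lra).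
  rewrite Cmod_mult, Cmod_inv, Cmod_R, Rabs_pos_eq by (apply two_PI_nz || lra).
  assert (B : Cmod (CInt (fun x => V (circ r x) * (/ circ r x) ^ j)%C 0 (2 * PI)) <= (2 * PI - 0) * (M * / r ^ j)).
  { apply CInt_norm; [lra| |].
    - intros s _. assert (H1 := circ_pcont_comp V r s DV ltac:(lra)).
      assert (H2 := pcont_inv_pow r j s ltac:(lra)). unfold pcont in *. clim_tac.
    - intros s Hs. rewrite Cmod_mult, Cmod_pow, Cmod_inv, circ_mod, pow_inv by (lra || apply circ_nz; lra).
      apply Rmult_le_compat_r; [|now apply HM]. apply Rlt_le, Rinv_0_lt_compat. lra. }
  apply Rle_trans with (/ (2 * PI) * ((2 * PI - 0) * (M * / r ^ j)) * r ^ j).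
  - apply Rmult_le_compat_r; [lra|]. apply Rmult_le_compat_l; [|easy].
    apply Rlt_le, Rinv_0_lt_compat. lra.
  - apply Req_le. field. split; [lra|]. generalize PI_RGT_0. lra.
Qed.

(** Cauchy's theorem for the difference quotient at w says that (V(z) - V(w)) z / (z - w) has
    angular integral 0. Expanding z / (z - w) into powers of w / z produces the partial sums of the
    series; the constant V(w) contributes only to j = 0, by [circle_inv_pow], and the remainder is
    of order (|w| / r)^N. *)
Lemma cauchy_series V F r w : hol F -> (forall z, unit_disc z -> cder V z (F z)) ->
  0 < r < 1 -> Cmod w < r -> cser (fun j => ccoef V r j * w ^ j)%C (V w).
Proof.
  intros HF HV Hr Hw. assert (P := two_PI_pos).
  assert (Uw : unit_disc w) by (unfold unit_disc; lra).
  assert (DV : dcont V) by (intros z Hz; apply (cder_cont V z (F z)); auto).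
  assert (Hne : forall x, (circ r x - w)%C <> 0%C).
  { intros x. apply Cmod_gt_0. generalize (Cmod_rev (circ r x) w). rewrite circ_mod; lra. }
  assert (Hnz : forall x, circ r x <> 0%C) by (intros; apply circ_nz; lra).
  set (G := fun x => ((V (circ r x) - V w) * (circ r x / (circ r x - w)))%C).
  set (g := fun j x => ((V (circ r x) - V w) * (w ^ j * (/ circ r x) ^ j))%C).
  set (h := fun N x => ((V (circ r x) - V w) * (w ^ N * (/ circ r x) ^ N * (circ r x / (circ r x - w))))%C).
  assert (HVc : forall s, pcont (fun x => V (circ r x)) s) by (intros; apply circ_pcont_comp; [easy|lra]).
  assert (Hcc := circ_pcont r).
  assert (Hip : forall j s, pcont (fun x => (/ circ r x) ^ j)%C s) by (intros; apply pcont_inv_pow; lra).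
  assert (Hg : forall j s, pcont (g j) s).
  { intros j s. specialize (HVc s). specialize (Hip j s). unfold g, pcont in *. clim_tac. }
  assert (Hh : forall N s, pcont (h N) s).
  { intros N s. specialize (HVc s). specialize (Hip N s). specialize (Hcc s). unfold h, pcont in *. clim_tac. apply Hne. }
  assert (E0 : CInt G 0 (2 * PI) = 0%C).
  { rewrite <- (cauchy_circle (slope V F w) r) by (lra || now apply slope_hol).
    apply CInt_ext; [lra|]. intros s _. unfold G, slope.
    destruct (Ceq_dec (circ r s) w) as [E|_].
    - exfalso. apply (Hne s). rewrite E. ring.
    - field. apply Hne. }
  assert (E1 : forall N, (CInt G 0 (2 * PI) = csum (fun j => CInt (g j) 0 (2 * PI)) N + CInt (h N) 0 (2 * PI))%C).
  { intros N. destruct (CInt_csum g 0 (2 * PI) N ltac:(lra) (fun j s _ => Hg j s)) as [K1 K2].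
    rewrite <- K1, <- CInt_plus; [|lra|easy|intros s _; apply Hh].
    apply CInt_ext; [lra|]. intros s _. unfold G, g, h.
    rewrite csum_scal. rewrite <- Cmult_plus_distr_l. f_equal. now apply geom_expand. }
  assert (E2 : forall j, CInt (g j) 0 (2 * PI) =
     (RtoC (2 * PI) * (ccoef V r j * w ^ j - match j with O => V w | S _ => 0 end))%C).
  { intros j. unfold g.
    rewrite (CInt_ext _ (fun x => w ^ j * (V (circ r x) * (/ circ r x) ^ j) - (V w * w ^ j) * (/ circ r x) ^ j)%C)
      by (lra || intros; ring).
    assert (Hv : forall s, pcont (fun x => V (circ r x) * (/ circ r x) ^ j)%C s).
    { intros s. specialize (HVc s). specialize (Hip j s). unfold pcont in *. clim_tac. }
    rewrite CInt_minus, !CInt_scal; try lra; try (intros s _; auto; apply pcont_scal; auto).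
    unfold ccoef. destruct j as [|j].
    - rewrite (CInt_ext (fun x => (/ circ r x) ^ 0)%C (fun _ => 1%C)) by (lra || now intros).
      rewrite CInt_const by lra. replace (2 * PI - 0) with (2 * PI) by ring. simpl. field. apply two_PI_nz.
    - rewrite circle_inv_pow by lra. field. apply two_PI_nz. }
  (* One bound serves for all remainders, because [h N] is [h 0] times (w / z)^N. *)
  destruct (pcont_bounded (h 0%nat) 0 (2 * PI)) as [M HM]; [lra|intros s _; apply Hh|].
  assert (M0 : 0 <= M) by (eapply Rle_trans; [apply Cmod_ge_0|apply (HM 0); lra]).
  assert (B : forall N, Cmod (csum (fun j => ccoef V r j * w ^ j)%C (S N) - V w) <= M * (Cmod w / r) ^ S N).
  { intros N. specialize (E1 (S N)). rewrite E0 in E1.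
    rewrite (csum_ext _ (fun j => RtoC (2 * PI) * (ccoef V r j * w ^ j - match j with O => V w | S _ => 0 end))%C) in E1
      by (intros; apply E2).
    rewrite csum_scal in E1.
    rewrite (csum_ext _ (fun j => ccoef V r j * w ^ j + (- (1)) * match j with O => V w | S _ => 0 end)%C) in E1
      by (intros; ring).
    rewrite csum_plus, csum_scal, (csum_zero_tail (fun j => match j with O => V w | S _ => 0 end)%C) in E1 by easy.
    set (X := csum (fun j => ccoef V r j * w ^ j)%C (S N)) in *.
    assert (EX : (X - V w)%C = (- / RtoC (2 * PI) * CInt (h (S N)) 0 (2 * PI))%C).
    { assert (E' : CInt (h (S N)) 0 (2 * PI) = (- (RtoC (2 * PI) * (X + - (1) * V w)))%C).
      { replace (CInt (h (S N)) 0 (2 * PI)) with (RtoC (2 * PI) * (X + - (1) * V w) + CInt (h (S N)) 0 (2 * PI) - RtoC (2 * PI) * (X + - (1) * V w))%C by ring.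
        rewrite <- E1. ring. }
      rewrite E'. field. apply two_PI_nz. }
    rewrite EX, Cmod_mult, Cmod_opp, Cmod_inv, Cmod_R, Rabs_pos_eq by (apply two_PI_nz || lra).
    assert (Bh : Cmod (CInt (h (S N)) 0 (2 * PI)) <= (2 * PI - 0) * (M * (Cmod w / r) ^ S N)).
    { apply CInt_norm; [lra|intros s _; apply Hh|]. intros s Hs.
      replace (h (S N) s) with (h 0%nat s * (w ^ S N * (/ circ r s) ^ S N))%C by (unfold h; simpl; ring).
      rewrite !Cmod_mult, !Cmod_pow, Cmod_inv, circ_mod by (lra || apply Hnz).
      rewrite <- Rpow_mult_distr. apply Rmult_le_compat_r; [|now apply HM].
      apply pow_le. apply Rmult_le_pos; [apply Cmod_ge_0|apply Rlt_le, Rinv_0_lt_compat; lra]. }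
    apply Rle_trans with (/ (2 * PI) * ((2 * PI - 0) * (M * (Cmod w / r) ^ S N))).
    - apply Rmult_le_compat_l; [apply Rlt_le, Rinv_0_lt_compat; lra|easy].
    - apply Req_le. field. generalize PI_RGT_0. lra. }
  apply clim_seq. intros eps He.
  assert (Hq : 0 <= Cmod w / r < 1).
  { split; [apply Rmult_le_pos; [apply Cmod_ge_0|apply Rlt_le, Rinv_0_lt_compat; lra]|].
    apply Rmult_lt_reg_r with r; [lra|]. unfold Rdiv. rewrite Rmult_assoc, Rinv_l; lra. }
  destruct (pow_lt_1_zero (Cmod w / r) ltac:(rewrite Rabs_pos_eq; lra) (eps / (M + 1)) ltac:(apply Rdiv_lt_0_compat; lra)) as [N HN].
  exists (S N). intros n Hn. destruct n as [|n]; [lia|].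
  eapply Rle_lt_trans; [apply B|]. specialize (HN (S n) ltac:(lia)).
  rewrite Rabs_pos_eq in HN by now apply pow_le.
  apply (Rmult_lt_compat_r (M + 1)) in HN; [|lra].
  unfold Rdiv at 2 in HN. rewrite Rmult_assoc, Rinv_l, Rmult_1_r in HN by lra.
  nra.
Qed.

(** The coefficients of [V] at different radii agree, since they represent the same function on |z|
    < 1/2. A single sequence thus satisfies the coefficient bounds for radii up to 1, and its
    termwise derivative is the series of [f]. *)
Theorem hol_pser f : hol f -> exists a, pser f a.
Proof.
  intros Hf. set (V := prim f).
  assert (HV : forall z, unit_disc z -> cder V z (f z)) by (intros; now apply prim_cder).
  assert (DV : dcont V) by (intros z Hz; apply (cder_cont V z (f z)); auto).
  set (v := ccoef V (/ 2)).
  assert (Ev : forall r j, / 2 <= r < 1 -> ccoef V r j = v j).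
  { intros r j Hr. apply Ceq_minus.
    apply (pser_unique_zero (/ 2) ltac:(lra) j (fun k => ccoef V r k - v k)%C).
    - destruct (ccoef_bound V r DV ltac:(lra)) as [M HM].
      destruct (ccoef_bound V (/ 2) DV ltac:(lra)) as [K HK].
      exists (M + K). intros k. specialize (HM k). specialize (HK k). fold v in HK.
      assert (T := Cmod_triangle (ccoef V r k) (- v k)). rewrite Cmod_opp in T.
      assert (Q : (/ 2) ^ k <= r ^ k) by (apply pow_incr; lra).
      assert (Q0 : 0 < (/ 2) ^ k) by (apply pow_lt; lra).
      assert (G := Cmod_ge_0 (ccoef V r k)). unfold Cminus. nra.
    - intros z _ Hz.
      assert (S1 := cauchy_series V f r z Hf HV ltac:(lra) ltac:(lra)).
      assert (S2 := cauchy_series V f (/ 2) z Hf HV ltac:(lra) ltac:(lra)).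
      assert (Hs := cser_plus _ _ _ _ S1 (cser_scal (-(1))%C _ _ S2)).
      replace (V z + - (1) * V z)%C with (RtoC 0) in Hs by ring.
      eapply cser_ext; [|exact Hs]. intros k. unfold v. simpl. ring. }
  assert (HP : pser V v).
  { split.
    - intros r Hr. set (r' := Rmax r (/ 2)).
      assert (R1 : r <= r') by apply Rmax_l. assert (R2 : / 2 <= r') by apply Rmax_r.
      assert (R3 : r' < 1) by (apply Rmax_lub_lt; lra).
      destruct (ccoef_bound V r' DV ltac:(lra)) as [M HM]. exists M. intros n.
      rewrite <- (Ev r') by lra. eapply Rle_trans; [|apply HM].
      apply Rmult_le_compat_l; [apply Cmod_ge_0|]. apply pow_incr. lra.
    - intros z Hz. unfold unit_disc in Hz. assert (C0 := Cmod_ge_0 z).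
      eapply cser_ext; [|apply (cauchy_series V f ((1 + Cmod z) / 2) z Hf HV); lra].
      intros n. cbv beta. rewrite Ev by lra. reflexivity. }
  exists (dcoef v). destruct (pser_exists (dcoef v) (tame_dcoef v (proj1 HP))) as [g Hg].
  apply (pser_ext g f); [|easy]. intros z Hz. apply (cder_unique V z); [|now apply HV].
  now apply (pser_cder V g v).
Qed.

(** * Square means on circles and coefficient bounds *)

Definition sq_mean (f : C -> C) (r : R) : R := RInt (fun x => Cmod (f (circ r x)) ^ 2) 0 (2 * PI).

Lemma sq_mean_correct f r : dcont f -> 0 <= r < 1 ->
  is_RInt (fun x => Cmod (f (circ r x)) ^ 2) 0 (2 * PI) (sq_mean f r).
Proof.
  intros Hf Hr. apply (@RInt_correct R_CompleteNormedModule), (@ex_RInt_continuous R_CompleteNormedModule). intros z _.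
  assert (H := pcont_Cmod _ _ (circ_pcont_comp f r z Hf Hr)).
  apply (continuous_ext (fun x => mult (Cmod (f (circ r x))) (Cmod (f (circ r x))))).
  - intros x. unfold mult; simpl. ring.
  - now apply (continuous_mult (K := R_AbsRing)).
Qed.

Lemma sq_mean_nonneg f r : dcont f -> 0 <= r < 1 -> 0 <= sq_mean f r.
Proof.
  intros Hf Hr. assert (P := two_PI_pos).
  assert (I := @is_RInt_const R_NormedModule 0 (2 * PI) 0).
  replace (scal (2 * PI - 0) (0 : R_NormedModule)) with (0 : R_NormedModule) in I
    by (unfold scal; simpl; unfold mult; simpl; ring).
  apply (is_RInt_le (fun _ => 0) (fun x => Cmod (f (circ r x)) ^ 2) 0 (2 * PI)); [lra|exact I|now apply sq_mean_correct|].
  - intros x _. apply pow_le, Cmod_ge_0.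
Qed.

(** On the circle f = a_0 + z g with g the backward shift. Expanding the square leaves the cross
    term 2 Re (conj(a_0) z g), whose integral vanishes by [cauchy_circle]. *)
Lemma sq_mean_step f a r : pser f a -> 0 <= r < 1 ->
  sq_mean f r = 2 * PI * Cmod (a O) ^ 2 + r ^ 2 * sq_mean (slope0 f a) r.
Proof.
  intros Hf Hr. assert (P := two_PI_pos). assert (Hg := pser_slope0 f a Hf).
  set (g := slope0 f a) in *. assert (Hh := pser_hol g _ Hg). assert (Dg := hol_dcont g Hh).
  apply is_RInt_unique.
  assert (Hc : pcont_on (fun x => g (circ r x) * circ r x)%C 0 (2 * PI)).
  { intros s _. assert (H1 := circ_pcont_comp g r s Dg Hr). assert (H2 := circ_pcont r s).
    unfold pcont in *. clim_tac. }
  assert (I1 := CInt_correct _ 0 (2 * PI) ltac:(lra) (fun s Hs => pcont_scal (RtoC 2 * Cconj (a O))%C _ s (Hc s Hs))).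
  rewrite CInt_scal in I1 by (lra || easy). rewrite cauchy_circle in I1 by easy.
  apply (@is_RInt_fct_extend_fst R_NormedModule R_NormedModule) in I1.
  assert (I2 := is_RInt_scal _ 0 (2 * PI) (r ^ 2) _ (sq_mean_correct g r Dg Hr)).
  assert (I3 := @is_RInt_const R_NormedModule 0 (2 * PI) (Cmod (a O) ^ 2)).
  assert (I4 := is_RInt_plus _ _ _ _ _ _ I3 (is_RInt_plus _ _ _ _ _ _ I1 I2)).
  replace (2 * PI * Cmod (a O) ^ 2 + r ^ 2 * sq_mean g r) with
    (plus (scal (2 * PI - 0) (Cmod (a O) ^ 2)) (plus (fst (RtoC 2 * Cconj (a O) * 0)%C) (scal (r ^ 2) (sq_mean g r)))).
  2: { unfold plus, scal; simpl; unfold mult; simpl. ring. }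
  refine (is_RInt_ext _ _ _ _ _ _ I4).
  intros x _. symmetry. rewrite (slope0_eq f a (circ r x) Hf). fold g.
  change (Cmod (a O + circ r x * g (circ r x)) ^ 2 = Cmod (a O) ^ 2 +
    (fst (RtoC 2 * Cconj (a O) * (g (circ r x) * circ r x))%C + r ^ 2 * Cmod (g (circ r x)) ^ 2)).
  assert (M := circ_mod r x ltac:(lra)).
  set (c := circ r x) in *. set (u := g c).
  replace (r ^ 2 * Cmod u ^ 2) with (Cmod (c * u) ^ 2) by (rewrite Cmod_mult, M; ring).
  rewrite (Cmult_comm u c). rewrite !Cmod2_alt. set (d := (c * u)%C). unfold Re, Im. clearbody d. destruct d as [d1 d2], (a O) as [a1 a2]. simpl. ring.
Qed.

(** Iterating [sq_mean_step] splits off one coefficient at a time and drops a nonnegative square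
    mean at the end; series and integral are never interchanged. *)
Lemma bessel N : forall f a r, pser f a -> 0 <= r < 1 ->
  2 * PI * rsum (fun n => Cmod (a n) ^ 2 * (r ^ 2) ^ n) N <= sq_mean f r.
Proof.
  induction N as [|N IH]; intros f a r Hf Hr.
  - simpl rsum. rewrite Rmult_0_r. apply sq_mean_nonneg; [|easy]. apply hol_dcont. now apply (pser_hol f a).
  - rewrite rsum_shift, (sq_mean_step f a r Hf Hr).
    specialize (IH _ _ r (pser_slope0 f a Hf) Hr).
    rewrite (rsum_ext _ (fun n => r ^ 2 * (Cmod (a (S n)) ^ 2 * (r ^ 2) ^ n)))
      by (intros k _; change ((r ^ 2) ^ S k) with (r ^ 2 * (r ^ 2) ^ k); ring).
    rewrite rsum_scal. rewrite pow_O. assert (0 <= r ^ 2) by (apply pow_le; lra).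
    assert (X := Rmult_le_compat_l _ _ _ H IH). lra.
Qed.

(** A single term of Bessel's inequality gives |a_n| r^n <= M; then r tends to 1. Besides the Cauchy
    estimates, the case M = 0 yields uniqueness statements. *)
Lemma coef_bound f a M n : pser f a -> (forall z, unit_disc z -> Cmod (f z) <= M) -> Cmod (a n) <= M.
Proof.
  intros Hf HM. assert (P := two_PI_pos).
  assert (M0 : 0 <= M) by (eapply Rle_trans; [apply Cmod_ge_0|apply (HM 0%C unit_disc_0)]).
  assert (B : forall r, 0 <= r < 1 -> Cmod (a n) * r ^ n <= M).
  { intros r Hr. assert (K := bessel (S n) f a r Hf Hr).
    assert (Df : dcont f) by (apply hol_dcont; now apply (pser_hol f a)).
    assert (U : sq_mean f r <= (2 * PI) * M ^ 2).
    { assert (I := @is_RInt_const R_NormedModule 0 (2 * PI) (M ^ 2)).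
      replace (scal (2 * PI - 0) (M ^ 2 : R_NormedModule)) with (2 * PI * M ^ 2 : R_NormedModule) in I
        by (unfold scal; simpl; unfold mult; simpl; ring).
      apply (is_RInt_le (fun x => Cmod (f (circ r x)) ^ 2) (fun _ => M ^ 2) 0 (2 * PI)); [lra|now apply sq_mean_correct|exact I|].
      - intros x _. apply pow_incr. split; [apply Cmod_ge_0|]. apply HM. now apply circ_disc. }
    cbn [rsum] in K.
    assert (0 <= rsum (fun n => Cmod (a n) ^ 2 * (r ^ 2) ^ n) n).
    { apply rsum_nonneg. intros k _. apply Rmult_le_pos; repeat apply pow_le; [apply Cmod_ge_0|lra]. }
    replace (Cmod (a n) ^ 2 * (r ^ 2) ^ n) with ((Cmod (a n) * r ^ n) ^ 2) in K
      by (rewrite <- !pow_mult, Rpow_mult_distr, <- pow_mult, (Nat.mul_comm n); ring).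
    assert (X : (Cmod (a n) * r ^ n) ^ 2 <= M ^ 2).
    { assert (K' : rsum (fun n => Cmod (a n) ^ 2 * (r ^ 2) ^ n) n + (Cmod (a n) * r ^ n) ^ 2 <= M ^ 2)
        by (apply Rmult_le_reg_l with (2 * PI); lra). lra. }
    rewrite <- !Rsqr_pow2 in X. now apply Rsqr_incr_0_var. }
  apply (le_of_le_add _ _ (INR n * Cmod (a n))). intros x Hx. specialize (B (1 - x) ltac:(lra)).
  assert (Be := bernoulli x n ltac:(lra)). assert (A := Cmod_ge_0 (a n)). nra.
Qed.

Definition conv (a b : nat -> C) (n : nat) : C := csum (fun j => a j * b (n - j)%nat)%C (S n).

Lemma hol_mult f g : hol f -> hol g -> hol (fun z => f z * g z)%C.
Proof.
  intros Hf Hg z Hz. destruct (Hf z Hz) as [a Ha]. destruct (Hg z Hz) as [b Hb].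
  eexists. now apply cder_mult; [exact Ha|exact Hb].
Qed.

(** The product is holomorphic and so has some series; from f g = a_0 g + z (slope0 f) g its
    coefficients satisfy the recursion of the Cauchy product. The induction on the index runs over
    all [f] at once, and no double series is rearranged. *)
Lemma pser_mult f g a b : pser f a -> pser g b -> pser (fun z => f z * g z)%C (conv a b).
Proof.
  intros Hf Hg.
  assert (K : forall n f a c, pser f a -> pser (fun z => f z * g z)%C c -> c n = conv a b n).
  { clear f a Hf. induction n as [|n IH]; intros f a c Hf Hc.
    - rewrite <- (pser_at_0 _ _ Hc), (pser_at_0 _ _ Hf), (pser_at_0 _ _ Hg). unfold conv. simpl. ring.
    - assert (Hs := pser_slope0 f a Hf).
      destruct (hol_pser (fun z => slope0 f a z * g z)%C) as [d Hd].
      { apply hol_mult; [now apply (pser_hol _ _ Hs)|now apply (pser_hol g b)]. }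
      assert (H1 := pser_plus _ _ _ _ (pser_scal (a O) g b Hg) (pser_mulz _ _ 0%C Hd)).
      assert (H2 : pser (fun z => f z * g z)%C (fun n => a O * b n + match n with O => 0 | S k => d k end)%C).
      { refine (pser_ext _ _ _ _ H1). intros z _. cbv beta. rewrite (slope0_eq f a z Hf). ring. }
      rewrite (pser_unique _ _ _ Hc H2). rewrite (IH _ _ _ Hs Hd).
      unfold conv at 2. rewrite csum_shift. reflexivity. }
  destruct (hol_pser (fun z => f z * g z)%C) as [c Hc].
  { apply hol_mult; [now apply (pser_hol f a)|now apply (pser_hol g b)]. }
  apply (pser_ext_coef _ c); [|easy]. intros n. now apply (K n f).
Qed.

(** * Exponential and logarithm *)

Definition Cexp (z : C) : C := (exp (fst z) * cos (snd z), exp (fst z) * sin (snd z)).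

Lemma Cexp_plus a b : Cexp (a + b) = (Cexp a * Cexp b)%C.
Proof.
  unfold Cexp. apply injective_projections; simpl; rewrite exp_plus, ?cos_plus, ?sin_plus; ring.
Qed.

Lemma Cexp_nz z : Cexp z <> 0%C.
Proof.
  intros E. assert (H : (Cexp z * Cexp (- z))%C = 1%C).
  { rewrite <- Cexp_plus. replace (z + - z)%C with (RtoC 0) by ring.
    unfold Cexp; simpl. rewrite exp_0, cos_0, sin_0. apply injective_projections; simpl; ring. }
  rewrite E, Cmult_0_l in H. apply C1_nz. now rewrite H.
Qed.

Lemma real_first_order (f : R -> R) l : is_derive f 0 l -> forall eps, 0 < eps ->
  exists d, 0 < d /\ forall x, Rabs x < d -> Rabs (f x - f 0 - l * x) <= eps * Rabs x.
Proof.
  intros [_ H] eps He. specialize (H 0 (fun P HP => HP) (mkposreal eps He)).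
  apply locally_real in H. destruct H as [d [d0 Hd]]. exists d. split; [easy|].
  intros x Hx. rewrite <- (Rminus_0_r x) in Hx. specialize (Hd x Hx).
  change (Rabs (f x - f 0 - (x - 0) * l) <= eps * Rabs (x - 0)) in Hd.
  rewrite Rminus_0_r in Hd. now rewrite (Rmult_comm l).
Qed.

Lemma Rabs_fst_Cmod (z : C) : Rabs (fst z) <= Cmod z.
Proof. eapply Rle_trans; [apply Rmax_l|apply Rmax_Cmod]. Qed.

Lemma Rabs_snd_Cmod (z : C) : Rabs (snd z) <= Cmod z.
Proof. eapply Rle_trans; [apply Rmax_r|apply Rmax_Cmod]. Qed.

Lemma Cmod_le_sum (z : C) : Cmod z <= Rabs (fst z) + Rabs (snd z).
Proof.
  replace z with (RtoC (fst z) + Ci * RtoC (snd z))%C at 1 by (apply injective_projections; simpl; ring).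
  eapply Rle_trans; [apply Cmod_triangle|]. rewrite Cmod_mult, Cmod_Ci, !Cmod_R. lra.
Qed.

Lemma Cexp_first_order eps : 0 < eps -> exists d, 0 < d /\
  forall k, Cmod k < d -> Cmod (Cexp k - 1 - k) <= eps * Cmod k.
Proof.
  (* The real and imaginary parts will contribute 4 e |k| and 5 e |k|, together below eps |k|;
     [e <= 1] gives exp x <= 3. *)
  intros He. set (e := Rmin (eps / 10) 1).
  assert (He0 : 0 < e) by (apply Rmin_glb_lt; lra).
  assert (He1 : e <= eps / 10) by apply Rmin_l. assert (He2 : e <= 1) by apply Rmin_r. clearbody e.
  assert (D1 : is_derive exp 0 1) by (auto_derive; try easy; rewrite exp_0; ring).
  assert (D2 : is_derive cos 0 0) by (auto_derive; try easy; rewrite sin_0; ring).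
  assert (D3 : is_derive sin 0 1) by (auto_derive; try easy; rewrite cos_0; ring).
  destruct (real_first_order exp 1 D1 e He0) as [d1 [P1 H1]].
  destruct (real_first_order cos 0 D2 e He0) as [d2 [P2 H2]].
  destruct (real_first_order sin 1 D3 e He0) as [d3 [P3 H3]].
  exists (Rmin (Rmin d1 d2) (Rmin d3 e)). split; [repeat apply Rmin_glb_lt; assumption|].
  intros [x y] Hk.
  destruct (Rlt_Rmin _ _ _ Hk) as [K1 K2].
  destruct (Rlt_Rmin _ _ _ K1) as [Ka Kb].
  destruct (Rlt_Rmin _ _ _ K2) as [Kc Kd].
  assert (X := Rabs_fst_Cmod (x, y)). assert (Y := Rabs_snd_Cmod (x, y)). simpl fst in X. simpl snd in Y.
  specialize (H1 x ltac:(lra)). specialize (H2 y ltac:(lra)). specialize (H3 y ltac:(lra)).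
  rewrite exp_0 in H1. rewrite cos_0 in H2. rewrite sin_0 in H3.
  set (m := Cmod (x, y)) in *.
  assert (m0 : 0 <= m) by apply Cmod_ge_0.
  replace (exp x - 1 - 1 * x) with (exp x - 1 - x) in H1 by ring.
  replace (cos y - 1 - 0 * y) with (cos y - 1) in H2 by ring.
  replace (sin y - 0 - 1 * y) with (sin y - y) in H3 by ring.
  assert (E3 : Rabs (exp x) <= 3).
  { replace (exp x) with ((exp x - 1 - x) + (1 + x)) by ring.
    eapply Rle_trans; [apply Rabs_triang|]. assert (A := Rabs_triang 1 x). rewrite Rabs_R1 in A.
    assert (e * Rabs x <= 1 * 1) by (apply Rmult_le_compat; try lra; apply Rabs_pos). lra. }
  assert (E4 : Rabs (exp x - 1) <= 2 * m).
  { replace (exp x - 1) with ((exp x - 1 - x) + x) by ring.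
    eapply Rle_trans; [apply Rabs_triang|]. nra. }
  assert (F1 : Rabs (exp x * cos y - 1 - x) <= 4 * e * m).
  { replace (exp x * cos y - 1 - x) with (exp x * (cos y - 1) + (exp x - 1 - x)) by ring.
    eapply Rle_trans; [apply Rabs_triang|]. rewrite Rabs_mult.
    assert (Rabs (exp x) * Rabs (cos y - 1) <= 3 * (e * m)).
    { apply Rmult_le_compat; try apply Rabs_pos; [easy|]. eapply Rle_trans; [exact H2|]. apply Rmult_le_compat_l; lra. }
    assert (e * Rabs x <= e * m) by (apply Rmult_le_compat_l; lra). lra. }
  assert (F2 : Rabs (exp x * sin y - y) <= 5 * e * m).
  { replace (exp x * sin y - y) with (exp x * (sin y - y) + (exp x - 1) * y) by ring.
    eapply Rle_trans; [apply Rabs_triang|]. rewrite !Rabs_mult.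
    assert (Rabs (exp x) * Rabs (sin y - y) <= 3 * (e * m)).
    { apply Rmult_le_compat; try apply Rabs_pos; [easy|]. eapply Rle_trans; [exact H3|]. apply Rmult_le_compat_l; lra. }
    assert (Rabs (exp x - 1) * Rabs y <= 2 * m * e).
    { apply Rmult_le_compat; try apply Rabs_pos; lra. }
    lra. }
  eapply Rle_trans; [apply Cmod_le_sum|]. unfold Cexp. simpl.
  replace (exp x * cos y + - (1) + - x) with (exp x * cos y - 1 - x) by ring.
  replace (exp x * sin y + - 0 + - y) with (exp x * sin y - y) by ring. nra.
Qed.

Lemma Cexp_cder z : cder Cexp z (Cexp z).
Proof.
  intros eps He. assert (P : 0 < Cmod (Cexp z)) by (apply Cmod_gt_0, Cexp_nz).
  destruct (Cexp_first_order (eps / Cmod (Cexp z))) as [d [d0 Hd]]; [now apply Rdiv_lt_0_compat|].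
  exists d. split; [easy|]. intros w Hw. specialize (Hd _ Hw).
  replace (Cexp w) with (Cexp z * Cexp (w - z))%C by (rewrite <- Cexp_plus; f_equal; ring).
  replace (Cexp z * Cexp (w - z) - Cexp z - Cexp z * (w - z))%C
    with (Cexp z * (Cexp (w - z) - 1 - (w - z)))%C by ring.
  rewrite Cmod_mult. apply Rle_trans with (Cmod (Cexp z) * (eps / Cmod (Cexp z) * Cmod (w - z))).
  - apply Rmult_le_compat_l; lra.
  - apply Req_le. field. lra.
Qed.

Lemma Log_eq (w : C) : 0 < fst w -> Log w = (ln (Cmod w), atan (snd w / fst w)).
Proof.
  intros H. unfold Log, Arg. destruct (total_order_T (fst w) 0) as [[|]|]; try lra. easy.
Qed.

Lemma Cexp_Log (w : C) : 0 < fst w -> Cexp (Log w) = w.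
Proof.
  intros H. rewrite Log_eq by easy. destruct w as [x y]. simpl in *. unfold Cexp; simpl.
  assert (S0 : 0 < 1 + (y / x)²) by (generalize (Rle_0_sqr (y / x)); lra).
  assert (Sq : 0 < sqrt (1 + (y / x)²)) by now apply sqrt_lt_R0.
  assert (E : Cmod (x, y) = x * sqrt (1 + (y / x)²)).
  { unfold Cmod; simpl. rewrite <- (sqrt_square x) at 3 by lra. rewrite <- sqrt_mult by (try lra; nra).
    f_equal. unfold Rsqr. field. lra. }
  assert (P : 0 < Cmod (x, y)) by (rewrite E; nra).
  rewrite exp_ln by easy. rewrite cos_atan, sin_atan, E.
  apply injective_projections; simpl; field; lra.
Qed.

Lemma Log_cont (w : C) : 0 < fst w -> ccont Log w.
Proof.
  intros H.
  assert (Hn : w <> 0%C) by (intros ->; simpl in H; lra).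
  assert (P : 0 < Cmod w) by now apply Cmod_gt_0.
  assert (Hid := clim_id w). apply (clim_filterlim_abs _ _) in Hid.
  assert (C1 : filterlim (fun v : C => ln (Cmod v)) (near w) (locally (ln (Cmod w)))).
  { apply (filterlim_comp _ _ _ Cmod ln _ (locally (Cmod w))).
    - apply filterlim_locally. intros eps. apply locally_disc. exists eps. split; [apply eps|].
      intros v Hv. change (Rabs (Cmod v - Cmod w) < eps).
      generalize (Cmod_rev v w) (Cmod_rev w v). rewrite (Cmod_sym w v). intros. apply Rabs_def1; lra.
    - apply continuity_pt_filterlim, derivable_continuous_pt. exists (/ Cmod w).
      apply is_derive_Reals. auto_derive; [lra|]. field. lra. }
  assert (C2 : filterlim (fun v : C => atan (snd v / fst v)) (near w) (locally (atan (snd w / fst w)))).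
  { apply (filterlim_comp C R R (fun v : C => snd v / fst v) atan (near w) (locally (snd w / fst w)) (locally (atan (snd w / fst w)))).
    - refine (filterlim_comp_2 (F := @locally C_UniformSpace w) (G := locally (snd w)) (H := locally (/ fst w)) (fun v : C => snd v) (fun v : C => / fst v) (@mult R_AbsRing) _ _ _).
      + intros Q [d Hd]. apply locally_disc. exists d. split; [apply d|]. intros v Hv. apply Hd.
        eapply Rle_lt_trans; [|exact Hv]. apply (Rabs_snd_Cmod (v - w)).
      + apply (filterlim_comp C R R (fun v : C => fst v) Rinv (near w) (locally (fst w)) (locally (/ fst w))).
        * intros Q [d Hd]. apply locally_disc. exists d. split; [apply d|]. intros v Hv. apply Hd.
          eapply Rle_lt_trans; [|exact Hv]. apply (Rabs_fst_Cmod (v - w)).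
        * apply (filterlim_Rbar_inv (fst w)). intros E. injection E. lra.
      + apply (@filterlim_mult R_AbsRing (snd w) (/ fst w)).
    - apply continuity_pt_filterlim, derivable_continuous_pt, derivable_pt_atan. }
  intros eps He.
  assert (He2 : 0 < eps / 2) by lra.
  assert (A1 := proj1 (filterlim_locally _ _) C1 (mkposreal _ He2)).
  assert (A2 := proj1 (filterlim_locally _ _) C2 (mkposreal _ He2)).
  assert (A3 : @locally C_UniformSpace w (fun v : C => 0 < fst v)).
  { apply locally_disc. exists (fst w). split; [easy|]. intros v Hv.
    assert (T := Rabs_fst_Cmod (v - w)). simpl in T. assert (T2 := Rle_lt_trans _ _ _ T Hv).
    apply Rabs_def2 in T2. lra. }
  generalize (filter_and _ _ A3 (filter_and _ _ A1 A2)). apply filter_imp.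
  intros v (B3 & B1 & B2). rewrite !Log_eq by easy.
  change (Rabs (ln (Cmod v) - ln (Cmod w)) < eps / 2) in B1.
  change (Rabs (atan (snd v / fst v) - atan (snd w / fst w)) < eps / 2) in B2.
  eapply Rle_lt_trans; [apply Cmod_le_sum|]. simpl. unfold Rminus in *. lra.
Qed.

(** Differentiation of an inverse function: with k = Log v - Log w, small by [Log_cont], one has (v
    - w) / w = exp k - 1, which equals k up to first order. The bound [e <= / 2] makes |k| at most 2
    |exp k - 1|, so the error can be measured by |v - w|. *)
Lemma Log_cder (w : C) : 0 < fst w -> cder Log w (/ w)%C.
Proof.
  intros H. assert (Hn : w <> 0%C) by (intros ->; simpl in H; lra).
  assert (P : 0 < Cmod w) by now apply Cmod_gt_0.
  intros eps He. set (e := Rmin (/ 2) (eps * Cmod w / 2)).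
  assert (He0 : 0 < e) by (apply Rmin_glb_lt; [lra|]; apply Rmult_lt_0_compat; [nra|lra]).
  assert (He1 : e <= / 2) by apply Rmin_l. assert (He2 : e <= eps * Cmod w / 2) by apply Rmin_r.
  destruct (Cexp_first_order e He0) as [d1 [d10 H1]].
  destruct (proj1 (locally_disc _ _) (Log_cont w H d1 d10)) as [d2 [d20 H2]].
  exists (Rmin d2 (fst w)). split; [now apply Rmin_glb_lt|]. intros v Hv.
  destruct (Rlt_Rmin _ _ _ Hv) as [V1 V2].
  assert (Hv0 : 0 < fst v).
  { assert (T := Rabs_fst_Cmod (v - w)). simpl in T. assert (T2 := Rle_lt_trans _ _ _ T V2).
    apply Rabs_def2 in T2. lra. }
  specialize (H1 _ (H2 v V1)). set (k := (Log v - Log w)%C) in *.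
  assert (E : v = (w * Cexp k)%C).
  { rewrite <- (Cexp_Log v Hv0), <- (Cexp_Log w H) at 1. rewrite <- Cexp_plus. f_equal. unfold k. ring. }
  assert (E2 : ((v - w) / w)%C = (Cexp k - 1)%C) by (rewrite E; field; easy).
  assert (E3 : Cmod (v - w) / Cmod w = Cmod (Cexp k - 1)) by (rewrite <- E2, Cmod_div; easy).
  assert (E4 : Cmod k <= 2 * Cmod (Cexp k - 1)).
  { assert (T := Cmod_rev k (k - (Cexp k - 1))). replace (k - (k - (Cexp k - 1)))%C with (Cexp k - 1)%C in T by ring.
    rewrite (Cmod_sym k) in T. generalize (Cmod_ge_0 k). nra. }
  replace (k - / w * (v - w))%C with (k - (v - w) / w)%C by (unfold Cdiv; ring). rewrite E2, Cmod_sym.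
  eapply Rle_trans; [exact H1|].
  apply Rle_trans with (eps * Cmod w / 2 * (2 * (Cmod (v - w) / Cmod w))).
  - rewrite E3. apply Rmult_le_compat; try lra. apply Cmod_ge_0.
  - apply Req_le. field. lra.
Qed.

Definition den (t : R) (z : C) : C := (1 - RtoC t * z)%C.

Lemma den_lower t z : 0 <= t -> Cmod z <= 1 -> 1 - t <= Cmod (den t z).
Proof.
  intros Ht Hz. unfold den. generalize (Cmod_rev 1 (RtoC t * z)).
  rewrite Cmod_1, Cmod_mult, Cmod_R, Rabs_pos_eq by lra. nra.
Qed.

Lemma den_upper t z : 0 <= t <= 1 -> Cmod z <= 1 -> Cmod (den t z) <= 2.
Proof.
  intros Ht Hz. unfold den, Cminus. eapply Rle_trans; [apply Cmod_triangle|].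
  rewrite Cmod_opp, Cmod_1, Cmod_mult, Cmod_R, Rabs_pos_eq by lra. generalize (Cmod_ge_0 z). nra.
Qed.

Lemma den_nz t z : 0 <= t < 1 -> unit_disc z -> den t z <> 0%C.
Proof.
  unfold unit_disc. intros Ht Hz. apply Cmod_gt_0.
  generalize (den_lower t z ltac:(lra) ltac:(lra)). lra.
Qed.

Lemma den_cder t z : cder (den t) z (- RtoC t)%C.
Proof.
  eapply cder_eq; [apply cder_minus; [apply cder_const|apply cder_scal, cder_id]|ring].
Qed.

(** The point 1 - t z stays in the right half-plane, where [Arg] is an arctangent and [Log] is
    differentiable; the branch t = 0 is the identity. *)
Lemma g_log_derive t z : 0 <= t < 1 -> unit_disc z -> C_derive (g_log t) z = (/ den t z)%C.
Proof.
  intros Ht Hz. assert (Hd := den_nz t z Ht Hz).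
  apply is_C_derive_unique. rewrite <- cder_is_derive. unfold g_log.
  destruct (Req_EM_T t 0) as [->|Hn].
  - eapply cder_eq; [apply cder_id|]. unfold den. field.
  - assert (Htc : RtoC t <> 0%C) by (intros E; apply RtoC_inj in E; easy).
    apply (cder_ext_loc (fun w => (- / RtoC t) * Log (den t w))%C _ z _ 1 Rlt_0_1).
    + intros w _. unfold den. field. easy.
    + eapply cder_eq.
      * apply cder_scal. apply (cder_comp Log (den t)); [apply Log_cder|apply den_cder].
        unfold den. simpl. unfold unit_disc in Hz. assert (X := Rabs_fst_Cmod z).
        assert (Y := Rle_abs (fst z)). nra.
      * field. now split.
Qed.

(** * Uniform continuity and the operators on coefficients *)

(** The bound [M] and the point 0 of the disc exclude the infinite values of [Lub_Rbar], on which
    [real] would return 0. *)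
Lemma sup_norm_bounds f M : (forall z, unit_disc z -> Cmod (f z) <= M) ->
  (forall z, unit_disc z -> Cmod (f z) <= sup_norm f) /\
  (forall K, (forall z, unit_disc z -> Cmod (f z) <= K) -> sup_norm f <= K).
Proof.
  intros HM. unfold sup_norm.
  set (E := fun x : R => exists z : C, unit_disc z /\ x = Cmod (f z)).
  assert (U : forall K, (forall z, unit_disc z -> Cmod (f z) <= K) -> is_ub_Rbar E (Finite K)).
  { intros K HK x (z & Hz & ->). now apply HK. }
  destruct (Lub_Rbar_correct E) as [Hub Hl]. destruct (Lub_Rbar E) as [l| |].
  - split.
    + intros z Hz. apply (Hub (Cmod (f z))). now exists z.
    + intros K HK. apply (Hl (Finite K)). now apply U.
  - destruct (Hl (Finite M) (U M HM)).
  - destruct (Hub (Cmod (f 0%C))). exists 0%C. split; [apply unit_disc_0|easy].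
Qed.

Definition dbounded (f : C -> C) : Prop := exists M, forall z, unit_disc z -> Cmod (f z) <= M.

Lemma sup_norm_ub f z : dbounded f -> unit_disc z -> Cmod (f z) <= sup_norm f.
Proof. intros [M HM]. now apply (sup_norm_bounds f M HM). Qed.

Lemma sup_norm_le f K : (forall z, unit_disc z -> Cmod (f z) <= K) -> sup_norm f <= K.
Proof. intros HK. now apply (sup_norm_bounds f K HK). Qed.

Lemma sup_norm_nonneg f : dbounded f -> 0 <= sup_norm f.
Proof. intros H. eapply Rle_trans; [apply Cmod_ge_0|apply (sup_norm_ub f 0%C H unit_disc_0)]. Qed.

(** Uniform continuity on the open disc, the intrinsic form of having a continuous extension to the
    closed disc. *)
Definition ucont (f : C -> C) : Prop := forall eps, 0 < eps -> exists d, 0 < d /\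
  forall z w, unit_disc z -> unit_disc w -> Cmod (z - w) < d -> Cmod (f z - f w) < eps.

Lemma scale_mod s z : 0 <= s -> Cmod (RtoC s * z) = s * Cmod z.
Proof. intros H. now rewrite Cmod_mult, Cmod_R, Rabs_pos_eq. Qed.

(** The radius from 0 to z is walked in a fixed number of steps shorter than [d], each of which
    changes [f] by less than 1. *)
Lemma ucont_bounded f : ucont f -> dbounded f.
Proof.
  intros H. destruct (H 1 Rlt_0_1) as [d [d0 Hd]].
  destruct (nfloor_ex (/ d)) as [N [_ HN]]; [apply Rlt_le, Rinv_0_lt_compat; easy|].
  rewrite <- S_INR in HN.
  assert (N0 : 0 < INR (S N)) by (apply lt_0_INR; lia).
  assert (Hi : / INR (S N) < d).
  { rewrite <- (Rinv_inv d). apply Rinv_lt_contravar; [|easy].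
    apply Rmult_lt_0_compat; [apply Rinv_0_lt_compat; easy|easy]. }
  exists (Cmod (f 0%C) + INR (S N)). intros z Hz. unfold unit_disc in *.
  assert (C0 := Cmod_ge_0 z).
  assert (K : forall k, (k <= S N)%nat -> Cmod (f (RtoC (INR k * / INR (S N)) * z)%C - f 0%C) <= INR k).
  { induction k as [|k IH]; intros Hk.
    - simpl INR. rewrite Rmult_0_l. replace (0 * z)%C with (RtoC 0) by ring.
      replace (f 0 - f 0)%C with (RtoC 0) by ring. rewrite Cmod_0. lra.
    - specialize (IH ltac:(lia)).
      assert (B : forall j, (j <= S N)%nat -> Cmod (RtoC (INR j * / INR (S N)) * z) < 1).
      { intros j Hj. assert (J0 := pos_INR j). assert (J1 := le_INR _ _ Hj).
        assert (J2 : INR j * / INR (S N) <= 1).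
        { apply Rmult_le_reg_r with (INR (S N)); [easy|]. rewrite Rmult_assoc, Rinv_l; lra. }
        rewrite scale_mod; [nra|]. apply Rmult_le_pos; [easy|]. apply Rlt_le, Rinv_0_lt_compat. easy. }
      assert (S1 := Hd _ _ (B (S k) Hk) (B k ltac:(lia))).
      assert (S2 : Cmod (f (RtoC (INR (S k) * / INR (S N)) * z)%C - f (RtoC (INR k * / INR (S N)) * z)%C) < 1).
      { apply S1. rewrite (S_INR k).
        replace (RtoC ((INR k + 1) * / INR (S N)) * z - RtoC (INR k * / INR (S N)) * z)%C
          with (RtoC (/ INR (S N)) * z)%C.
        - rewrite scale_mod by (apply Rlt_le, Rinv_0_lt_compat; easy).
          assert (I0 : 0 < / INR (S N)) by (apply Rinv_0_lt_compat; easy).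
          apply Rle_lt_trans with (/ INR (S N) * 1); [apply Rmult_le_compat_l|]; lra.
        - rewrite Rmult_plus_distr_r, Rmult_1_l, RtoC_plus. ring. }
      replace (f (RtoC (INR (S k) * / INR (S N)) * z)%C - f 0%C)%C with
        ((f (RtoC (INR (S k) * / INR (S N)) * z)%C - f (RtoC (INR k * / INR (S N)) * z)%C) +
         (f (RtoC (INR k * / INR (S N)) * z)%C - f 0%C))%C by ring.
      eapply Rle_trans; [apply Cmod_triangle|]. assert (ES := S_INR k). lra. }
  specialize (K (S N) (le_n _)). rewrite Rinv_r in K by lra. replace (1 * z)%C with z in K by ring.
  generalize (Cmod_rev (f z) (f 0%C)). lra.
Qed.

#[global] Instance within_C_filter (D : C -> Prop) (z : C) : @Filter C (within D (near z)).
Proof. apply within_filter. apply locally_C_filter. Qed.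

Lemma closed_disc_continuous F z :
  filterlim F (within closed_disc (near z)) (near (F z)) <->
  forall eps, 0 < eps -> exists d, 0 < d /\ forall w, closed_disc w -> Cmod (w - z) < d -> Cmod (F w - F z) < eps.
Proof.
  rewrite <- (clim_filterlim (within closed_disc (near z)) _). split.
  - intros H eps He. destruct (proj1 (locally_disc _ _) (H eps He)) as [d [d0 Hd]].
    exists d. split; [easy|]. intros w Hw Hz. now apply Hd.
  - intros H eps He. destruct (H eps He) as [d [d0 Hd]]. apply locally_disc.
    exists d. split; [easy|]. intros w Hw Hz. now apply Hd.
Qed.

(** Compactness of the square [-1,1]^2 with a gauge: at points of the closed disc it comes from
    continuity, at the other points it keeps the closed disc at distance 4 r. If both coordinates of
    z differ by less than r from those of the centre, then z is within 2 r and w within 3 r of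
    it. *)
Lemma closed_disc_ucont F :
  (forall z, closed_disc z -> filterlim F (within closed_disc (near z)) (near (F z))) ->
  ucont F.
Proof.
  intros HF eps He.
  set (P := fun (u v : R) (r : posreal) => if Rle_dec (Cmod (u, v)) 1
     then forall w, closed_disc w -> Cmod (w - (u, v)) < 4 * r -> Cmod (F w - F (u, v)) < eps / 2
     else forall w, closed_disc w -> 4 * r <= Cmod (w - (u, v))).
  assert (HP : forall u v, exists r, P u v r).
  { intros u v. unfold P. destruct (Rle_dec (Cmod (u, v)) 1) as [L|L].
    - destruct (proj1 (closed_disc_continuous F (u, v)) (HF _ L) (eps / 2) ltac:(lra)) as [d [d0 Hd]].
      assert (d4 : 0 < d / 4) by lra. exists (mkposreal _ d4). intros w Hw Hz. apply Hd; [easy|]. simpl in Hz. lra.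
    - assert (d4 : 0 < (Cmod (u, v) - 1) / 4) by lra. exists (mkposreal _ d4). intros w Hw. simpl.
      unfold closed_disc in Hw. rewrite Cmod_sym. generalize (Cmod_rev (u, v) w). lra. }
  set (delta := fun u v => epsilon (inhabits (mkposreal 1 Rlt_0_1)) (P u v)).
  assert (Hdl : forall u v, P u v (delta u v)) by (intros; apply epsilon_spec, HP).
  destruct (compactness_value_2d (-1) 1 (-1) 1 delta) as [d Hd].
  exists d. split; [apply d|]. intros z w Hz Hw Hzw. unfold unit_disc in *.
  assert (X := Rabs_fst_Cmod z). assert (Y := Rabs_snd_Cmod z).
  destruct (Rabs_def2 (fst z) 1 ltac:(lra)) as [x1 x2]. destruct (Rabs_def2 (snd z) 1 ltac:(lra)) as [y1 y2].
  (* [compactness_value_2d] yields its point only under a double negation, so the conclusion is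
     first assumed false. *)
  apply Rnot_le_lt. intros Habs. apply (Hd (fst z) (snd z) ltac:(lra) ltac:(lra)).
  intros (u & v & _ & _ & Hu & Hv & Hdd). specialize (Hdl u v). unfold P in Hdl.
  set (r := delta u v) in *.
  assert (R1 : Cmod (z - (u, v)) < 2 * r).
  { eapply Rle_lt_trans; [apply Cmod_le_sum|]. simpl. unfold Rminus in *. lra. }
  assert (R2 : Cmod (w - (u, v)) < 4 * r).
  { replace (w - (u, v))%C with (- (z - w) + (z - (u, v)))%C by ring.
    eapply Rle_lt_trans; [apply Cmod_triangle|]. rewrite Cmod_opp. generalize (cond_pos r). lra. }
  destruct (Rle_dec (Cmod (u, v)) 1) as [L|L].
  - assert (A1 := Hdl z ltac:(unfold closed_disc; lra) ltac:(generalize (cond_pos r); lra)).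
    assert (A2 := Hdl w ltac:(unfold closed_disc; lra) R2).
    assert (T := Cmod_triangle (F z - F (u, v)) (- (F w - F (u, v)))). rewrite Cmod_opp in T.
    replace (F z - F (u, v) + - (F w - F (u, v)))%C with (F z - F w)%C in T by ring. lra.
  - specialize (Hdl w ltac:(unfold closed_disc; lra)). lra.
Qed.

Lemma ucont_ext f g : (forall z, unit_disc z -> f z = g z) -> ucont f -> ucont g.
Proof.
  intros E H eps He. destruct (H eps He) as [d [d0 Hd]]. exists d. split; [easy|].
  intros z w Hz Hw. rewrite <- !E by easy. now apply Hd.
Qed.

(** The extension is the limit of [f] along the dilates (1 - 1/(n+1)) z. Uniform continuity makes
    these values Cauchy at every closed-disc point, and since dilations do not increase distances
    the modulus of continuity passes to the limit. *)
Lemma ucont_extends f : ucont f -> exists F : C -> C, eq_disc F f /\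
  forall z : C, closed_disc z -> filterlim F (within closed_disc (near z)) (near (F z)).
Proof.
  intros H.
  set (s := fun n => 1 - / INR (S n)).
  assert (s0 : forall n, 0 <= s n < 1).
  { intros n. unfold s. assert (N1 : 1 <= INR (S n)) by (rewrite S_INR; generalize (pos_INR n); lra).
    assert (0 < / INR (S n)) by (apply Rinv_0_lt_compat; lra).
    assert (/ INR (S n) <= 1) by (rewrite <- Rinv_1; apply Rinv_le_contravar; lra). lra. }
  assert (s1 : forall eps, 0 < eps -> exists N, forall n, (N <= n)%nat -> 1 - s n < eps).
  { intros eps He. destruct (nfloor_ex (/ eps)) as [N [_ HN]]; [apply Rlt_le, Rinv_0_lt_compat; easy|].
    exists N. intros n Hn. unfold s. replace (1 - (1 - / INR (S n))) with (/ INR (S n)) by ring.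
    assert (INR N <= INR n) by now apply le_INR. assert (0 < / eps) by now apply Rinv_0_lt_compat.
    rewrite <- (Rinv_inv eps). rewrite S_INR. apply Rinv_lt_contravar; [|lra]. apply Rmult_lt_0_compat; [easy|].
    generalize (pos_INR n). lra. }
  set (zs := fun (z : C) n => (RtoC (s n) * z)%C).
  assert (zs_in : forall z n, closed_disc z -> unit_disc (zs z n)).
  { unfold closed_disc, unit_disc, zs. intros z n Hz. specialize (s0 n).
    rewrite scale_mod by lra. generalize (Cmod_ge_0 z). nra. }
  assert (zs_near : forall z w n, Cmod (zs z n - zs w n) <= Cmod (z - w)).
  { intros z w n. unfold zs. specialize (s0 n).
    replace (RtoC (s n) * z - RtoC (s n) * w)%C with (RtoC (s n) * (z - w))%C by ring.
    rewrite scale_mod by lra. generalize (Cmod_ge_0 (z - w)). nra. }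
  assert (zs_far : forall z n, closed_disc z -> Cmod (zs z n - z) <= 1 - s n).
  { unfold closed_disc, zs. intros z n Hz. specialize (s0 n).
    replace (RtoC (s n) * z - z)%C with (- (RtoC (1 - s n) * z))%C by (rewrite RtoC_minus; ring).
    rewrite Cmod_opp, scale_mod by lra. generalize (Cmod_ge_0 z). nra. }
  set (F := fun z => epsilon (inhabits (RtoC 0)) (clim eventually (fun n => f (zs z n)))).
  assert (HF : forall z, closed_disc z -> clim eventually (fun n => f (zs z n)) (F z)).
  { intros z Hz. unfold F. apply epsilon_spec. apply (C_complete (fun n => f (zs z n))).
    intros eps He. destruct (H eps He) as [d [d0 Hd]]. destruct (s1 (d / 2) ltac:(lra)) as [N HN].
    exists N. intros m n Hm Hn. apply Hd; [now apply zs_in|now apply zs_in|].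
    replace (zs z m - zs z n)%C with ((zs z m - z) + - (zs z n - z))%C by ring.
    eapply Rle_lt_trans; [apply Cmod_triangle|]. rewrite Cmod_opp.
    generalize (zs_far z m Hz) (zs_far z n Hz) (HN m Hm) (HN n Hn). lra. }
  exists F. split.
  - intros z Hz. assert (Cz : closed_disc z) by (unfold closed_disc, unit_disc in *; lra).
    apply (clim_unique (fun n => f (zs z n))); [now apply HF|].
    intros eps He. destruct (H eps He) as [d [d0 Hd]]. destruct (s1 d d0) as [N HN].
    exists N. intros n Hn. apply Hd; [now apply zs_in|easy|].
    eapply Rle_lt_trans; [now apply zs_far|]. now apply HN.
  - intros z Hz. apply closed_disc_continuous. intros eps He.
    destruct (H (eps / 2) ltac:(lra)) as [d [d0 Hd]]. exists d. split; [easy|]. intros w Hw Hwz.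
    apply Rle_lt_trans with (eps / 2); [|lra].
    replace (F w - F z)%C with (F w - F z - 0)%C by ring.
    apply (clim_bound (fun n => f (zs w n) - f (zs z n))%C _ 0%C _ 0).
    + apply (clim_minus eventually (fun n => f (zs w n)) (fun n => f (zs z n))); now apply HF.
    + intros n _. replace (f (zs w n) - f (zs z n) - 0)%C with (f (zs w n) - f (zs z n))%C by ring.
      apply Rlt_le, Hd; try now apply zs_in. eapply Rle_lt_trans; [apply zs_near|easy].
Qed.

Lemma hol_ext f g : (forall z, unit_disc z -> f z = g z) -> hol f -> hol g.
Proof.
  intros E H z Hz. destruct (H z Hz) as [l Hl]. exists l.
  destruct (unit_disc_open z Hz) as [d [d0 Hd]]. apply (cder_ext_loc f g z l d d0); [|easy].
  intros w Hw. now apply E, Hd.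
Qed.

Lemma disc_algebra_iff f : disc_algebra f <-> hol f /\ ucont f.
Proof.
  simpl. rewrite <- hol_analytic. split.
  - intros [H [F [E HF]]]. split; [easy|]. apply (ucont_ext F); [easy|]. now apply closed_disc_ucont.
  - intros [H1 H2]. split; [easy|]. now apply ucont_extends.
Qed.

Lemma hardy_infty_iff f : hardy_infty f <-> hol f /\ dbounded f.
Proof. simpl. now rewrite <- hol_analytic. Qed.

Lemma ucont_plus f g : ucont f -> ucont g -> ucont (fun z => f z + g z)%C.
Proof.
  intros Hf Hg eps He. destruct (Hf (eps / 2) ltac:(lra)) as [d1 [d10 H1]].
  destruct (Hg (eps / 2) ltac:(lra)) as [d2 [d20 H2]].
  exists (Rmin d1 d2). split; [now apply Rmin_glb_lt|]. intros z w Hz Hw Hzw.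
  destruct (Rlt_Rmin _ _ _ Hzw) as [Z1 Z2].
  specialize (H1 z w Hz Hw Z1). specialize (H2 z w Hz Hw Z2).
  replace (f z + g z - (f w + g w))%C with ((f z - f w) + (g z - g w))%C by ring.
  eapply Rle_lt_trans; [apply Cmod_triangle|]. lra.
Qed.

Lemma ucont_mult f g : ucont f -> ucont g -> ucont (fun z => f z * g z)%C.
Proof.
  intros Hf Hg eps He. destruct (ucont_bounded f Hf) as [M HM]. destruct (ucont_bounded g Hg) as [K HK].
  assert (M0 : 0 <= M) by (eapply Rle_trans; [apply Cmod_ge_0|apply (HM 0%C unit_disc_0)]).
  assert (K0 : 0 <= K) by (eapply Rle_trans; [apply Cmod_ge_0|apply (HK 0%C unit_disc_0)]).
  destruct (Hf (eps / 2 / (K + 1)) ltac:(repeat apply Rdiv_lt_0_compat; lra)) as [d1 [d10 H1]].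
  destruct (Hg (eps / 2 / (M + 1)) ltac:(repeat apply Rdiv_lt_0_compat; lra)) as [d2 [d20 H2]].
  exists (Rmin d1 d2). split; [now apply Rmin_glb_lt|]. intros z w Hz Hw Hzw.
  destruct (Rlt_Rmin _ _ _ Hzw) as [Z1 Z2].
  specialize (H1 z w Hz Hw Z1). specialize (H2 z w Hz Hw Z2). specialize (HM w Hw). specialize (HK z Hz).
  replace (f z * g z - f w * g w)%C with ((f z - f w) * g z + f w * (g z - g w))%C by ring.
  eapply Rle_lt_trans; [apply Cmod_triangle|]. rewrite !Cmod_mult.
  assert (B1 : Cmod (f z - f w) * (K + 1) < eps / 2).
  { apply (Rmult_lt_compat_r (K + 1)) in H1; [|lra]. replace (eps / 2 / (K + 1) * (K + 1)) with (eps / 2) in H1 by (field; lra). easy. }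
  assert (B2 : Cmod (g z - g w) * (M + 1) < eps / 2).
  { apply (Rmult_lt_compat_r (M + 1)) in H2; [|lra]. replace (eps / 2 / (M + 1) * (M + 1)) with (eps / 2) in H2 by (field; lra). easy. }
  assert (0 <= Cmod (f z - f w)) by apply Cmod_ge_0. assert (0 <= Cmod (g z - g w)) by apply Cmod_ge_0. nra.
Qed.

Lemma ucont_const c : ucont (fun _ => c).
Proof.
  intros eps He. exists 1. split; [lra|]. intros z w _ _ _. replace (c - c)%C with (RtoC 0) by ring.
  now rewrite Cmod_0.
Qed.

Lemma ucont_id : ucont (fun z => z).
Proof. intros eps He. exists eps. now split. Qed.

Lemma ucont_uniform_limit (u : nat -> C -> C) f : (forall n, ucont (u n)) ->
  (forall eps, 0 < eps -> exists n, forall z, unit_disc z -> Cmod (u n z - f z) <= eps) -> ucont f.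
Proof.
  intros Hu H eps He. destruct (H (eps / 3) ltac:(lra)) as [n Hn].
  destruct (Hu n (eps / 3) ltac:(lra)) as [d [d0 Hd]]. exists d. split; [easy|].
  intros z w Hz Hw Hzw. specialize (Hd z w Hz Hw Hzw). assert (A := Hn z Hz). assert (B := Hn w Hw).
  replace (f z - f w)%C with (- (u n z - f z) + ((u n z - u n w) + (u n w - f w)))%C by ring.
  eapply Rle_lt_trans; [apply Cmod_triangle|]. rewrite Cmod_opp.
  generalize (Cmod_triangle (u n z - u n w) (u n w - f w)). lra.
Qed.

Lemma ucont_csum (a : nat -> C) N : ucont (fun z => csum (fun n => a n * z ^ n)%C N).
Proof.
  induction N as [|N IH]; simpl; [apply ucont_const|]. apply ucont_plus; [easy|].
  apply ucont_mult; [apply ucont_const|]. clear IH.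
  induction N as [|N IH]; simpl; [apply ucont_const|]. apply ucont_mult; [apply ucont_id|easy].
Qed.

(** The partial sums are polynomials and converge uniformly by the Weierstrass test. *)
Lemma pser_abs_ucont f a K : pser f a -> (forall n, rsum (fun k => Cmod (a k)) n <= K) -> ucont f.
Proof.
  intros Hf HK. apply (ucont_uniform_limit (fun N z => csum (fun n => a n * z ^ n)%C N)).
  - intros N. apply ucont_csum.
  - intros eps He.
    destruct (rsum_bounded_cauchy (fun k => Cmod (a k)) K (fun k => Cmod_ge_0 _) HK eps He) as [N HN].
    exists N. intros z Hz. rewrite Cmod_sym.
    apply (clim_bound (csum (fun n => a n * z ^ n)%C) (f z) _ _ N (proj2 Hf z Hz)).
    intros n Hn. eapply Rle_trans; [now apply csum_diff_norm|].
    eapply Rle_trans; [|apply Rlt_le, (HN N n (le_n _) Hn)].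
    assert (T : forall m, rsum (fun k => Cmod (a k * z ^ k)%C) m <= rsum (fun k => Cmod (a k)) m /\
       ((N <= m)%nat -> rsum (fun k => Cmod (a k * z ^ k)%C) m - rsum (fun k => Cmod (a k * z ^ k)%C) N <=
         rsum (fun k => Cmod (a k)) m - rsum (fun k => Cmod (a k)) N)).
    { assert (T0 : forall k, Cmod (a k * z ^ k)%C <= Cmod (a k)).
      { intros k. rewrite term_mod. unfold unit_disc in Hz.
        assert (Cmod z ^ k <= 1) by (rewrite <- (pow1 k); apply pow_incr; split; [apply Cmod_ge_0|lra]).
        generalize (Cmod_ge_0 (a k)). nra. }
      intros m. split; [apply rsum_le; auto|]. induction 1 as [|m Hm IH]; [lra|]. simpl. specialize (T0 m). lra. }
    now apply T.
Qed.

(** [v] is the coefficient sequence of the primitive of f / (1 - t z) vanishing at 0. Formulated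
    through f / (1 - t z) alone, it does not mention either operator and serves both. *)
Definition hcoef (t : R) (f : C -> C) (v : nat -> C) : Prop :=
  v O = 0%C /\ pser (fun z => f z / den t z)%C (dcoef v).

Lemma hol_den t : hol (den t).
Proof. intros z _. eexists. apply den_cder. Qed.

Lemma hol_div_den t f : 0 <= t < 1 -> hol f -> hol (fun z => f z / den t z)%C.
Proof.
  intros Ht Hf z Hz. destruct (Hf z Hz) as [l Hl]. eexists.
  apply cder_div; [now apply den_nz|exact Hl|apply den_cder].
Qed.

Lemma INR_S_nz n : RtoC (INR (S n)) <> 0%C.
Proof. intros E. apply RtoC_inj in E. generalize (lt_0_INR (S n) ltac:(lia)). lra. Qed.

Lemma hcoef_exists t f : 0 <= t < 1 -> hol f -> exists v, hcoef t f v.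
Proof.
  intros Ht Hf. destruct (hol_pser _ (hol_div_den t f Ht Hf)) as [a Ha].
  exists (fun n => match n with O => RtoC 0 | S k => (a k / RtoC (INR (S k)))%C end).
  split; [easy|]. apply (pser_ext_coef _ a); [|easy]. intros n. unfold dcoef. field. apply INR_S_nz.
Qed.

(** Functions can be built from prescribed coefficients of their image; limits of Cauchy sequences
    and the unbounded witness arise in this way. *)
Lemma hcoef_surj t v : 0 <= t < 1 -> tame v -> v O = 0%C -> exists f, hol f /\ hcoef t f v.
Proof.
  intros Ht Hv H0. destruct (pser_exists (dcoef v) (tame_dcoef v Hv)) as [h Hh].
  exists (fun z => h z * den t z)%C. split.
  - apply hol_mult; [now apply (pser_hol h (dcoef v))|apply hol_den].
  - split; [easy|]. apply (pser_ext h); [|easy]. intros z Hz. field. now apply den_nz.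
Qed.

Lemma seg_ext f g a b : (forall z, unit_disc z -> f z = g z) -> unit_disc a -> unit_disc b -> seg f a b = seg g a b.
Proof.
  intros E Ha Hb. unfold seg. f_equal. apply CInt_ext; [lra|]. intros s Hs. apply E. now apply conv_disc.
Qed.

(** The primitive of f / (1 - t z) has a series whose termwise derivative is the series of f / (1 -
    t z); with the value 0 at 0 this identifies its coefficients as [v]. The value f(0) prescribed
    for [cesaro_op] at 0 is the coefficient v_1. *)
Lemma operators_pser t f v : 0 <= t < 1 -> hol f -> hcoef t f v ->
  pser (volterra_op (g_log t) f) v /\ pser (cesaro_op t f) (fun n => v (S n)).
Proof.
  intros Ht Hf [v0 Hv]. set (h := fun z => (f z / den t z)%C) in *.
  assert (Hh : hol h) by now apply hol_div_den.
  assert (HV : forall z, unit_disc z -> cder (prim h) z (h z)) by (intros; now apply prim_cder).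
  destruct (hol_pser (prim h)) as [w Hw]; [intros z Hz; exists (h z); auto|].
  assert (w0 : w O = 0%C).
  { rewrite <- (pser_at_0 _ _ Hw). unfold prim, seg. ring. }
  destruct (pser_exists (dcoef w) (tame_dcoef w (proj1 Hw))) as [g Hg].
  assert (Hh2 : pser h (dcoef w)).
  { apply (pser_ext g h); [|easy]. intros z Hz. apply (cder_unique (prim h) z); [|now apply HV].
    now apply (pser_cder _ g w). }
  assert (Ewv : forall n, w n = v n).
  { intros [|n]; [now rewrite w0, v0|]. assert (E := pser_unique _ _ _ Hh2 Hv n). unfold dcoef in E.
    assert (N := INR_S_nz n). replace (w (S n)) with (/ RtoC (INR (S n)) * (RtoC (INR (S n)) * w (S n)))%C by (field; easy).
    rewrite E. field. easy. }
  assert (HVv : pser (prim h) v) by now apply (pser_ext_coef _ w).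
  split.
  - apply (pser_ext (prim h)); [|easy]. intros z Hz. unfold volterra_op. rewrite integral_from_0_seg.
    apply seg_ext; [|apply unit_disc_0|easy]. intros x Hx. unfold h. now rewrite (g_log_derive t x Ht Hx).
  - apply (pser_ext (slope0 (prim h) v)); [|now apply pser_slope0]. intros z Hz. unfold slope0, cesaro_op.
    destruct (Ceq_dec z 0) as [->|Hz0].
    + assert (E := pser_at_0 _ _ Hv). unfold dcoef in E. simpl INR in E.
      replace (v 1%nat) with (1 * v 1%nat)%C by ring. rewrite <- E. unfold h, den.
      replace (1 - RtoC t * 0)%C with (RtoC 1) by ring. field.
    + rewrite v0, integral_from_0_seg. change (seg _ 0 z) with (prim h z). field. easy.
Qed.

Lemma csum_zero n : csum (fun _ => RtoC 0) n = 0%C.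
Proof. induction n as [|n IH]; simpl; [easy|]. rewrite IH. ring. Qed.

Lemma cser_zero : cser (fun _ => RtoC 0) 0%C.
Proof.
  intros eps He. exists O. intros n _. rewrite csum_zero.
  replace (0 - 0)%C with (RtoC 0) by ring. now rewrite Cmod_0.
Qed.

Lemma pser_null f a : pser f a -> (forall n, a n = 0%C) -> forall z, unit_disc z -> f z = 0%C.
Proof.
  intros [_ Hf] H0 z Hz. apply (clim_unique _ _ _ (Hf z Hz)).
  apply (cser_ext (fun _ => RtoC 0)); [intros n; rewrite H0; ring|apply cser_zero].
Qed.

Lemma hcoef_zero t (f : C -> C) : (forall z, unit_disc z -> f z = 0%C) -> hcoef t f (fun _ => RtoC 0).
Proof.
  intros H0. split; [easy|]. split.
  - apply (tame_bounded _ 0). intros n. unfold dcoef. rewrite Cmult_0_r, Cmod_0. lra.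
  - intros z Hz. rewrite H0 by easy. unfold Cdiv. rewrite Cmult_0_l.
    apply (cser_ext (fun _ => RtoC 0)); [intros n; unfold dcoef; ring|apply cser_zero].
Qed.

Lemma hcoef_plus t f g v w : hcoef t f v -> hcoef t g w -> hcoef t (fadd f g) (fun n => v n + w n)%C.
Proof.
  intros [v0 Hv] [w0 Hw]. split; [rewrite v0, w0; ring|].
  apply (pser_ext_coef _ (fun n => dcoef v n + dcoef w n)%C); [intros; unfold dcoef; ring|].
  apply (pser_ext (fun z => f z / den t z + g z / den t z)%C); [intros; unfold fadd, Cdiv; ring|].
  now apply pser_plus.
Qed.

Lemma hcoef_scal t f v c : hcoef t f v -> hcoef t (fscal c f) (fun n => c * v n)%C.
Proof.
  intros [v0 Hv]. split; [rewrite v0; ring|].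
  apply (pser_ext_coef _ (fun n => c * dcoef v n)%C); [intros; unfold dcoef; ring|].
  apply (pser_ext (fun z => c * (f z / den t z))%C); [intros; unfold fscal, Cdiv; ring|].
  now apply pser_scal.
Qed.

Lemma hol_plus f g : hol f -> hol g -> hol (fadd f g).
Proof.
  intros Hf Hg z Hz. destruct (Hf z Hz) as [a Ha]. destruct (Hg z Hz) as [b Hb].
  eexists. now apply cder_plus; [exact Ha|exact Hb].
Qed.

Lemma hol_scal c f : hol f -> hol (fscal c f).
Proof. intros Hf z Hz. destruct (Hf z Hz) as [a Ha]. eexists. apply cder_scal. exact Ha. Qed.

Lemma hol_zero : hol fzero.
Proof. intros z _. eexists. apply cder_const. Qed.

(* The two operators act on the coefficients of [f / (1 - t z)] in the same way up to
   the shift [k]. *)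
Definition acts (t : R) (T : (C -> C) -> C -> C) (k : nat) : Prop :=
  forall f v, hol f -> hcoef t f v -> pser (T f) (fun n => v (k + n)%nat).

Lemma volterra_acts t : 0 <= t < 1 -> acts t (volterra_op (g_log t)) 0.
Proof. intros Ht f v Hf Hv. now apply (operators_pser t f v). Qed.

Lemma cesaro_acts t : 0 <= t < 1 -> acts t (cesaro_op t) 1.
Proof. intros Ht f v Hf Hv. now apply (operators_pser t f v). Qed.

Section Operator.
Context (t : R) (T : (C -> C) -> C -> C) (k : nat) (ht : 0 <= t < 1) (HT : acts t T k).

Lemma op_plus f g z : hol f -> hol g -> unit_disc z -> T (fadd f g) z = (T f z + T g z)%C.
Proof.
  intros Hf Hg Hz. destruct (hcoef_exists t f ht Hf) as [v Hv]. destruct (hcoef_exists t g ht Hg) as [w Hw].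
  exact (pser_fun_unique _ _ _ (HT _ _ (hol_plus f g Hf Hg) (hcoef_plus _ _ _ _ _ Hv Hw))
    (pser_plus _ _ _ _ (HT f v Hf Hv) (HT g w Hg Hw)) z Hz).
Qed.

Lemma op_scal c f z : hol f -> unit_disc z -> T (fscal c f) z = (c * T f z)%C.
Proof.
  intros Hf Hz. destruct (hcoef_exists t f ht Hf) as [v Hv].
  exact (pser_fun_unique _ _ _ (HT _ _ (hol_scal c f Hf) (hcoef_scal _ _ _ c Hv))
    (pser_scal c _ _ (HT f v Hf Hv)) z Hz).
Qed.

Lemma op_null (f : C -> C) : hol f -> (forall z, unit_disc z -> f z = 0%C) -> forall z, unit_disc z -> T f z = 0%C.
Proof.
  intros Hf H0. exact (pser_null _ _ (HT f _ Hf (hcoef_zero t f H0)) (fun _ => eq_refl)).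
Qed.

Lemma op_hol f : hol f -> hol (T f).
Proof.
  intros Hf. destruct (hcoef_exists t f ht Hf) as [v Hv]. exact (pser_hol _ _ (HT f v Hf Hv)).
Qed.

(** A vanishing image has zero coefficients, by [coef_bound] with bound 0. The image shows v_k,
    v_(k+1), ...; for [k <= 1] this hides at most v_0, which is 0 by [hcoef]. *)
Lemma op_inj f : (k <= 1)%nat -> hol f -> (forall z, unit_disc z -> T f z = 0%C) -> forall z, unit_disc z -> f z = 0%C.
Proof.
  intros Hk Hf H0 z Hz. destruct (hcoef_exists t f ht Hf) as [v Hv]. assert (HTf := HT f v Hf Hv).
  assert (v0 : forall n, v n = 0%C).
  { intros [|n]; [apply Hv|].
    assert (B : forall m, Cmod (v (k + m)%nat) <= 0).
    { intros m. apply (coef_bound (T f) _ 0 m HTf). intros x Hx. rewrite H0 by easy. rewrite Cmod_0. lra. }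
    apply Cmod_eq_0, Rle_antisym; [|apply Cmod_ge_0].
    specialize (B (S n - k)%nat). now replace (k + (S n - k))%nat with (S n) in B by lia. }
  assert (E := pser_null _ _ (proj2 Hv) (fun n => eq_trans (f_equal _ (v0 (S n))) (Cmult_0_r _)) z Hz).
  cbv beta in E.
  replace (f z) with (f z / den t z * den t z)%C by (field; now apply den_nz). rewrite E. ring.
Qed.

Lemma opt_iff f : optimal_domain T disc_algebra f <-> hol f /\ ucont (T f).
Proof.
  change (analytic f /\ disc_algebra (T f) <-> hol f /\ ucont (T f)). rewrite disc_algebra_iff, <- hol_analytic.
  split; [tauto|]. intros [H1 H2]. repeat split; try easy. now apply op_hol.
Qed.

Lemma opt_plus f g : optimal_domain T disc_algebra f -> optimal_domain T disc_algebra g ->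
  optimal_domain T disc_algebra (fadd f g).
Proof.
  rewrite !opt_iff. intros [Hf Uf] [Hg Ug]. split; [now apply hol_plus|].
  apply (ucont_ext (fun z => T f z + T g z)%C); [intros; symmetry; now apply op_plus|]. now apply ucont_plus.
Qed.

Lemma opt_scal c f : optimal_domain T disc_algebra f -> optimal_domain T disc_algebra (fscal c f).
Proof.
  rewrite !opt_iff. intros [Hf Uf]. split; [now apply hol_scal|].
  apply (ucont_ext (fun z => c * T f z)%C); [intros; symmetry; now apply op_scal|].
  apply ucont_mult; [apply ucont_const|easy].
Qed.

Lemma opt_linear_subspace : linear_subspace (optimal_domain T disc_algebra).
Proof.
  split; [now intros f [H _]|]. split; [|split].
  - apply opt_iff. split; [apply hol_zero|]. apply (ucont_ext (fun _ => 0%C)); [|apply ucont_const].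
    intros; symmetry; now apply (op_null fzero hol_zero).
  - apply opt_plus.
  - apply opt_scal.
Qed.

Lemma opt_norm_axioms : (k <= 1)%nat -> norm_axioms (optimal_domain T disc_algebra).
Proof.
  intros Hk.
  assert (B : forall f, optimal_domain T disc_algebra f -> hol f /\ dbounded (T f)).
  { intros f Hf. apply opt_iff in Hf. split; [easy|]. now apply ucont_bounded. }
  split; [|split; [|split]].
  - intros f Hf. apply sup_norm_nonneg. now apply B.
  - intros f Hf. apply B in Hf. destruct Hf as [Hf Bf]. simpl. split.
    + intros E z Hz. apply (op_inj f Hk Hf); [|easy]. intros x Hx.
      apply Cmod_eq_0, Rle_antisym; [|apply Cmod_ge_0]. rewrite <- E. now apply sup_norm_ub.
    + intros E. apply Rle_antisym; [|now apply sup_norm_nonneg]. apply sup_norm_le. intros z Hz.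
      rewrite (op_null f Hf E z Hz), Cmod_0. lra.
  - intros c f Hf. apply B in Hf. destruct Hf as [Hf Bf]. simpl.
    assert (Bc : dbounded (T (fscal c f))).
    { destruct Bf as [M HM]. exists (Cmod c * M). intros z Hz. rewrite op_scal, Cmod_mult by easy.
      apply Rmult_le_compat_l; [apply Cmod_ge_0|auto]. }
    apply Rle_antisym.
    + apply sup_norm_le. intros z Hz. rewrite op_scal, Cmod_mult by easy.
      apply Rmult_le_compat_l; [apply Cmod_ge_0|]. now apply sup_norm_ub.
    + destruct (Req_dec (Cmod c) 0) as [E|E]; [rewrite E, Rmult_0_l; now apply sup_norm_nonneg|].
      assert (Pc : 0 < Cmod c) by (generalize (Cmod_ge_0 c); lra).
      apply Rmult_le_reg_l with (/ Cmod c); [now apply Rinv_0_lt_compat|].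
      rewrite <- Rmult_assoc, Rinv_l, Rmult_1_l by easy. apply sup_norm_le. intros z Hz.
      apply Rmult_le_reg_l with (Cmod c); [easy|]. rewrite <- Rmult_assoc, Rinv_r, Rmult_1_l by easy.
      rewrite <- Cmod_mult, <- op_scal by easy. now apply sup_norm_ub.
  - intros f g Hf Hg. apply B in Hf. apply B in Hg. destruct Hf as [Hf Bf], Hg as [Hg Bg]. simpl.
    apply sup_norm_le. intros z Hz. rewrite op_plus by easy.
    eapply Rle_trans; [apply Cmod_triangle|]. apply Rplus_le_compat; now apply sup_norm_ub.
Qed.

End Operator.

(** * Optimal domains in the disc algebra *)

Lemma volterra_eq_z_cesaro t f z : 0 <= t < 1 -> hol f -> unit_disc z ->
  volterra_op (g_log t) f z = (z * cesaro_op t f z)%C.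
Proof.
  intros Ht Hf Hz. destruct (hcoef_exists t f Ht Hf) as [v Hv].
  destruct (operators_pser t f v Ht Hf Hv) as [H1 H2].
  assert (H3 := pser_mulz _ _ 0%C H2).
  assert (H4 : pser (fun z => 0 + z * cesaro_op t f z)%C v).
  { refine (pser_ext_coef _ _ _ _ H3). intros [|n]; [symmetry; apply Hv|easy]. }
  rewrite (pser_fun_unique _ _ _ H1 H4 z Hz). ring.
Qed.

(** The extension of [V] divided by z is continuous on the closed disc away from 0, and near 0 it is
    [G], which is continuous there. Compactness upgrades this to uniform continuity. *)
Lemma ucont_div_id V G : hol G -> ucont V -> (forall z, unit_disc z -> V z = (z * G z)%C) -> ucont G.
Proof.
  intros HG HV E. destruct (ucont_extends V HV) as [F [EF HF]].
  set (F' := fun z => if Ceq_dec z 0 then G 0%C else (F z / z)%C).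
  assert (EG : forall z, unit_disc z -> F' z = G z).
  { intros z Hz. unfold F'. destruct (Ceq_dec z 0) as [->|Hz0]; [easy|].
    rewrite (EF z Hz), (E z Hz). field. easy. }
  apply (ucont_ext F'); [exact EG|]. apply closed_disc_ucont. intros z Hz.
  apply closed_disc_continuous. destruct (Ceq_dec z 0) as [->|Hz0].
  - intros eps He. destruct (HG 0%C unit_disc_0) as [l Hl]. apply cder_cont in Hl.
    destruct (proj1 (locally_disc _ _) (Hl eps He)) as [d [d0 Hd]].
    exists (Rmin d 1). split; [apply Rmin_glb_lt; lra|]. intros w _ Hw.
    destruct (Rlt_Rmin _ _ _ Hw) as [W1 W2].
    rewrite !EG; [now apply Hd|apply unit_disc_0|].
    unfold unit_disc. now replace w with (w - 0)%C by ring.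
  - assert (Hc := HF z Hz). apply (clim_filterlim (within closed_disc (near z)) _) in Hc.
    assert (Hi : clim (within closed_disc (near z)) (fun w : C => w) z).
    { intros eps He. generalize (clim_id z eps He). unfold within. apply filter_imp. auto. }
    assert (Hq : clim (within closed_disc (near z)) (fun w => F w / w)%C (F z / z)%C) by now clim_tac.
    intros eps He. destruct (proj1 (locally_disc _ _) (Hq eps He)) as [d [d0 Hd]].
    exists (Rmin d (Cmod z)). split; [apply Rmin_glb_lt; [easy|now apply Cmod_gt_0]|]. intros w Hw Hwz.
    destruct (Rlt_Rmin _ _ _ Hwz) as [W1 W2].
    unfold F'. destruct (Ceq_dec z 0) as [|_]; [easy|]. destruct (Ceq_dec w 0) as [->|_].
    + rewrite Cmod_sym in W2. replace (z - 0)%C with z in W2 by ring. lra.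
    + now apply (Hd w W1).
Qed.

Lemma ucont_volterra_cesaro t f : 0 <= t < 1 -> hol f ->
  (ucont (volterra_op (g_log t) f) <-> ucont (cesaro_op t f)).
Proof.
  intros Ht Hf. assert (E := fun z => volterra_eq_z_cesaro t f z Ht Hf). split; intros H.
  - apply (ucont_div_id (volterra_op (g_log t) f)); [|easy|easy].
    exact (op_hol t _ 1 Ht (cesaro_acts t Ht) f Hf).
  - apply (ucont_ext (fun z => z * cesaro_op t f z)%C); [intros; now rewrite E|].
    apply ucont_mult; [apply ucont_id|easy].
Qed.

Lemma same_volterra_cesaro t : 0 <= t < 1 -> same_functions
  (optimal_domain (volterra_op (g_log t)) disc_algebra) (optimal_domain (cesaro_op t) disc_algebra).
Proof.
  intros Ht f. rewrite (opt_iff t _ 0 Ht (volterra_acts t Ht)), (opt_iff t _ 1 Ht (cesaro_acts t Ht)).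
  split; intros [H1 H2]; (split; [easy|]); now apply (ucont_volterra_cesaro t f Ht H1).
Qed.

Lemma volterra_le_cesaro t f : 0 <= t < 1 -> hol f -> dbounded (cesaro_op t f) ->
  sup_norm (volterra_op (g_log t) f) <= sup_norm (cesaro_op t f).
Proof.
  intros Ht Hf HB. apply sup_norm_le. intros z Hz. rewrite volterra_eq_z_cesaro, Cmod_mult by easy.
  assert (H1 := sup_norm_ub _ z HB Hz). unfold unit_disc in Hz.
  generalize (Cmod_ge_0 z) (Cmod_ge_0 (cesaro_op t f z)). nra.
Qed.

Lemma pser_coef_bound_sum f a M z : pser f a -> unit_disc z -> 0 <= M -> (forall n, Cmod (a n) <= M) ->
  Cmod (f z) <= M / (1 - Cmod z).
Proof.
  intros Hf Hz M0 HM. apply (cser_bound _ _ _ (proj2 Hf z Hz)). intros n.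
  apply rsum_geom; [split; [apply Cmod_ge_0|easy]|easy|]. intros k. rewrite term_mod.
  apply Rmult_le_compat_r; [apply pow_le, Cmod_ge_0|apply HM].
Qed.

(** For |z| >= 1/2 one divides V_g f = z C_t f by z. For |z| < 1/2 the coefficients of C_t f are
    those of V_g f, hence at most the sup-norm M, and the geometric series gives M / (1 - |z|) <= 2
    M. *)
Lemma cesaro_le_volterra t f : 0 <= t < 1 -> hol f -> dbounded (volterra_op (g_log t) f) ->
  sup_norm (cesaro_op t f) <= 2 * sup_norm (volterra_op (g_log t) f).
Proof.
  intros Ht Hf HB. set (M := sup_norm (volterra_op (g_log t) f)).
  assert (M0 : 0 <= M) by now apply sup_norm_nonneg.
  destruct (hcoef_exists t f Ht Hf) as [v Hv]. destruct (operators_pser t f v Ht Hf Hv) as [H1 H2].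
  apply sup_norm_le. intros z Hz. destruct (Rle_lt_dec (/ 2) (Cmod z)) as [L|L].
  - assert (U := sup_norm_ub _ z HB Hz). rewrite volterra_eq_z_cesaro, Cmod_mult in U by easy. fold M in U.
    generalize (Cmod_ge_0 (cesaro_op t f z)). nra.
  - eapply Rle_trans; [apply (pser_coef_bound_sum _ _ M z H2 Hz M0)|].
    + intros n. apply (coef_bound _ _ M (S n) H1). intros w Hw. now apply sup_norm_ub.
    + apply Rmult_le_reg_r with (1 - Cmod z); [lra|]. unfold Rdiv. rewrite Rmult_assoc, Rinv_l; nra.
Qed.

Lemma hcoef_ext t f g v : (forall z, unit_disc z -> f z = g z) -> hcoef t f v -> hcoef t g v.
Proof.
  intros E [H1 H2]. split; [easy|]. apply (pser_ext (fun z => f z / den t z)%C); [|easy].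
  intros z Hz. now rewrite E.
Qed.

Lemma op_minus t T k f g z : 0 <= t < 1 -> acts t T k -> hol f -> hol g -> unit_disc z ->
  T (fsub f g) z = (T f z - T g z)%C.
Proof.
  intros Ht HT Hf Hg Hz.
  assert (E : forall w, unit_disc w -> fadd f (fscal (- (1))%C g) w = fsub f g w) by (intros; unfold fadd, fscal, fsub; ring).
  assert (H1 : hol (fadd f (fscal (- (1))%C g))) by (apply hol_plus; [|apply hol_scal]; easy).
  destruct (hcoef_exists t _ Ht H1) as [v Hv].
  rewrite <- (pser_fun_unique _ _ _ (HT _ _ H1 Hv) (HT _ _ (hol_ext _ _ E H1) (hcoef_ext _ _ _ _ E Hv)) z Hz).
  rewrite (op_plus t T k), (op_scal t T k) by (easy || now apply hol_scal). ring.
Qed.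

Lemma hol_minus f g : hol f -> hol g -> hol (fsub f g).
Proof.
  intros Hf Hg z Hz. destruct (Hf z Hz) as [a Ha]. destruct (Hg z Hz) as [b Hb].
  eexists. apply cder_minus; [exact Ha|exact Hb].
Qed.

Lemma ucont_minus f g : ucont f -> ucont g -> ucont (fun z => f z - g z)%C.
Proof.
  intros Hf Hg. apply (ucont_ext (fun z => f z + (-(1)) * g z)%C); [intros; ring|].
  apply ucont_plus; [easy|]. apply ucont_mult; [apply ucont_const|easy].
Qed.

(* The Taylor coefficients of a sup-norm Cauchy sequence converge uniformly in the index,
   and the limiting coefficients define the limit. *)
Lemma cesaro_complete t : 0 <= t < 1 -> complete_norm (optimal_domain (cesaro_op t) disc_algebra).
Proof.
  intros Ht u Hu HC. assert (HT := cesaro_acts t Ht). set (T := cesaro_op t) in *.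
  assert (Hhol : forall n, hol (u n)) by (intros n; apply (opt_iff t T 1 Ht HT), Hu).
  assert (Huc : forall n, ucont (T (u n))) by (intros n; apply (opt_iff t T 1 Ht HT), Hu).
  assert (Hsub : forall m n, dbounded (T (fsub (u m) (u n)))).
  { intros m n. apply ucont_bounded. apply (ucont_ext (fun z => T (u m) z - T (u n) z)%C).
    - intros z Hz. symmetry. now apply (op_minus t T 1).
    - now apply ucont_minus. }
  assert (HC' : forall eps, 0 < eps -> exists N, forall m n, (N <= m)%nat -> (N <= n)%nat ->
    forall z, unit_disc z -> Cmod (T (u m) z - T (u n) z) <= eps).
  { intros eps He. destruct (HC eps He) as [N HN]. exists N. intros m n Hm Hn z Hz.
    rewrite <- (op_minus t T 1) by easy. eapply Rle_trans; [apply sup_norm_ub; [apply Hsub|easy]|].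
    apply Rlt_le, (HN m n Hm Hn). }
  set (v := fun n => epsilon (inhabits (fun _ => RtoC 0)) (hcoef t (u n))).
  assert (Hv : forall n, hcoef t (u n) (v n)) by (intros n; apply epsilon_spec; now apply hcoef_exists).
  set (A := fun n j => v n (S j)).
  assert (HA : forall n, pser (T (u n)) (A n)) by (intros n; exact (HT _ _ (Hhol n) (Hv n))).
  assert (HAc : forall eps, 0 < eps -> exists N, forall m n, (N <= m)%nat -> (N <= n)%nat ->
    forall j, Cmod (A m j - A n j) <= eps).
  { intros eps He. destruct (HC' eps He) as [N HN]. exists N. intros m n Hm Hn j.
    apply (coef_bound _ _ eps j (pser_minus _ _ _ _ (HA m) (HA n))). now apply HN. }
  set (L := fun j => epsilon (inhabits (RtoC 0)) (clim eventually (fun n => A n j))).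
  assert (HL : forall j, clim eventually (fun n => A n j) (L j)).
  { intros j. unfold L. apply epsilon_spec, (C_complete (fun n => A n j)). intros eps He.
    destruct (HAc (eps / 2) ltac:(lra)) as [N HN]. exists N. intros m n Hm Hn.
    specialize (HN m n Hm Hn j). lra. }
  assert (HAL : forall eps, 0 < eps -> exists N, forall n, (N <= n)%nat -> forall j, Cmod (A n j - L j) <= eps).
  { intros eps He. destruct (HAc eps He) as [N HN]. exists N. intros n Hn j. rewrite Cmod_sym.
    apply (clim_bound (fun m => A m j) (L j) _ _ N (HL j)). intros m Hm. now apply HN. }
  (* [L] differs by a bounded sequence from the tame sequence [A N]. *)
  assert (TL : tame L).
  { destruct (HAL 1 Rlt_0_1) as [N HN].
    assert (K := tame_plus _ _ (proj1 (HA N)) (tame_bounded (fun j => L j - A N j)%C 1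
      (fun j => eq_ind _ (fun x => x <= 1) (HN N (le_n _) j) _ (Cmod_sym _ _)))).
    refine (tame_le _ _ _ K). intros j. apply Req_le. f_equal. ring. }
  set (w := fun n => match n with O => RtoC 0 | S j => L j end).
  destruct (hcoef_surj t w Ht (tame_unshift w TL) eq_refl) as [f [Hf Hfw]].
  assert (HTf : pser (T f) L) by exact (HT f w Hf Hfw).
  assert (Hpt : forall z, unit_disc z -> clim eventually (fun n => T (u n) z) (T f z)).
  { intros z Hz. apply clim_seq. intros eps He. assert (Hz' := Hz). unfold unit_disc in Hz'.
    destruct (HAL (eps * (1 - Cmod z) / 2)) as [N HN].
    { apply Rdiv_lt_0_compat; [apply Rmult_lt_0_compat|]; lra. }
    exists N. intros n Hn.
    assert (B := pser_coef_bound_sum _ _ (eps * (1 - Cmod z) / 2) z (pser_minus _ _ _ _ (HA n) HTf) Hz).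
    cbv beta in B. replace (eps * (1 - Cmod z) / 2 / (1 - Cmod z)) with (eps / 2) in B by (field; lra).
    eapply Rle_lt_trans; [apply B|lra].
    - apply Rlt_le, Rdiv_lt_0_compat; [apply Rmult_lt_0_compat|]; lra.
    - now apply HN. }
  (* The closeness of the coefficients yields only pointwise convergence, with a loss 1 / (1 - |z|);
     uniformity returns by letting m tend to infinity in the Cauchy condition at each z. *)
  assert (Hunif : forall eps, 0 < eps -> exists N, forall n, (N <= n)%nat -> forall z, unit_disc z -> Cmod (T (u n) z - T f z) <= eps).
  { intros eps He. destruct (HC' eps He) as [N HN]. exists N. intros n Hn z Hz. rewrite Cmod_sym.
    apply (clim_bound (fun m => T (u m) z) _ _ _ N (Hpt z Hz)). intros m Hm. now apply HN. }
  exists f. split.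
  - apply (opt_iff t T 1 Ht HT). split; [easy|]. apply (ucont_uniform_limit (fun n => T (u n))); [easy|].
    intros eps He. destruct (Hunif eps He) as [N HN]. exists N. now apply HN.
  - apply is_lim_seq_spec. intros eps. destruct (Hunif (eps / 2)) as [N HN]; [generalize (cond_pos eps); lra|].
    exists N. intros n Hn. simpl. rewrite Rminus_0_r.
    assert (B : forall z, unit_disc z -> Cmod (T (fsub (u n) f) z) <= eps / 2).
    { intros z Hz. rewrite (op_minus t T 1) by easy. now apply HN. }
    rewrite Rabs_pos_eq.
    + eapply Rle_lt_trans; [apply sup_norm_le, B|]. generalize (cond_pos eps). lra.
    + apply sup_norm_nonneg. now exists (eps / 2).
Qed.

Lemma equivalent_volterra_cesaro t f : 0 <= t < 1 -> optimal_domain (volterra_op (g_log t)) disc_algebra f ->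
  1 * sup_norm (volterra_op (g_log t) f) <= sup_norm (cesaro_op t f) <= 2 * sup_norm (volterra_op (g_log t) f).
Proof.
  intros Ht Hf. assert (Hc := proj1 (same_volterra_cesaro t Ht f) Hf).
  apply (opt_iff t _ 0 Ht (volterra_acts t Ht)) in Hf. apply (opt_iff t _ 1 Ht (cesaro_acts t Ht)) in Hc.
  destruct Hf as [Hf U1], Hc as [_ U2]. rewrite Rmult_1_l. split.
  - apply volterra_le_cesaro; [easy|easy|now apply ucont_bounded].
  - apply cesaro_le_volterra; [easy|easy|now apply ucont_bounded].
Qed.

Lemma opt_minus t T k f g : 0 <= t < 1 -> acts t T k -> optimal_domain T disc_algebra f ->
  optimal_domain T disc_algebra g -> optimal_domain T disc_algebra (fsub f g).
Proof.
  intros Ht HT. rewrite !(opt_iff t T k Ht HT). intros [Hf Uf] [Hg Ug]. split; [now apply hol_minus|].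
  apply (ucont_ext (fun z => T f z - T g z)%C); [intros; symmetry; now apply (op_minus t T k)|]. now apply ucont_minus.
Qed.

(** Transported from [cesaro_complete] along the equivalence of norms; the factor 2 there explains
    eps / 2. *)
Lemma volterra_complete t : 0 <= t < 1 -> complete_norm (optimal_domain (volterra_op (g_log t)) disc_algebra).
Proof.
  intros Ht u Hu HC. assert (HV := volterra_acts t Ht).
  destruct (cesaro_complete t Ht u) as [f [Hf Hl]].
  - intros n. exact (proj1 (same_volterra_cesaro t Ht (u n)) (Hu n)).
  - intros eps He. destruct (HC (eps / 2) ltac:(lra)) as [N HN]. exists N. intros m n Hm Hn.
    specialize (HN m n Hm Hn). simpl in *.
    assert (E := equivalent_volterra_cesaro t _ Ht (opt_minus t _ 0 _ _ Ht HV (Hu m) (Hu n))). lra.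
  - exists f. apply (proj2 (same_volterra_cesaro t Ht f)) in Hf. split; [exact Hf|].
    apply (is_lim_seq_le_le (fun _ => 0) _ _ (Finite 0)) with (2 := is_lim_seq_const 0) (3 := Hl).
    intros n. assert (Hd := opt_minus t _ 0 _ _ Ht HV (Hu n) Hf).
    assert (E := equivalent_volterra_cesaro t _ Ht Hd). simpl. split; [|lra].
    apply sup_norm_nonneg, ucont_bounded. now apply (opt_iff t _ 0 Ht HV).
Qed.

Lemma equal_volterra_cesaro t : 0 <= t < 1 -> equal_as_banach_spaces
  (optimal_domain (volterra_op (g_log t)) disc_algebra) (optimal_domain (cesaro_op t) disc_algebra).
Proof.
  intros Ht. split; [|split; [|split]].
  - split; [|split].
    + exact (opt_linear_subspace t _ 0 Ht (volterra_acts t Ht)).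
    + exact (opt_norm_axioms t _ 0 Ht (volterra_acts t Ht) ltac:(lia)).
    + now apply volterra_complete.
  - split; [|split].
    + exact (opt_linear_subspace t _ 1 Ht (cesaro_acts t Ht)).
    + exact (opt_norm_axioms t _ 1 Ht (cesaro_acts t Ht) ltac:(lia)).
    + now apply cesaro_complete.
  - now apply same_volterra_cesaro.
  - exists 1, 2. split; [lra|]. split; [lra|]. intros f Hf. now apply equivalent_volterra_cesaro.
Qed.

(** With r = 1 - |z|, the rescaled function k -> V(z + r k) - V(z) lives on the unit disc, is
    bounded by M and has first coefficient r F(z), so [coef_bound] applies. *)
Lemma derivative_estimate V F z M : (forall w, unit_disc w -> cder V w (F w)) -> unit_disc z ->
  (forall w, Cmod (w - z) < 1 - Cmod z -> Cmod (V w - V z) <= M) ->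
  (1 - Cmod z) * Cmod (F z) <= M.
Proof.
  intros HV Hz HM. set (r := 1 - Cmod z). assert (Hr : 0 < r) by (unfold r, unit_disc in *; lra).
  set (G := fun k => (V (z + RtoC r * k) - V z)%C).
  assert (In : forall k, unit_disc k -> unit_disc (z + RtoC r * k)%C /\ Cmod (z + RtoC r * k - z) < r).
  { intros k Hk. unfold unit_disc in *.
    assert (E : Cmod (RtoC r * k) < r) by (rewrite scale_mod by lra; nra). split.
    - eapply Rle_lt_trans; [apply Cmod_triangle|]. unfold r in *. lra.
    - now replace (z + RtoC r * k - z)%C with (RtoC r * k)%C by ring. }
  assert (HG : forall k, unit_disc k -> cder G k (F (z + RtoC r * k) * RtoC r)%C).
  { intros k Hk. eapply cder_eq.
    - apply cder_minus; [|apply cder_const].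
      apply (cder_comp V (fun k => z + RtoC r * k)%C); [now apply HV, In|].
      apply cder_plus; [apply cder_const|apply cder_scal, cder_id].
    - ring. }
  destruct (hol_pser G) as [c Hc]; [intros k Hk; eexists; now apply HG|].
  destruct (pser_exists (dcoef c) (tame_dcoef _ (proj1 Hc))) as [g Hg].
  assert (E : (F z * RtoC r)%C = c 1%nat).
  { apply (cder_unique G 0%C).
    - generalize (HG 0%C unit_disc_0). now replace (z + RtoC r * 0)%C with z by ring.
    - replace (c 1%nat) with (g 0%C); [now apply (pser_cder G g c), unit_disc_0|].
      rewrite (pser_at_0 _ _ Hg). unfold dcoef. simpl. ring. }
  assert (B := coef_bound G c M 1 Hc (fun k Hk => HM _ (proj2 (In k Hk)))).
  rewrite <- E, Cmod_mult, Cmod_R, Rabs_pos_eq in B by lra. lra.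
Qed.

Lemma volterra_cder t f z : 0 <= t < 1 -> hol f -> unit_disc z ->
  cder (volterra_op (g_log t) f) z (f z / den t z)%C.
Proof.
  intros Ht Hf Hz. destruct (hcoef_exists t f Ht Hf) as [v Hv].
  apply (pser_cder _ _ v z (proj1 (operators_pser t f v Ht Hf Hv)) (proj2 Hv) Hz).
Qed.

Lemma mod_le_div_den t f z : 0 <= t < 1 -> unit_disc z -> Cmod (f z) <= 2 * Cmod (f z / den t z).
Proof.
  intros Ht Hz. assert (U := den_upper t z ltac:(lra) (Rlt_le _ _ Hz)).
  replace (f z) with (f z / den t z * den t z)%C at 1 by (field; now apply den_nz).
  rewrite Cmod_mult. generalize (Cmod_ge_0 (f z / den t z)). nra.
Qed.

Lemma cesaro_hardy_infty_growth t : 0 <= t < 1 -> contained (optimal_domain (cesaro_op t) hardy_infty) growth_space.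
Proof.
  (* One factor 2 comes from |V(w) - V(z)| <= 2 M, the other from |1 - t z| <= 2. *)
  intros Ht f [Ha [_ [M HM]]]. assert (Hf := proj2 (hol_analytic f) Ha). split; [easy|]. exists (4 * M).
  intros z Hz.
  assert (HV : forall w, unit_disc w -> Cmod (volterra_op (g_log t) f w) <= M).
  { intros w Hw. rewrite volterra_eq_z_cesaro, Cmod_mult by easy. specialize (HM w Hw). unfold unit_disc in Hw.
    generalize (Cmod_ge_0 w) (Cmod_ge_0 (cesaro_op t f w)). nra. }
  assert (D := derivative_estimate _ (fun z => f z / den t z)%C z (2 * M)
    (fun w Hw => volterra_cder t f w Ht Hf Hw) Hz).
  cbv beta in D. assert (L := mod_le_div_den t f z Ht Hz).
  assert (D' : (1 - Cmod z) * Cmod (f z / den t z) <= 2 * M).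
  { apply D. intros w Hw. assert (Uw : unit_disc w) by (unfold unit_disc; generalize (Cmod_rev w z); lra).
    eapply Rle_trans; [apply Cmod_triangle|]. rewrite Cmod_opp. generalize (HV w Uw) (HV z Hz). lra. }
  unfold unit_disc in Hz. nra.
Qed.

Lemma cesaro_disc_algebra_little_growth t : 0 <= t < 1 ->
  contained (optimal_domain (cesaro_op t) disc_algebra) little_growth_space.
Proof.
  intros Ht f HfT. apply (proj2 (same_volterra_cesaro t Ht f)) in HfT.
  apply (opt_iff t _ 0 Ht (volterra_acts t Ht)) in HfT. destruct HfT as [Hf HU].
  split; [now apply hol_analytic|]. intros eps He.
  (* When |z| > 1 - d, the disc about z of radius 1 - |z| is smaller than [d], so V_g f differs
     there from its value at z by less than eps / 4. The factor 2 of [mod_le_div_den] leaves eps /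
     2. *)
  destruct (HU (eps / 4) ltac:(lra)) as [d [d0 Hd]]. exists d. split; [easy|]. intros z Hz Hzd.
  assert (D : (1 - Cmod z) * Cmod (f z / den t z) <= eps / 4).
  { apply (derivative_estimate _ (fun z => f z / den t z)%C z (eps / 4)
      (fun w Hw => volterra_cder t f w Ht Hf Hw) Hz).
    intros w Hw. assert (Uw : unit_disc w) by (unfold unit_disc; generalize (Cmod_rev w z); lra).
    apply Rlt_le, Hd; [easy|easy|lra]. }
  assert (L := mod_le_div_den t f z Ht Hz). unfold unit_disc in Hz. nra.
Qed.

(** * Bounded functions and the properness of their inclusion *)

Lemma harmonic_unbounded K : exists N, K < rsum (fun n => / INR (S n)) N.
Proof.
  assert (H : forall n, ln (INR (S n)) <= rsum (fun n => / INR (S n)) n).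
  { induction n as [|n IH]; [simpl; rewrite ln_1; lra|]. cbn [rsum].
    assert (P : 0 < INR (S n)) by (apply lt_0_INR; lia).
    (* The increment of the logarithm is ln (1 + 1/(n+1)), which is at most 1/(n+1). *)
    assert (E : ln (INR (S (S n))) <= ln (INR (S n)) + / INR (S n)).
    { replace (INR (S (S n))) with (INR (S n) * (1 + / INR (S n))) by (rewrite (S_INR (S n)); field; lra).
      assert (Pi : 0 < / INR (S n)) by now apply Rinv_0_lt_compat.
      rewrite ln_mult by lra. apply Rplus_le_compat_l.
      rewrite <- (ln_exp (/ INR (S n))) at 2. apply Rlt_le, ln_increasing; [lra|]. apply exp_ineq1. lra. }
    lra. }
  destruct (nfloor_ex (exp (K + 1))) as [N [_ HN]]; [apply Rlt_le, exp_pos|].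
  exists N. apply Rlt_le_trans with (K + 1); [lra|]. eapply Rle_trans; [|apply H].
  rewrite <- (ln_exp (K + 1)). apply Rlt_le, ln_increasing; [apply exp_pos|]. now rewrite S_INR.
Qed.

Lemma rsum_RtoC a n : csum (fun k => RtoC (a k)) n = RtoC (rsum a n).
Proof. induction n as [|n IH]; simpl; [easy|]. now rewrite IH, RtoC_plus. Qed.

(** At real points r of the disc nonnegative terms make every partial sum a lower bound for f(r);
    then r tends to 1. It turns divergence of the harmonic series into unboundedness of a
    function. *)
Lemma pser_positive_bounded f a K N : (forall n, 0 <= a n) -> pser f (fun n => RtoC (a n)) ->
  (forall z, unit_disc z -> Cmod (f z) <= K) -> rsum a N <= K.
Proof.
  intros H0 Hf HK. apply (abel_bound a N K 0 H0). intros r Hr. rewrite Rmult_0_l, Rplus_0_r.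
  assert (Uz : unit_disc (RtoC r)) by (unfold unit_disc; rewrite Cmod_R, Rabs_pos_eq; lra).
  apply Rnot_lt_le. intros Hlt. specialize (HK _ Uz).
  destruct (proj1 (clim_seq _ _) (proj2 Hf _ Uz) (rsum (fun n => a n * r ^ n) N - K) ltac:(lra)) as [M HM].
  specialize (HM (max M N) ltac:(lia)).
  rewrite (csum_ext _ (fun n => RtoC (a n * r ^ n))), rsum_RtoC in HM by (intros; now rewrite RtoC_mult, RtoC_pow).
  assert (P : forall n, 0 <= a n * r ^ n) by (intros; apply Rmult_le_pos; [easy|apply pow_le; lra]).
  assert (B := rsum_mono _ N (max M N) P ltac:(lia)).
  assert (T := Cmod_rev (RtoC (rsum (fun n => a n * r ^ n) (max M N))) (f (RtoC r))).
  rewrite Cmod_R, Rabs_pos_eq in T by now apply rsum_nonneg. lra.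
Qed.

(** Telescoping with 1/(m+1)^2 <= 1/m - 1/(m+1), starting from the first term 1. *)
Lemma rsum_inv_sq n : rsum (fun k => / (INR (S k) * INR (S k))) n <= 2.
Proof.
  assert (H : forall m, rsum (fun k => / (INR (S k) * INR (S k))) (S m) <= 2 - / INR (S m)).
  { induction m as [|m IH]; [simpl; lra|].
    change (rsum (fun k => / (INR (S k) * INR (S k))) (S m) + / (INR (S (S m)) * INR (S (S m))) <= 2 - / INR (S (S m))).
    assert (P : 0 < INR (S m)) by (apply lt_0_INR; lia). rewrite (S_INR (S m)) in *.
    set (x := INR (S m)) in *. assert (E : / x - / (x + 1) = / (x * (x + 1))) by (field; lra).
    assert (F : / ((x + 1) * (x + 1)) <= / (x * (x + 1))) by (apply Rinv_le_contravar; nra). lra. }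
  destruct n as [|n]; [simpl; lra|]. eapply Rle_trans; [apply H|].
  assert (0 < / INR (S n)) by (apply Rinv_0_lt_compat, lt_0_INR; lia). lra.
Qed.

Lemma hardy_infty_subspace : linear_subspace hardy_infty.
Proof.
  split; [now intros f [H _]|]. split; [|split].
  - apply hardy_infty_iff. split; [apply hol_zero|]. exists 0. intros z _. unfold fzero. rewrite Cmod_0. lra.
  - intros f g. rewrite !hardy_infty_iff. intros [Hf [M HM]] [Hg [K HK]]. split; [now apply hol_plus|].
    exists (M + K). intros z Hz. eapply Rle_trans; [apply Cmod_triangle|]. generalize (HM z Hz) (HK z Hz). lra.
  - intros c f. rewrite !hardy_infty_iff. intros [Hf [M HM]]. split; [now apply hol_scal|].
    exists (Cmod c * M). intros z Hz. unfold fscal. rewrite Cmod_mult.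
    apply Rmult_le_compat_l; [apply Cmod_ge_0|auto].
Qed.

Lemma div_den_bound t f z M : 0 <= t < 1 -> unit_disc z -> Cmod (f z) <= M -> Cmod (f z / den t z) <= M / (1 - t).
Proof.
  intros Ht Hz HM. rewrite Cmod_div by now apply den_nz.
  assert (L := den_lower t z ltac:(lra) (Rlt_le _ _ Hz)). assert (C0 := Cmod_ge_0 (f z)).
  unfold Rdiv. apply Rmult_le_compat; [easy|apply Rlt_le, Rinv_0_lt_compat; lra|easy|].
  apply Rinv_le_contravar; lra.
Qed.

(** The derivative f / (1 - t z) of V_g f is bounded by M / (1 - t), so V_g f is Lipschitz, hence
    uniformly continuous. *)
Lemma hardy_infty_in_cesaro t : 0 <= t < 1 -> contained hardy_infty (optimal_domain (cesaro_op t) disc_algebra).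
Proof.
  intros Ht f. rewrite hardy_infty_iff. intros [Hf [M HM]]. apply (proj1 (same_volterra_cesaro t Ht f)).
  apply (opt_iff t _ 0 Ht (volterra_acts t Ht)). split; [easy|].
  assert (M0 : 0 <= M) by (eapply Rle_trans; [apply Cmod_ge_0|apply (HM 0%C unit_disc_0)]).
  set (K := M / (1 - t)).
  assert (K0 : 0 <= K) by (apply Rmult_le_pos; [easy|apply Rlt_le, Rinv_0_lt_compat; lra]).
  intros eps He. exists (eps / (K + 1)). split; [apply Rdiv_lt_0_compat; lra|]. intros z w Hz Hw Hzw.
  assert (Dh := hol_dcont _ (hol_div_den t f Ht Hf)).
  rewrite <- (seg_FTC (volterra_op (g_log t) f) (fun z => f z / den t z)%C w z) by (auto; intros; now apply volterra_cder).
  eapply Rle_lt_trans; [apply (seg_norm _ w z K Dh Hw Hz)|].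
  - intros s Hs. assert (U := conv_disc w z s Hw Hz Hs). now apply div_den_bound, HM.
  - apply (Rmult_lt_compat_r (K + 1)) in Hzw; [|lra]. replace (eps / (K + 1) * (K + 1)) with eps in Hzw by (field; lra).
    generalize (Cmod_ge_0 (z - w)). nra.
Qed.

(* Witness: [V f = sum z^(n+1) / (n+1)^2], so that [f / (1 - t z) = sum z^n / (n+1)]. *)
Lemma hardy_infty_proper t : 0 <= t < 1 -> proper_subspace hardy_infty (optimal_domain (cesaro_op t) disc_algebra).
Proof.
  intros Ht. split; [apply hardy_infty_subspace|]. split; [exact (opt_linear_subspace t _ 1 Ht (cesaro_acts t Ht))|].
  split; [now apply hardy_infty_in_cesaro|]. intros Hsame.
  set (v := fun n => match n with O => RtoC 0 | S k => RtoC (/ (INR (S k) * INR (S k))) end).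
  assert (Iv : forall k, 0 <= / (INR (S k) * INR (S k))).
  { intros k. assert (0 < INR (S k)) by (apply lt_0_INR; lia).
    apply Rlt_le, Rinv_0_lt_compat, Rmult_lt_0_compat; easy. }
  assert (Sv : forall n, rsum (fun k => Cmod (v (S k))) n <= 2).
  { intros n. rewrite (rsum_ext _ (fun k => / (INR (S k) * INR (S k)))); [apply rsum_inv_sq|].
    intros k _. unfold v. rewrite Cmod_R, Rabs_pos_eq; [easy|apply Iv]. }
  assert (Tv : tame v).
  { apply (tame_bounded v 2). intros [|n]; [unfold v; rewrite Cmod_0; lra|].
    assert (B := Sv (S n)). cbn [rsum] in B.
    assert (0 <= rsum (fun k => Cmod (v (S k))) n) by (apply rsum_nonneg; intros; apply Cmod_ge_0). lra. }
  destruct (hcoef_surj t v Ht Tv eq_refl) as [f [Hf Hv]].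
  assert (Hin : optimal_domain (cesaro_op t) disc_algebra f).
  { apply (opt_iff t _ 1 Ht (cesaro_acts t Ht)). split; [easy|].
    apply (pser_abs_ucont _ _ 2 (cesaro_acts t Ht f v Hf Hv) Sv). }
  apply Hsame, hardy_infty_iff in Hin. destruct Hin as [_ [M HM]].
  destruct (harmonic_unbounded (M / (1 - t))) as [N HN].
  assert (B := pser_positive_bounded (fun z => f z / den t z)%C (fun n => / INR (S n)) (M / (1 - t)) N).
  apply (Rlt_irrefl (M / (1 - t))). eapply Rlt_le_trans; [exact HN|]. apply B.
  - intros n. apply Rlt_le, Rinv_0_lt_compat, lt_0_INR. lia.
  - apply (pser_ext_coef _ (dcoef v)); [|apply Hv]. intros n. unfold dcoef, v. rewrite <- RtoC_mult. f_equal.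
    field. apply Rgt_not_eq, lt_0_INR. lia.
  - intros z Hz. apply div_den_bound; auto.
Qed.

(** * Hardy's inequality *)

(** The Hilbert kernel 1 / (j + l + 1) times the ratio of the weights sqrt (j + 1) and sqrt (l +
    1). *)
Definition hilbert_weight (j l : nat) : R :=
  sqrt (INR (S j)) / (sqrt (INR (S l)) * INR (S (j + l))).

(* Telescoping against [8 sqrt l / (sqrt l + sqrt m)], [m = j + 1]. *)
Lemma hilbert_weight_sum j N : rsum (hilbert_weight j) N <= 8.
Proof.
  set (b := sqrt (INR (S j))).
  assert (Hj : 0 < INR (S j)) by (apply lt_0_INR; lia).
  assert (b0 : 0 < b) by now apply sqrt_lt_R0.
  assert (bb : b * b = INR (S j)) by (apply sqrt_sqrt; lra).
  assert (S1 : forall n, rsum (hilbert_weight j) n <= 8 * (sqrt (INR n) / (sqrt (INR n) + b))).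
  { induction n as [|n IH].
    - simpl. rewrite sqrt_0. unfold Rdiv. lra.
    - cbn [rsum]. unfold hilbert_weight at 2. fold b.
      set (x := sqrt (INR n)) in *. set (y := sqrt (INR (S n))).
      assert (Hn : 0 <= INR n) by apply pos_INR.
      assert (Hn1 : 0 < INR (S n)) by (apply lt_0_INR; lia).
      assert (x0 : 0 <= x) by apply sqrt_pos. assert (y0 : 0 < y) by now apply sqrt_lt_R0.
      assert (xx : x * x = INR n) by (apply sqrt_sqrt; lra).
      assert (yy : y * y = INR n + 1) by (rewrite <- S_INR; apply sqrt_sqrt; lra).
      assert (xy : x <= y) by (apply sqrt_le_1; rewrite ?S_INR; lra).
      assert (D : y - x = 1 / (y + x)) by (field_simplify_eq; [nra|lra]).
      replace (INR (S (j + n))) with (b * b + y * y - 1).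
      2: { rewrite bb, yy, !S_INR, plus_INR. ring. }
      assert (B : 1 <= b * b) by (rewrite bb, S_INR; generalize (pos_INR j); lra).
      apply Rle_trans with (8 * (x / (x + b)) + 8 * (y / (y + b) - x / (x + b))); [|lra].
      apply Rplus_le_compat; [exact IH|].
      replace (y / (y + b) - x / (x + b)) with (b * (y - x) / ((y + b) * (x + b))) by (field; lra).
      rewrite D.
      (* Source of the constant 8: y + x <= 2 y, and (y + b)(x + b) <= (y + b)^2 <= 2 (b^2 + y^2) <=
         4 (b^2 + y^2 - 1), the last step because b^2 and y^2 are both at least 1. *)
      assert (Q : (y + x) * ((y + b) * (x + b)) <= 8 * (y * (b * b + y * y - 1))).
      { apply Rle_trans with ((2 * y) * (4 * (b * b + y * y - 1))); [|lra].
        apply Rmult_le_compat; [lra| |lra|].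
        - apply Rmult_le_pos; lra.
        - apply Rle_trans with ((y + b) * (y + b)); [apply Rmult_le_compat_l; lra|].
          nra. }
      assert (P1 : 0 < y * (b * b + y * y - 1)) by (apply Rmult_lt_0_compat; lra).
      assert (P2 : 0 < (y + x) * ((y + b) * (x + b))) by (repeat apply Rmult_lt_0_compat; lra).
      replace (8 * (b * (1 / (y + x)) / ((y + b) * (x + b)))) with (b * (8 / ((y + x) * ((y + b) * (x + b))))) by (field; repeat split; lra).
      unfold Rdiv at 1. apply Rmult_le_compat_l; [lra|].
      apply Rmult_le_reg_r with (y * (b * b + y * y - 1)); [easy|]. rewrite Rinv_l by lra.
      apply Rmult_le_reg_r with ((y + x) * ((y + b) * (x + b))); [easy|].
      replace (8 / ((y + x) * ((y + b) * (x + b))) * (y * (b * b + y * y - 1)) * ((y + x) * ((y + b) * (x + b))))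
        with (8 * (y * (b * b + y * y - 1))) by (field; repeat split; lra). lra. }
  eapply Rle_trans; [apply S1|]. assert (Z := sqrt_pos (INR N)).
  apply Rmult_le_reg_r with (sqrt (INR N) + b); [lra|].
  replace (8 * (sqrt (INR N) / (sqrt (INR N) + b)) * (sqrt (INR N) + b)) with (8 * sqrt (INR N)) by (field; lra). lra.
Qed.

Lemma rsum_triangle F N : rsum (fun n => rsum (fun j => F j (n - j)%nat) (S n)) N =
  rsum (fun j => rsum (F j) (N - j)) N.
Proof.
  induction N as [|N IH]; [easy|].
  change (rsum (fun n => rsum (fun j => F j (n - j)%nat) (S n)) N + rsum (fun j => F j (N - j)%nat) (S N) =
    rsum (fun j => rsum (F j) (S N - j)) (S N)).
  rewrite IH.
  replace (rsum (fun j => rsum (F j) (N - j)) N) with (rsum (fun j => rsum (F j) (N - j)) (S N))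
    by (cbn [rsum]; rewrite Nat.sub_diag; simpl; ring).
  rewrite <- rsum_plus. apply rsum_ext. intros j Hj.
  replace (S N - j)%nat with (S (N - j)) by lia. easy.
Qed.

Lemma rsum_swap F M N : rsum (fun j => rsum (F j) N) M = rsum (fun l => rsum (fun j => F j l) M) N.
Proof.
  induction M as [|M IH]; cbn [rsum].
  - induction N as [|N IHN]; cbn [rsum]; lra.
  - now rewrite IH, rsum_plus.
Qed.

Lemma hilbert_weight_nonneg j l : 0 <= hilbert_weight j l.
Proof.
  apply Rmult_le_pos; [apply sqrt_pos|]. apply Rlt_le, Rinv_0_lt_compat, Rmult_lt_0_compat.
  - apply sqrt_lt_R0, lt_0_INR. lia.
  - apply lt_0_INR. lia.
Qed.

(* Schur test with weights [sqrt ((j + 1) / (l + 1))]. *)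
Lemma hilbert_inequality (u w : nat -> R) N : (forall n, 0 <= u n) -> (forall n, 0 <= w n) ->
  rsum (fun n => rsum (fun j => u j * w (n - j)%nat) (S n) / INR (S n)) N <=
  4 * (rsum (fun n => u n ^ 2) N + rsum (fun n => w n ^ 2) N).
Proof.
  intros Hu Hw.
  set (F := fun j l => (u j ^ 2 * hilbert_weight j l + w l ^ 2 * hilbert_weight l j) / 2).
  assert (F0 : forall j l, 0 <= F j l).
  { intros j l. unfold F. generalize (hilbert_weight_nonneg j l) (hilbert_weight_nonneg l j).
    intros A B. nra. }
  assert (E : forall n, rsum (fun j => u j * w (n - j)%nat) (S n) / INR (S n) <= rsum (fun j => F j (n - j)%nat) (S n)).
  { intros n. unfold Rdiv. rewrite Rmult_comm, <- rsum_scal. apply rsum_le. intros j Hj.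
    unfold F, hilbert_weight. set (l := (n - j)%nat).
    replace (S (j + l)) with (S n) by (unfold l; lia). replace (S (l + j)) with (S n) by (unfold l; lia).
    assert (Hn : 0 < INR (S n)) by (apply lt_0_INR; lia).
    assert (Ha : 0 < sqrt (INR (S j))) by (apply sqrt_lt_R0, lt_0_INR; lia).
    assert (Hb : 0 < sqrt (INR (S l))) by (apply sqrt_lt_R0, lt_0_INR; lia).
    set (a := sqrt (INR (S j))) in *. set (b := sqrt (INR (S l))) in *. set (m := INR (S n)) in *.
    set (x := u j). set (y := w l).
    (* Completing the square: the weighted arithmetic mean exceeds the product x y / m by a multiple
       of (x a - y b)^2. *)
    replace ((x ^ 2 * (a / (b * m)) + y ^ 2 * (b / (a * m))) / 2) with
      (/ m * (x * y) + (x * a - y * b) ^ 2 / (2 * a * b * m)) by (field; repeat split; lra).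
    assert (0 <= (x * a - y * b) ^ 2 / (2 * a * b * m)); [|lra].
    apply Rmult_le_pos; [apply pow2_ge_0|]. apply Rlt_le, Rinv_0_lt_compat. repeat apply Rmult_lt_0_compat; lra. }
  eapply Rle_trans; [apply rsum_le; intros n _; apply E|]. rewrite rsum_triangle.
  (* The triangle j + l < N is enlarged to the full square, as [F] is nonnegative; then rows and
     columns are summed separately. *)
  apply Rle_trans with (rsum (fun j => rsum (F j) N) N).
  { apply rsum_le. intros j _. apply rsum_mono; [apply F0|lia]. }
  unfold F.
  rewrite (rsum_ext _ (fun j => / 2 * (u j ^ 2 * rsum (hilbert_weight j) N) + / 2 * rsum (fun l => w l ^ 2 * hilbert_weight l j) N)).
  2: { intros j _. rewrite <- rsum_scal, <- !rsum_scal, <- rsum_plus. apply rsum_ext. intros l _. field. }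
  rewrite rsum_plus, !rsum_scal, (rsum_swap (fun j l => w l ^ 2 * hilbert_weight l j)).
  assert (G : forall x : nat -> R, (forall n, 0 <= x n) ->
     rsum (fun j => x j ^ 2 * rsum (hilbert_weight j) N) N <= 8 * rsum (fun n => x n ^ 2) N).
  { intros x Hx. rewrite <- rsum_scal. apply rsum_le. intros j _. rewrite Rmult_comm.
    apply Rmult_le_compat_r; [apply pow_le, Hx|apply hilbert_weight_sum]. }
  assert (G1 := G u Hu). assert (G2 := G w Hw).
  rewrite (rsum_ext (fun l => rsum (fun j => w l ^ 2 * hilbert_weight l j) N) (fun l => w l ^ 2 * rsum (hilbert_weight l) N))
    by (intros l _; now rewrite rsum_scal).
  lra.
Qed.

(** * Polynomials, Blaschke factors and square roots *)

Fixpoint peval (p : list C) (z : C) : C :=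
  match p with nil => 0%C | a :: q => (a + z * peval q z)%C end.

(** Horner's scheme: the coefficients, in increasing order, of the quotient of [p] by z - w. The
    remainder is the value at w. *)
Fixpoint synth (p : list C) (w : C) : list C :=
  match p with
  | nil => nil
  | _ :: q => match q with nil => nil | _ => peval q w :: synth q w end
  end.

Lemma synth_spec p w z : peval p z = (peval p w + (z - w) * peval (synth p w) z)%C.
Proof.
  induction p as [|a q IH]; [simpl; ring|]. destruct q as [|b q]; [simpl; ring|].
  change (synth (a :: b :: q) w) with (peval (b :: q) w :: synth (b :: q) w).
  change (peval (a :: b :: q) z) with (a + z * peval (b :: q) z)%C.
  change (peval (a :: b :: q) w) with (a + w * peval (b :: q) w)%C.
  change (peval (peval (b :: q) w :: synth (b :: q) w) z) with
    (peval (b :: q) w + z * peval (synth (b :: q) w) z)%C.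
  rewrite IH at 1. ring.
Qed.

Lemma synth_length a p w : length (synth (a :: p) w) = length p.
Proof.
  revert a. induction p as [|b q IH]; intros a; [easy|].
  change (S (length (synth (b :: q) w)) = S (length q)). now rewrite IH.
Qed.

Lemma peval_pser p : pser (peval p) (fun n => nth n p 0%C).
Proof.
  induction p as [|a q IH].
  - apply (pser_ext_coef _ (fun _ => 0%C)); [intros [|n]; easy|]. split.
    + apply (tame_bounded _ 0). intros n. rewrite Cmod_0. lra.
    + intros z _. apply (cser_ext (fun _ => RtoC 0)); [intros; ring|apply cser_zero].
  - refine (pser_ext_coef _ _ _ _ (pser_mulz _ _ a IH)). now intros [|n].
Qed.

Lemma peval_cont p z : ccont (peval p) z.
Proof.
  induction p as [|a q IH]; unfold ccont in *; simpl; clim_tac.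
Qed.

(** Compares the circle of radius r with the unit circle at the price of an error linear in 1 - r,
    exactly what [abel_bound] absorbs. It is stable under sums and products, hence available for
    polynomials. *)
Definition radial_lipschitz (g : C -> C) : Prop := exists K, 0 <= K /\
  forall theta r, 0 <= r <= 1 -> Cmod (g (circ r theta)) <= K /\
    Cmod (g (circ r theta) - g (circ 1 theta)) <= K * (1 - r).

Lemma radial_const c : radial_lipschitz (fun _ => c).
Proof.
  exists (Cmod c). split; [apply Cmod_ge_0|]. intros theta r Hr. split; [lra|].
  replace (c - c)%C with (RtoC 0) by ring. rewrite Cmod_0. apply Rmult_le_pos; [apply Cmod_ge_0|lra].
Qed.

Lemma circ_scale r theta : circ r theta = (RtoC r * circ 1 theta)%C.
Proof. unfold circ. apply injective_projections; simpl; ring. Qed.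

Lemma radial_id : radial_lipschitz (fun z => z).
Proof.
  exists 1. split; [lra|]. intros theta r Hr. rewrite circ_mod by lra. split; [lra|].
  rewrite (circ_scale r). replace (RtoC r * circ 1 theta - circ 1 theta)%C with (- (RtoC (1 - r) * circ 1 theta))%C
    by (rewrite RtoC_minus; ring).
  rewrite Cmod_opp, scale_mod, circ_mod by lra. lra.
Qed.

Lemma radial_plus f g : radial_lipschitz f -> radial_lipschitz g -> radial_lipschitz (fun z => f z + g z)%C.
Proof.
  intros [K [K0 HK]] [L [L0 HL]]. exists (K + L). split; [lra|]. intros theta r Hr.
  destruct (HK theta r Hr) as [A1 A2], (HL theta r Hr) as [B1 B2]. split.
  - eapply Rle_trans; [apply Cmod_triangle|]. lra.
  - replace (f (circ r theta) + g (circ r theta) - (f (circ 1 theta) + g (circ 1 theta)))%C with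
      ((f (circ r theta) - f (circ 1 theta)) + (g (circ r theta) - g (circ 1 theta)))%C by ring.
    eapply Rle_trans; [apply Cmod_triangle|]. lra.
Qed.

Lemma radial_mult f g : radial_lipschitz f -> radial_lipschitz g -> radial_lipschitz (fun z => f z * g z)%C.
Proof.
  intros [K [K0 HK]] [L [L0 HL]]. exists (2 * K * L).
  assert (KL : 0 <= K * L) by now apply Rmult_le_pos.
  split; [lra|]. intros theta r Hr.
  destruct (HK theta r Hr) as [A1 A2], (HL theta r Hr) as [B1 B2]. destruct (HK theta 1 ltac:(lra)) as [A3 _]. split.
  - rewrite Cmod_mult. apply Rle_trans with (K * L); [|lra].
    apply Rmult_le_compat; try apply Cmod_ge_0; easy.
  - replace (f (circ r theta) * g (circ r theta) - f (circ 1 theta) * g (circ 1 theta))%C with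
      ((f (circ r theta) - f (circ 1 theta)) * g (circ r theta) + f (circ 1 theta) * (g (circ r theta) - g (circ 1 theta)))%C by ring.
    eapply Rle_trans; [apply Cmod_triangle|]. rewrite !Cmod_mult.
    apply Rle_trans with (K * (1 - r) * L + K * (L * (1 - r))); [|apply Req_le; ring].
    apply Rplus_le_compat; apply Rmult_le_compat; try apply Cmod_ge_0; easy.
Qed.

Lemma radial_peval p : radial_lipschitz (peval p).
Proof.
  induction p as [|a q IH]; [apply radial_const|].
  apply (radial_plus (fun _ => a)); [apply radial_const|]. apply radial_mult; [apply radial_id|easy].
Qed.

Lemma blaschke_identity (a z : C) :
  Cmod (1 - Cconj a * z) ^ 2 - Cmod (z - a) ^ 2 = (1 - Cmod z ^ 2) * (1 - Cmod a ^ 2).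
Proof. rewrite !Cmod2_alt. destruct a as [a1 a2], z as [x y]. unfold Re, Im. simpl. ring. Qed.

Lemma blaschke_le a z : Cmod a < 1 -> Cmod z <= 1 -> Cmod (z - a) <= Cmod (1 - Cconj a * z).
Proof.
  intros Ha Hz. assert (B := blaschke_identity a z). assert (A0 := Cmod_ge_0 a). assert (Z0 := Cmod_ge_0 z).
  apply Rsqr_incr_0_var; [|apply Cmod_ge_0]. rewrite !Rsqr_pow2.
  assert (0 <= (1 - Cmod z ^ 2) * (1 - Cmod a ^ 2)) by (apply Rmult_le_pos; nra). lra.
Qed.

Lemma blaschke_eq a z : Cmod z = 1 -> Cmod (z - a) = Cmod (1 - Cconj a * z).
Proof.
  intros Hz. assert (B := blaschke_identity a z). rewrite Hz in B.
  apply Rsqr_inj; try apply Cmod_ge_0. rewrite !Rsqr_pow2. lra.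
Qed.

(** Induction on the number of coefficients. A zero a in the open disc is divided out, and z - a is
    written as (z - a) / (1 - conj(a) z) times 1 - conj(a) z: the quotient joins [B], the other
    factor joins [g], and |1 - conj(a) z| = |z - a| on the unit circle. Zeros on the unit circle
    stay in [g], which must be nonzero only inside. *)
Lemma blaschke_factorization n : forall p, (length p <= n)%nat ->
  (forall z, peval p z = 0%C) \/
  exists B g : C -> C, hol B /\ hol g /\ radial_lipschitz g /\
    (forall z, unit_disc z -> peval p z = (B z * g z)%C /\ Cmod (B z) <= 1 /\ g z <> 0%C) /\
    (forall theta, Cmod (g (circ 1 theta)) = Cmod (peval p (circ 1 theta))).
Proof.
  induction n as [|n IH]; intros p Hp.
  - left. destruct p; [easy|simpl in Hp; lia].
  - destruct p as [|c p]; [now left|].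
    destruct (classic (exists a, unit_disc a /\ peval (c :: p) a = 0%C)) as [[a [Ha H0]]|Hno].
    + assert (E : forall z, peval (c :: p) z = ((z - a) * peval (synth (c :: p) a) z)%C).
      { intros z. rewrite (synth_spec (c :: p) a z), H0. ring. }
      destruct (IH (synth (c :: p) a)) as [Hz|(B & g & HB & Hg & Rg & H1 & H2)].
      { rewrite synth_length. simpl in Hp. lia. }
      * left. intros z. rewrite E, Hz. ring.
      * right. set (d := fun z => (1 - Cconj a * z)%C).
        assert (Dd : forall z, unit_disc z -> d z <> 0%C).
        { intros z Hz. unfold unit_disc in *. apply Cmod_gt_0.
          generalize (Cmod_rev 1 (Cconj a * z)). unfold d. rewrite Cmod_1, Cmod_mult, Cmod_conj.
          generalize (Cmod_ge_0 a) (Cmod_ge_0 z). nra. }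
        assert (Cd : forall z, cder d z (- Cconj a)%C).
        { intros z. eapply cder_eq; [apply cder_minus; [apply cder_const|apply cder_scal, cder_id]|ring]. }
        exists (fun z => (z - a) / d z * B z)%C, (fun z => d z * g z)%C. repeat split.
        -- apply (hol_mult (fun z => (z - a) / d z)%C); [|easy]. intros z Hz. eexists.
           apply (cder_div (fun z => z - a)%C d); [now apply Dd| |apply Cd].
           apply cder_minus; [apply cder_id|apply cder_const].
        -- apply hol_mult; [|easy]. intros z Hz. eexists. apply Cd.
        -- apply radial_mult; [|easy].
           apply (radial_plus (fun _ => 1%C) (fun z => - (Cconj a * z))%C); [apply radial_const|].
           assert (R1 := radial_mult _ _ (radial_const (- Cconj a)%C) radial_id). cbv beta in R1.
           destruct R1 as [K [K0 HK]]. exists K. split; [easy|]. intros theta r Hr.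
           specialize (HK theta r Hr).
           replace (- (Cconj a * circ r theta))%C with (- Cconj a * circ r theta)%C by ring.
           now replace (- (Cconj a * circ 1 theta))%C with (- Cconj a * circ 1 theta)%C by ring.
        -- rewrite E. destruct (H1 z H) as [-> _]. field. now apply Dd.
        -- rewrite Cmod_mult, Cmod_div by now apply Dd. destruct (H1 z H) as [_ [HB1 _]].
           assert (L := blaschke_le a z Ha (Rlt_le _ _ H)). fold (d z) in L.
           assert (P : 0 < Cmod (d z)) by now apply Cmod_gt_0, Dd.
           rewrite <- (Rmult_1_l 1). apply Rmult_le_compat; try apply Cmod_ge_0; [| |easy].
           ++ apply Rmult_le_pos; [apply Cmod_ge_0|]. now apply Rlt_le, Rinv_0_lt_compat.
           ++ apply Rmult_le_reg_r with (Cmod (d z)); [easy|]. unfold Rdiv. rewrite Rmult_assoc, Rinv_l; lra.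
        -- apply Cmult_neq_0; [now apply Dd|]. now apply H1.
        -- intros theta. rewrite E, !Cmod_mult, H2. unfold d. rewrite <- blaschke_eq; [easy|]. apply circ_mod. lra.
    + right. exists (fun _ => 1%C), (peval (c :: p)). repeat split.
      * intros z _. eexists. apply cder_const.
      * apply (pser_hol _ _ (peval_pser _)).
      * apply radial_peval.
      * ring.
      * rewrite Cmod_1. lra.
      * intros E. apply Hno. now exists z.
Qed.

(** Take k = exp L with L the primitive of g' / (2 g) vanishing at 0; then g exp(-2 L) has
    derivative 0 and equals g(0). Keeping g(0) as a factor avoids the choice of a complex root of
    it. *)
Lemma nonvanishing_square_root g : hol g -> (forall z, unit_disc z -> g z <> 0%C) ->
  exists k, hol k /\ (forall z, unit_disc z -> g z = (g 0%C * (k z * k z))%C) /\ (forall z, k z <> 0%C).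
Proof.
  intros Hg Hnz. destruct (hol_pser g Hg) as [a Ha].
  destruct (pser_exists (dcoef a) (tame_dcoef _ (proj1 Ha))) as [g' Hg'].
  assert (Dg : forall z, unit_disc z -> cder g z (g' z)) by (intros z Hz; now apply (pser_cder g g' a)).
  set (q := fun z => (g' z / (2 * g z))%C).
  assert (H2 : RtoC 2 <> 0%C) by (intros E; apply RtoC_inj in E; lra).
  assert (Hq : hol q).
  { intros z Hz. destruct (pser_hol _ _ Hg' z Hz) as [l Hl]. eexists. unfold q.
    apply cder_div; [apply Cmult_neq_0; auto|exact Hl|]. apply cder_scal. now apply Dg. }
  set (L := prim q). assert (DL : forall z, unit_disc z -> cder L z (q z)) by (intros; now apply prim_cder).
  exists (fun z => Cexp (L z)). split; [|split].
  - intros z Hz. eexists. apply (cder_comp Cexp L); [apply Cexp_cder|now apply DL].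
  - set (phi := fun z => (g z * Cexp (- (L z + L z)))%C).
    assert (Dphi : forall z, unit_disc z -> cder phi z 0%C).
    { intros z Hz. eapply cder_eq.
      - apply (cder_mult g (fun z => Cexp (- (L z + L z)))%C); [now apply Dg|].
        apply (cder_comp Cexp (fun z => - (L z + L z))%C); [apply Cexp_cder|].
        apply cder_opp, cder_plus; now apply DL.
      - unfold q. field. auto. }
    intros z Hz.
    assert (Dz : dcont (fun _ => 0%C)) by (intros x _; unfold ccont; clim_tac).
    assert (E := seg_FTC phi (fun _ => 0%C) 0%C z Dphi Dz unit_disc_0 Hz).
    unfold seg in E. rewrite CInt_const, Cmult_0_r, Cmult_0_r in E by lra.
    assert (E1 : phi z = phi 0%C) by (replace (phi z) with (phi z - phi 0 + phi 0)%C by ring; rewrite <- E; ring).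
    assert (L0 : L 0%C = 0%C) by (unfold L, prim, seg; ring).
    assert (E2 : phi 0%C = g 0%C).
    { unfold phi. rewrite L0. replace (- (0 + 0))%C with (RtoC 0) by ring.
      replace (Cexp 0) with (RtoC 1); [ring|].
      unfold Cexp; simpl. rewrite exp_0, cos_0, sin_0. apply injective_projections; simpl; ring. }
    rewrite <- E2, <- E1. unfold phi. rewrite <- Cexp_plus, <- Cmult_assoc, <- Cexp_plus.
    replace (- (L z + L z) + (L z + L z))%C with (RtoC 0) by ring.
    replace (Cexp 0) with (RtoC 1); [ring|].
    unfold Cexp; simpl. rewrite exp_0, cos_0, sin_0. apply injective_projections; simpl; ring.
  - intros z. apply Cexp_nz.
Qed.

(** From P = B g and g = g(0) k^2 the modulus of g(0) is shared out by s = sqrt |g(0)|: the factors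
    become (g(0) / s) B k and s k. The second has squared modulus |g|, compared radially with |P| on
    the unit circle, and the first is no larger because |B| <= 1. *)
Lemma polynomial_split p : (forall z, peval p z = 0%C) \/
  exists b k K, hol b /\ hol k /\ (forall z, unit_disc z -> peval p z = (b z * k z)%C) /\
    forall theta r, 0 <= r < 1 ->
      Cmod (b (circ r theta)) ^ 2 <= Cmod (peval p (circ 1 theta)) + K * (1 - r) /\
      Cmod (k (circ r theta)) ^ 2 <= Cmod (peval p (circ 1 theta)) + K * (1 - r).
Proof.
  destruct (blaschke_factorization (length p) p (le_n _)) as [H|(B & g & HB & Hg & [K [K0 HK]] & H1 & H2)]; [now left|].
  right. destruct (nonvanishing_square_root g Hg) as [k [Hk [Eg Nk]]]; [intros z Hz; now apply H1|].
  assert (Hc : g 0%C <> 0%C) by (apply H1, unit_disc_0).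
  assert (Pc : 0 < Cmod (g 0%C)) by now apply Cmod_gt_0.
  set (s := sqrt (Cmod (g 0%C))).
  assert (Ps : 0 < s) by now apply sqrt_lt_R0.
  assert (ss : s * s = Cmod (g 0%C)) by (apply sqrt_sqrt; lra).
  assert (Ns : RtoC s <> 0%C) by (intros E; apply RtoC_inj in E; lra).
  assert (Hk2 : forall theta r, 0 <= r < 1 -> Cmod (fscal (RtoC s) k (circ r theta)) ^ 2 <= Cmod (peval p (circ 1 theta)) + K * (1 - r)).
  { intros theta r Hr. unfold fscal. rewrite scale_mod by lra.
    assert (E := Eg (circ r theta) (circ_disc r theta Hr)).
    replace ((s * Cmod (k (circ r theta))) ^ 2) with (Cmod (g (circ r theta))).
    2: { rewrite E, !Cmod_mult, <- ss. ring. }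
    rewrite <- H2. assert (R := proj2 (HK theta r ltac:(lra))).
    generalize (Cmod_rev (g (circ r theta)) (g (circ 1 theta))). lra. }
  exists (fscal (g 0%C / RtoC s)%C (fun z => B z * k z)%C), (fscal (RtoC s) k), K. repeat split.
  - apply hol_scal. now apply hol_mult.
  - now apply hol_scal.
  - intros z Hz. destruct (H1 z Hz) as [-> _]. rewrite (Eg z Hz) at 1. unfold fscal. field. easy.
  - eapply Rle_trans; [|apply (Hk2 theta r H)]. apply pow_incr. split; [apply Cmod_ge_0|].
    unfold fscal. rewrite Cmod_mult, scale_mod, Cmod_div, Cmod_R, (Rabs_pos_eq s) by (easy || lra).
    rewrite <- ss. replace (s * s / s) with s by (field; lra). apply Rmult_le_compat_l; [lra|].
    rewrite Cmod_mult. destruct (H1 (circ r theta) (circ_disc r theta H)) as [_ [HB1 _]].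
    generalize (Cmod_ge_0 (k (circ r theta))). nra.
  - now apply Hk2.
Qed.

Definition circle_mean (p : R -> R) : R := / (2 * PI) * RInt p 0 (2 * PI).

Lemma continuous_RInt (p : R -> R) : (forall x, continuous p x) -> is_RInt p 0 (2 * PI) (RInt p 0 (2 * PI)).
Proof. intros H. apply (@RInt_correct R_CompleteNormedModule), (@ex_RInt_continuous R_CompleteNormedModule). auto. Qed.

Lemma circle_integral_le p q c d : (forall x, continuous q x) ->
  (forall x, p x <= c * q x + d) -> forall I, is_RInt p 0 (2 * PI) I ->
  I <= 2 * PI * (c * circle_mean q + d).
Proof.
  intros Hq H I HI. assert (P := two_PI_pos).
  assert (I1 := is_RInt_plus _ _ _ _ _ _ (is_RInt_scal _ 0 (2 * PI) c _ (continuous_RInt q Hq)) (@is_RInt_const R_NormedModule 0 (2 * PI) d)).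
  replace (2 * PI * (c * circle_mean q + d)) with (plus (scal c (RInt q 0 (2 * PI))) (scal (2 * PI - 0) (d : R_NormedModule)) : R).
  - apply (is_RInt_le _ _ 0 (2 * PI) _ _ ltac:(lra) HI I1). intros x _. apply H.
  - unfold circle_mean, plus, scal; simpl; unfold mult; simpl. field. generalize PI_RGT_0. lra.
Qed.

Lemma bessel_mean f a r N q c d : pser f a -> 0 <= r < 1 -> (forall x, continuous q x) ->
  (forall x, Cmod (f (circ r x)) ^ 2 <= c * q x + d) ->
  rsum (fun n => (Cmod (a n) * r ^ n) ^ 2) N <= c * circle_mean q + d.
Proof.
  intros Hf Hr Hq H. assert (P := two_PI_pos). apply Rmult_le_reg_l with (2 * PI); [easy|].
  rewrite (rsum_ext _ (fun n => Cmod (a n) ^ 2 * (r ^ 2) ^ n)).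
  - eapply Rle_trans; [apply (bessel N f a r Hf Hr)|].
    apply (circle_integral_le _ q c d Hq H). apply sq_mean_correct; [|easy]. apply hol_dcont, (pser_hol f a Hf).
  - intros n _. rewrite Rpow_mult_distr, <- !pow_mult. now rewrite (Nat.mul_comm n).
Qed.

(** The coefficients of P are Cauchy products of those of b and k, so Hilbert's inequality bounds
    the sum by 4 times two square sums. By Bessel each is at most the mean of |P| plus K (1 - r);
    this explains 8 and the error 8 K (1 - r), removed by [abel_bound]. *)
Lemma hardy_inequality_polynomial (p : list C) N :
  rsum (fun n => Cmod (nth n p 0%C) / INR (S n)) N <= 8 * circle_mean (fun x => Cmod (peval p (circ 1 x))).
Proof.
  set (q := fun x => Cmod (peval p (circ 1 x))).
  assert (Hq : forall x, continuous q x).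
  { intros x. apply pcont_Cmod. apply pcont_comp; [apply peval_cont|apply circ_pcont]. }
  assert (Hin : forall n, 0 < INR (S n)) by (intros; apply lt_0_INR; lia).
  destruct (polynomial_split p) as [H0|(b & k & K & Hb & Hk & E & HK)].
  - assert (Z : forall n, nth n p 0%C = 0%C).
    { intros n. apply Cmod_eq_0, Rle_antisym; [|apply Cmod_ge_0].
      apply (coef_bound _ _ 0 n (peval_pser p)). intros z _. rewrite H0, Cmod_0. lra. }
    rewrite (rsum_ext _ (fun _ => 0 * 0)) by (intros n _; rewrite Z, Cmod_0; unfold Rdiv; ring).
    rewrite (rsum_scal 0 (fun _ => 0)).
    assert (G := circle_integral_le (fun _ => 0) q 1 0 Hq ltac:(intros; unfold q; generalize (Cmod_ge_0 (peval p (circ 1 x))); lra) _ (@is_RInt_const R_NormedModule 0 (2 * PI) 0)).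
    unfold scal in G; simpl in G; unfold mult in G; simpl in G. generalize two_PI_pos. nra.
  - apply (abel_bound _ N _ (8 * K)).
    { intros n. apply Rmult_le_pos; [apply Cmod_ge_0|]. now apply Rlt_le, Rinv_0_lt_compat. }
    intros r Hr. destruct (hol_pser b Hb) as [u Hu]. destruct (hol_pser k Hk) as [w Hw].
    assert (Ec : forall n, nth n p 0%C = conv u w n).
    { apply (pser_unique (peval p)); [apply peval_pser|].
      apply (pser_ext (fun z => b z * k z)%C); [intros; symmetry; now apply E|]. now apply pser_mult. }
    set (u' := fun n => Cmod (u n) * r ^ n). set (w' := fun n => Cmod (w n) * r ^ n).
    assert (P0 : forall (x : nat -> C) n, 0 <= Cmod (x n) * r ^ n).
    { intros x n. apply Rmult_le_pos; [apply Cmod_ge_0|apply pow_le; lra]. }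
    assert (Bu : rsum (fun n => u' n ^ 2) N <= 1 * circle_mean q + K * (1 - r)).
    { apply (bessel_mean b u r N q 1 _ Hu Hr Hq). intros x. rewrite Rmult_1_l. now apply HK. }
    assert (Bw : rsum (fun n => w' n ^ 2) N <= 1 * circle_mean q + K * (1 - r)).
    { apply (bessel_mean k w r N q 1 _ Hw Hr Hq). intros x. rewrite Rmult_1_l. now apply HK. }
    assert (HI := hilbert_inequality u' w' N (P0 u) (P0 w)).
    apply Rle_trans with (rsum (fun n => rsum (fun j => u' j * w' (n - j)%nat) (S n) / INR (S n)) N); [|lra].
    apply rsum_le. intros n _.
    replace (Cmod (nth n p 0%C) / INR (S n) * r ^ n) with (Cmod (nth n p 0%C) * r ^ n / INR (S n))
      by (unfold Rdiv; ring).
    apply Rmult_le_compat_r; [now apply Rlt_le, Rinv_0_lt_compat|]. rewrite Ec. unfold conv.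
    eapply Rle_trans; [apply Rmult_le_compat_r; [apply pow_le; lra|apply csum_norm]|].
    rewrite Rmult_comm, <- rsum_scal. apply Req_le, rsum_ext. intros j Hj. unfold u', w'. rewrite Cmod_mult.
    replace (r ^ n) with (r ^ j * r ^ (n - j)) by (rewrite <- pow_add; f_equal; lia). ring.
Qed.

Fixpoint coef_list (a : nat -> C) (m : nat) : list C :=
  match m with O => nil | S k => a O :: coef_list (fun n => a (S n)) k end.

Lemma peval_coef_list m : forall a z, peval (coef_list a m) z = csum (fun n => a n * z ^ n)%C m.
Proof.
  induction m as [|m IH]; intros a z; [easy|].
  rewrite csum_shift. simpl peval. rewrite IH, <- csum_scal. f_equal; [simpl; ring|].
  apply csum_ext. intros n _. rewrite Cpow_S. ring.
Qed.

Lemma nth_coef_list m : forall a n, (n < m)%nat -> nth n (coef_list a m) 0%C = a n.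
Proof.
  induction m as [|m IH]; intros a n Hn; [lia|]. destruct n as [|n]; [easy|]. simpl. rewrite IH; [easy|lia].
Qed.

Lemma circle_mean_integral_mean h r : circle_mean (fun x => Cmod (h (circ r x))) = integral_mean h r.
Proof. reflexivity. Qed.

(** The polynomial case is applied to a long Taylor polynomial of the dilate h(r z), whose mean on
    the unit circle is close to the mean of |h| on the circle of radius r; afterwards r tends to
    1. *)
Lemma hardy_inequality h a M N : pser h a -> (forall r, 0 <= r < 1 -> integral_mean h r <= M) ->
  rsum (fun n => Cmod (a n) / INR (S n)) N <= 8 * M.
Proof.
  intros Hh HM. assert (Hin : forall n, 0 < INR (S n)) by (intros; apply lt_0_INR; lia).
  apply (abel_bound _ N _ 0).
  { intros n. apply Rmult_le_pos; [apply Cmod_ge_0|]. now apply Rlt_le, Rinv_0_lt_compat. }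
  intros r Hr. rewrite Rmult_0_l, Rplus_0_r.
  (* [eta] will bound the uniform distance on the circle between the dilate and its Taylor
     polynomial; it enters the estimate with the constant 8 of the polynomial case. *)
  apply (le_of_le_add _ _ 8). intros eta Heta.
  destruct (tame_geom a r (proj1 Hh) Hr) as (A & q & A0 & Hq & HA).
  assert (Em : exists m, (N <= m)%nat /\ A / (1 - q) * q ^ m <= eta).
  { assert (C0 : 0 <= A / (1 - q)) by (apply Rmult_le_pos; [easy|apply Rlt_le, Rinv_0_lt_compat; lra]).
    destruct (pow_lt_1_zero q ltac:(rewrite Rabs_pos_eq; lra) (eta / (A / (1 - q) + 1)) ltac:(apply Rdiv_lt_0_compat; lra)) as [m0 Hm].
    exists (max N m0). split; [lia|]. specialize (Hm (max N m0) ltac:(lia)).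
    assert (Q : 0 <= q ^ max N m0) by now apply pow_le. rewrite Rabs_pos_eq in Hm by easy.
    apply (Rmult_lt_compat_r (A / (1 - q) + 1)) in Hm; [|lra].
    replace (eta / (A / (1 - q) + 1) * (A / (1 - q) + 1)) with eta in Hm by (field; lra). nra. }
  destruct Em as [m [HNm Hm]].
  set (p := coef_list (fun n => a n * RtoC r ^ n)%C m).
  assert (B := hardy_inequality_polynomial p N).
  rewrite (rsum_ext _ (fun n => Cmod (a n) / INR (S n) * r ^ n)) in B.
  2: { intros n Hn. unfold p. rewrite nth_coef_list by lia.
       rewrite Cmod_mult, Cmod_pow, Cmod_R, Rabs_pos_eq by lra. unfold Rdiv. ring. }
  eapply Rle_trans; [exact B|].
  assert (Dh : dcont h) by apply hol_dcont, (pser_hol h a Hh).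
  assert (Hc : forall x, continuous (fun x => Cmod (h (circ r x))) x).
  { intros x. now apply pcont_Cmod, circ_pcont_comp. }
  assert (Hp : forall x, continuous (fun x => Cmod (peval p (circ 1 x))) x).
  { intros x. apply pcont_Cmod, pcont_comp; [apply peval_cont|apply circ_pcont]. }
  assert (D := circle_integral_le (fun x => Cmod (peval p (circ 1 x))) (fun x => Cmod (h (circ r x))) 1 eta Hc).
  assert (D' := fun H => D H _ (continuous_RInt _ Hp)). clear D.
  rewrite circle_mean_integral_mean in D'. specialize (HM r Hr).
  assert (P := two_PI_pos). unfold circle_mean.
  assert (D2 : RInt (fun x => Cmod (peval p (circ 1 x))) 0 (2 * PI) <= 2 * PI * (M + eta)).
  { eapply Rle_trans; [apply D'|].
    - intros x. rewrite Rmult_1_l.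
      assert (Ux := circ_disc r x Hr).
      assert (T : Cmod (h (circ r x) - csum (fun n => a n * circ r x ^ n)%C m) <= A / (1 - q) * q ^ m).
      { apply cser_geom_tail; [easy|easy| |now apply Hh]. intros n. rewrite term_mod, circ_mod by lra. apply HA. }
      replace (peval p (circ 1 x)) with (csum (fun n => a n * circ r x ^ n)%C m).
      2: { unfold p. rewrite peval_coef_list. apply csum_ext. intros n _.
           rewrite (circ_scale r x), Cpow_mult_l. ring. }
      generalize (Cmod_rev (csum (fun n => a n * circ r x ^ n)%C m) (h (circ r x))). rewrite Cmod_sym. lra.
    - apply Rmult_le_compat_l; lra. }
  apply Rle_trans with (8 * (/ (2 * PI) * (2 * PI * (M + eta)))).
  - apply Rmult_le_compat_l; [lra|]. apply Rmult_le_compat_l; [apply Rlt_le, Rinv_0_lt_compat; lra|easy].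
  - apply Req_le. field. generalize PI_RGT_0. lra.
Qed.

(** Division by 1 - t z multiplies the integral means by at most 1 / (1 - t). In Hardy's inequality
    the weight 1 / (n + 1) cancels the factor in [dcoef], leaving the moduli of the coefficients of
    [cesaro_op t f] themselves. *)
Lemma hardy_one_in_cesaro t : 0 <= t < 1 -> contained hardy_one (optimal_domain (cesaro_op t) disc_algebra).
Proof.
  intros Ht f [Ha [M HM]]. assert (Hf := proj2 (hol_analytic f) Ha).
  apply (opt_iff t _ 1 Ht (cesaro_acts t Ht)). split; [easy|].
  destruct (hcoef_exists t f Ht Hf) as [v Hv].
  assert (P := two_PI_pos).
  apply (pser_abs_ucont _ _ (8 * (M / (1 - t))) (cesaro_acts t Ht f v Hf Hv)). intros n. cbn [Nat.add].
  assert (B := hardy_inequality _ (dcoef v) (M / (1 - t)) n (proj2 Hv)).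
  rewrite (rsum_ext _ (fun k => Cmod (v (S k)))) in B.
  2: { intros k _. unfold dcoef. assert (0 < INR (S k)) by (apply lt_0_INR; lia).
       rewrite scale_mod by lra. field. lra. }
  apply B. intros r Hr. specialize (HM r Hr).
  assert (Df := hol_dcont f Hf). assert (Dh := hol_dcont _ (hol_div_den t f Ht Hf)).
  assert (Hc : forall x, continuous (fun x => Cmod (f (circ r x))) x) by (intros; now apply pcont_Cmod, circ_pcont_comp).
  assert (Hh : forall x, continuous (fun x => Cmod (f (circ r x) / den t (circ r x))) x).
  { intros x. apply pcont_Cmod. now apply (circ_pcont_comp (fun z => f z / den t z)%C). }
  assert (D := circle_integral_le (fun x => Cmod (f (circ r x) / den t (circ r x))) (fun x => Cmod (f (circ r x))) (/ (1 - t)) 0 Hc).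
  assert (D' : RInt (fun x => Cmod (f (circ r x) / den t (circ r x))) 0 (2 * PI) <= 2 * PI * (/ (1 - t) * integral_mean f r + 0)).
  { apply D; [|now apply continuous_RInt]. intros x. rewrite Rplus_0_r, Rmult_comm.
    apply div_den_bound; [easy|now apply circ_disc|lra]. }
  assert (I1 : 0 < / (1 - t)) by (apply Rinv_0_lt_compat; lra).
  apply Rle_trans with (/ (2 * PI) * (2 * PI * (/ (1 - t) * integral_mean f r + 0))).
  - apply Rmult_le_compat_l; [apply Rlt_le, Rinv_0_lt_compat; lra|exact D'].
  - rewrite <- Rmult_assoc, Rinv_l, Rmult_1_l, Rplus_0_r by lra. unfold Rdiv. rewrite Rmult_comm.
    apply Rmult_le_compat_r; lra.
Qed.

Theorem proposition4p8 (t : R) (ht : (0 <= t < 1)%R) :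
  equal_as_banach_spaces
    (optimal_domain (volterra_op (g_log t)) disc_algebra)
    (optimal_domain (cesaro_op t) disc_algebra) /\
  proper_subspace hardy_infty (optimal_domain (cesaro_op t) disc_algebra) /\
  (contained hardy_one (optimal_domain (cesaro_op t) disc_algebra) /\
   contained (optimal_domain (cesaro_op t) disc_algebra) little_growth_space) /\
  (contained hardy_one (optimal_domain (cesaro_op t) hardy_infty) /\
   contained (optimal_domain (cesaro_op t) hardy_infty) growth_space).
Proof.
  split; [now apply equal_volterra_cesaro|]. split; [now apply hardy_infty_proper|].
  split; split.
  - now apply hardy_one_in_cesaro.
  - now apply cesaro_disc_algebra_little_growth.
  - intros f Hf. destruct (hardy_one_in_cesaro t ht f Hf) as [H1 H2]. split; [easy|].
    apply disc_algebra_iff in H2. apply hardy_infty_iff. split; [apply H2|]. now apply ucont_bounded.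
  - now apply cesaro_hardy_infty_growth.
Qed.
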